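(* The Chacon system $(X,T)$ (viewed as a $\mathbb{Z}$-action generated by the shift $T$) is weakly IC-rigid but not IC-rigid.
   Context: Chacon system: let $b_1=0010$ and $b_{n+1}=b_nb_n1b_n$ (concatenation) for $n\ge1$. $X\subset\{0,1\}^{\mathbb{Z}}$ is the subshift consisting of all bi-infinite sequences all of whose finite subwords occur as a subword of some $b_n$, and $T\colon X\to X$ is the left shift, $(Tx)_i=x_{i+1}$. $\mathcal{K}(X)$ is the space of nonempty compact subsets of $X$ with the Hausdorff metric, with the induced action $T\cdot A=T(A)$. An invariant random compact (IRC) is a Borel probability measure on $\mathcal{K}(X)$ invariant under this induced action. $\delta_X$ denotes the Dirac mass at the point $X\in\mathcal{K}(X)$. $\mathcal{K}_{\mathrm{fin}}(X)$ and $\mathcal{K}_{\mathrm{ct}}(X)$ denote the sets of finite, respectively countable (finite or countably infinite), members of $\mathcal{K}(X)$. An IRC $\mu$ is nonfinitary if $\mu(\mathcal{K}_{\mathrm{fin}}(X))=0$. The system is IC-rigid if the only nonfinitary IRC is $\delta_X$. For an IRC $\mu$, let $\tilde\mu$ be the completion of $\mu$ (the set $\mathcal{K}_{\mathrm{ct}}(X)$ is coanalytic, hence $\tilde\mu$-measurable). The system is weakly IC-rigid if the only IRC $\mu$ satisfying $\tilde\mu(\mathcal{K}_{\mathrm{ct}}(X))=0$ is $\delta_X$. *)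

(* Defs.v *)
From HB Require Import structures.
From mathcomp Require Import all_boot all_order all_algebra.
From mathcomp Require Import finmap.
From mathcomp Require Import all_classical all_reals all_analysis.
From mathcomp Require Import lra zify.

Set Implicit Arguments.
Unset Strict Implicit.
Unset Printing Implicit Defensive.
Import Order.TTheory GRing.Theory Num.Theory.
Import numFieldNormedType.Exports.

Local Open Scope classical_set_scope.
Local Open Scope ring_scope.

#[short(type="pmetricType")]
HB.structure Definition PointedMetric (R : numDomainType) :=
  {M of Pointed M & Metric R M}.

Section subset_metric.
Context {R : realType} {M : metricType R} (A : set M).

Let dist (x y : A) : R := mdist (\val x) (\val y).

Let dist_ge0 x y : 0 <= dist x y. Proof. exact: mdist_ge0. Qed.

Let dist_positivity x y : dist x y = 0 -> x = y.
Proof. by move=> /mdist_positivity xy; exact: val_inj. Qed.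

Let ballEdist x d : ball x d = [set y : A | dist x y < d].
Proof.
by rewrite -initial_ballE; apply/seteqP; split => y /=; rewrite ballEmdist.
Qed.

HB.instance Definition _ :=
  @PseudoMetric_isMetric.Build R (set_type A) dist dist_ge0 dist_positivity
    ballEdist.

End subset_metric.

Section hyperspace.
Context {R : realType} (M : metricType R).

Record hyperspace := Hyperspace {
  hset :> set M ;
  hset_neq0 : hset !=set0 ;
  hset_compact : compact hset }.

HB.instance Definition _ := gen_eqMixin hyperspace.
HB.instance Definition _ := gen_choiceMixin hyperspace.

Lemma hyperspace_eq (A B : hyperspace) : A = B :> set M -> A = B.
Proof.
case: A B => [A A0 Ac] [B B0 Bc] /= AB; case: B / AB B0 Bc => B0 Bc.
by rewrite (Prop_irrelevance A0 B0) (Prop_irrelevance Ac Bc).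
Qed.

Definition point_dist (x : M) (B : set M) : R := inf [set mdist x b | b in B].

Definition excess (A B : set M) : R := sup [set point_dist a B | a in A].

Definition hausdorff_dist (A B : hyperspace) : R :=
  Num.max (excess A B) (excess B A).

Implicit Types A B C : hyperspace.

Let has_inf_dist x B : has_inf [set mdist x b | b in hset B].
Proof.
have [b Bb] := hset_neq0 B; split; first by exists (mdist x b), b.
by exists 0 => _ [c _ <-]; exact: mdist_ge0.
Qed.

Lemma point_dist_ge0 x B : 0 <= point_dist x B.
Proof.
apply: lb_le_inf; first by case: (has_inf_dist x B).
by move=> _ [c _ <-]; exact: mdist_ge0.
Qed.

Lemma point_dist_le x B b : hset B b -> point_dist x B <= mdist x b.
Proof.
by move=> Bb; apply: ge_inf; [case: (has_inf_dist x B)|exists b].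
Qed.

Lemma point_dist_lt x B e : point_dist x B < e ->
  exists2 b, hset B b & mdist x b < e.
Proof.
move=> /inf_lt[|_ [b Bb <-] ?]; last by exists b.
by case: (has_inf_dist x B).
Qed.

Lemma point_dist_lip x y B : point_dist x B <= mdist x y + point_dist y B.
Proof.
rewrite -lerBlDl; apply: lb_le_inf; first by case: (has_inf_dist y B).
move=> _ [b Bb <-]; rewrite lerBlDl.
exact: (le_trans (point_dist_le x Bb) (metric_triangle _ _ _)).
Qed.

Lemma mdist_continuous (x : M) : continuous (mdist x : M -> R).
Proof.
move=> y; apply/cvgrPdist_lt => e e0; near=> z.
have yz : mdist y z < e.
  by near: z; have := nbhsx_ballx y e e0; rewrite ballEmdist.
rewrite (le_lt_trans _ yz)//.
have := metric_triangle x y z; have := metric_triangle x z y.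
by rewrite (metric_sym z y) ler_norml => xzy xyz; apply/andP; split; lra.
Unshelve. all: by end_near. Qed.

Let excess_has_sup A B : has_sup [set point_dist a B | a in hset A].
Proof.
have [a0 Aa0] := hset_neq0 A; split; first by exists (point_dist a0 B), a0.
have [|c _ cmax] := @compact_EVT_max M R (mdist a0) (hset A) (hset_neq0 A)
  (@hset_compact A).
  by apply: continuous_subspaceT; exact: mdist_continuous.
exists (mdist a0 c + point_dist a0 B) => _ [a Aa <-].
rewrite (le_trans (point_dist_lip a a0 B))// lerD2r metric_sym.
by apply: cmax; rewrite inE.
Qed.

Lemma point_dist_le_excess A B a : hset A a -> point_dist a B <= excess A B.
Proof. by move=> Aa; apply: ub_le_sup; [case: (excess_has_sup A B)|exists a]. Qed.

Lemma excess_ge0 A B : 0 <= excess A B.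
Proof.
have [a Aa] := hset_neq0 A.
exact: (le_trans (point_dist_ge0 a B) (point_dist_le_excess B Aa)).
Qed.

Lemma excess_triangle B A C : excess A C <= excess A B + excess B C.
Proof.
apply: ge_sup; first by case: (excess_has_sup A C).
move=> _ [a Aa <-]; apply/ler_addgt0Pr => e e0.
have [|b Bb ab] := @point_dist_lt a B (excess A B + e).
  by rewrite (le_lt_trans (point_dist_le_excess B Aa))// ltrDl.
rewrite (le_trans (point_dist_lip a b C))// addrAC lerD ?(ltW ab)//.
exact: point_dist_le_excess.
Qed.

Lemma excess0_sub A B : excess A B = 0 -> A `<=` B.
Proof.
move=> AB0 a Aa; apply: (compact_closed _ (@hset_compact B)).
  exact: metric_hausdorff.
move=> U /metricType_numDomainType.nbhs_mdistP[e /= e0 eU].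
have [|b Bb ab] := @point_dist_lt a B e.
  by rewrite (le_lt_trans (point_dist_le_excess B Aa))// AB0.
by exists b; split => //; exact: eU.
Qed.

Lemma excessxx A : excess A A = 0.
Proof.
apply/eqP; rewrite eq_le excess_ge0 andbT.
apply: ge_sup; first by case: (excess_has_sup A A).
by move=> _ [a Aa <-]; rewrite (le_trans (point_dist_le a Aa))// mdistxx.
Qed.

Let hausdorff_distxx A : hausdorff_dist A A = 0.
Proof. by rewrite /hausdorff_dist excessxx maxxx. Qed.

Let hausdorff_dist_positivity A B : hausdorff_dist A B = 0 -> A = B.
Proof.
move=> AB0; have : hausdorff_dist A B <= 0 by rewrite AB0.
rewrite ge_max => /andP[AB BA]; apply: hyperspace_eq; apply/seteqP.
by split; apply: excess0_sub; apply/eqP; rewrite eq_le excess_ge0 andbT.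
Qed.

Let hausdorff_dist_sym A B : hausdorff_dist A B = hausdorff_dist B A.
Proof. exact: maxC. Qed.

Let hausdorff_dist_triangle B A C :
  hausdorff_dist A C <= hausdorff_dist A B + hausdorff_dist B C.
Proof.
rewrite ge_max; apply/andP; split.
  by rewrite (le_trans (excess_triangle B A C))// lerD// le_max lexx.
rewrite (le_trans (excess_triangle B C A))// addrC lerD//.
  by rewrite le_max lexx orbT.
by rewrite le_max lexx orbT.
Qed.

HB.instance Definition _ := @isMetric.Build R hyperspace
  hausdorff_dist hausdorff_distxx hausdorff_dist_positivity
  hausdorff_dist_sym hausdorff_dist_triangle.

End hyperspace.

Section pointed_hyperspace.
Context {R : realType} (M : pmetricType R).

Definition hyperspace_point : hyperspace M :=
  Hyperspace (ex_intro _ (point : M) erefl) (@compact_set1 M point).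

HB.instance Definition _ := isPointed.Build (hyperspace M) hyperspace_point.

Definition borel_hyperspace := g_sigma_algebraType (@open (hyperspace M)).

End pointed_hyperspace.
Arguments borel_hyperspace {R} M.

Record compact_system (R : realType) := CompactSystem {
  system_space :> pmetricType R ;
  system_map : system_space -> system_space ;
  system_inv : system_space -> system_space ;
  system_compact : compact [set: system_space] ;
  system_mapK : cancel system_map system_inv ;
  system_invK : cancel system_inv system_map ;
  system_map_continuous : continuous system_map ;
  system_inv_continuous : continuous system_inv }.

Arguments system_map {R c}.
Arguments system_inv {R c}.
Arguments system_compact {R} c.
Arguments system_map_continuous {R} c.
Arguments system_inv_continuous {R} c.

Section random_compacts.
Context {R : realType} (X : compact_system R).

Local Notation K := (borel_hyperspace X).

Definition induced_map (A : K) : K.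
Proof.
exists (system_map @` hset A).
- by have [a Aa] := hset_neq0 A; exists (system_map a), a.
- apply: continuous_compact (@hset_compact _ _ A).
  by apply: continuous_subspaceT; exact: (system_map_continuous X).
Defined.

Definition whole_space : K :=
  Hyperspace (ex_intro _ (point : X) I) (system_compact X).

Definition finite_compacts : set K := [set A | finite_set (hset A)].

Definition countable_compacts : set K := [set A | countable (hset A)].

(* As [system_map] is invertible, this is invariance under the induced action
   of the group of its integer powers. *)
Definition is_IRC (mu : probability K R) :=
  forall E : set K, measurable E -> mu (induced_map @^-1` E) = mu E.

Definition nonfinitary (mu : probability K R) := mu finite_compacts = 0%E.

(* [completed_measure_extension] of [mu] is the outer measure of [mu] on the
   Caratheodory sigma-algebra, that is, the completion of [mu]. *)
Definition countable_null (mu : probability K R) :=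
  @completed_measure_extension _ _ _ mu countable_compacts = 0%E.

(* Measures are functions on all sets, so that they are compared on the
   measurable ones only. *)
Definition is_dirac_whole (mu : probability K R) :=
  forall E : set K, measurable E -> mu E = \d_whole_space E.

Definition IC_rigid := forall mu : probability K R,
  is_IRC mu /\ nonfinitary mu <-> is_dirac_whole mu.

Definition weakly_IC_rigid := forall mu : probability K R,
  is_IRC mu /\ countable_null mu <-> is_dirac_whole mu.

End random_compacts.
Arguments IC_rigid {R} X.
Arguments weakly_IC_rigid {R} X.

Definition full_shift : Type := prod_topology (fun _ : int => bool).

HB.instance Definition _ := Choice.on full_shift.
HB.instance Definition _ := Nbhs.on full_shift.
HB.instance Definition _ := Topological.on full_shift.
HB.instance Definition _ := Uniform.on full_shift.

Lemma full_shift_compact : compact [set: full_shift].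
Proof.
have := @tychonoff _ (fun _ : int => _) _ (fun=> bool_compact).
by congr (compact _); rewrite eqEsubset.
Qed.

Definition agree_upto (n : nat) : set (full_shift * full_shift) :=
  [set xy | forall i : int, (`|i| <= n)%N -> xy.1 i = xy.2 i].

Lemma entourage_coord (i : int) :
  entourage [set xy : full_shift * full_shift | xy.1 i = xy.2 i].
Proof.
pose S := [set xy : full_shift * full_shift | xy.1 i = xy.2 i].
suff : @entourage (sup_topology (fun j : int => Uniform.class
    (initial_topology (@proj _ (fun _ : int => bool) j)))) S by [].
have ent : `[< @entourage (initial_topology (@proj _ (fun _ : int => bool) i))
    S >].
  apply/asboolP; exists [set ab : bool * bool | ab.1 = ab.2]; last by [].
  by rewrite uniform_discrete => -[a b] [c _ [<- <-]].
exists S => //; exists [fset (exist _ ((i, S) : {classic int} * _) ent)]%fset.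
  by move=> ? _; rewrite inE.
apply/seteqP; split => [xy /= | xy Sxy w /=].
  by move/(_ _ (fset11 _)).
by rewrite inE => /eqP ->.
Qed.

Lemma fset_bounded (T : choiceType) (F : {fset T}) (f : T -> nat) :
  exists n, forall w, w \in F -> (f w <= n)%N.
Proof.
exists (\max_(w <- enum_fset F) f w)%N => w wF.
exact: (leq_bigmax_seq _ wF).
Qed.

Lemma entourage_full_shiftP (E : set (full_shift * full_shift)) :
  entourage E <-> exists n, agree_upto n `<=` E.
Proof.
split=> [|[n nE]].
  move=> [B [F _ <-] FE].
  have [n nF] := fset_bounded F (fun w => `|(projT1 w).1 : int|%N).
  exists n => -[x y] xy; apply: FE => w wF.
  have /asboolP[V entV] := projT2 w; apply => /=.
  have xyw : x (projT1 w).1 = y (projT1 w).1 by apply: xy; exact: nF.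
  suff : V (x (projT1 w).1, y (projT1 w).1) by [].
  by rewrite xyw; exact: entourage_refl.
apply: filterS nE _; elim: n => [|n IHn].
  apply: filterS (entourage_coord 0) => -[x y] /= xy0 i.
  by rewrite leqn0 absz_eq0 => /eqP ->.
apply: filterS (filterI IHn (filterI (entourage_coord n.+1%:Z)
  (entourage_coord (- n.+1%:Z)))) => -[x y] /= [xy [xyp xyn]] i.
rewrite leq_eqVlt => /predU1P[|/xy//] iE.
by have [->|->] : i = n.+1%:Z \/ i = - n.+1%:Z by lia.
Qed.

Section full_shift_metric.
Context {R : realType}.
Implicit Types x y z : full_shift.

(* This is 2 ^- n for the least n = `|i| with x i != y i, and 0 if x = y. *)
Definition shift_dist x y : R :=
  sup [set 2 ^- `|i|%N | i in [set i : int | x i != y i]].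

Let pow_gt0 n : 0 < 2 ^- n :> R. Proof. by rewrite invr_gt0 exprn_gt0. Qed.

Let pow_le m n : (m <= n)%N -> 2 ^- n <= 2 ^- m :> R.
Proof. by move=> mn; rewrite lef_pV2 ?posrE ?exprn_gt0// ler_weXn2l// ler1n. Qed.

Let pow_lt n : 2 ^- n.+1 < 2 ^- n :> R.
Proof. by rewrite ltf_pV2 ?posrE ?exprn_gt0// ltr_eXn2l// ltr1n. Qed.

Lemma shift_dist_ge x y i : x i != y i -> 2 ^- `|i|%N <= shift_dist x y.
Proof.
move=> xyi; apply: ub_le_sup; last by exists i.
by exists 1 => _ [j _ <-]; rewrite invf_le1 ?exprn_gt0// exprn_ege1// ler1n.
Qed.

Lemma shift_dist_le x y e : 0 <= e ->
  (forall i, x i != y i -> 2 ^- `|i|%N <= e) -> shift_dist x y <= e.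
Proof.
move=> e0 xye; have [E0|/set0P E0] := eqVneq [set i : int | x i != y i] set0.
  by rewrite /shift_dist E0 image_set0 sup0.
apply: ge_sup; last by move=> _ [i /xye ? <-].
by case: E0 => i xyi; exists (2 ^- `|i|%N), i.
Qed.

Lemma shift_dist_ge0 x y : 0 <= shift_dist x y.
Proof.
have [->|/eqP xy] := eqVneq x y.
  rewrite /shift_dist (_ : [set _ | _] = set0) ?image_set0 ?sup0//.
  by apply/seteqP; split=> // i /=; rewrite eqxx.
have [i /eqP xyi] : exists i, x i <> y i.
  by apply/existsNP => xyE; apply: xy; apply/funext.
exact: (le_trans (ltW (pow_gt0 _)) (shift_dist_ge xyi)).
Qed.

Lemma shift_dist_lt x y n : shift_dist x y < 2 ^- n <-> agree_upto n (x, y).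
Proof.
split=> [xyn i /= iln|xyn].
  apply/eqP; apply: contraLR xyn => xyi; rewrite -leNgt.
  exact: (le_trans (pow_le iln) (shift_dist_ge xyi)).
apply: le_lt_trans (pow_lt n); apply: shift_dist_le; first exact/ltW/pow_gt0.
move=> i xyi; apply: pow_le; rewrite ltnNge; apply: contra xyi => iln.
by apply/eqP/xyn.
Qed.

Let dist_positivity x y : shift_dist x y = 0 -> x = y.
Proof.
move=> xy0; apply/funext => i.
suff : agree_upto `|i|%N (x, y) by apply.
by apply/shift_dist_lt; rewrite xy0.
Qed.

Let dist_sym x y : shift_dist x y = shift_dist y x.
Proof.
by congr sup; congr image; apply/funext => i /=; rewrite eq_sym.
Qed.

Let dist_triangle y x z : shift_dist x z <= shift_dist x y + shift_dist y z.
Proof.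
apply: shift_dist_le => [|i]; first by rewrite addr_ge0// shift_dist_ge0.
have [->|xyi _] := eqVneq (x i) (y i).
  by move=> /shift_dist_ge/le_trans; apply; rewrite lerDr shift_dist_ge0.
by rewrite (le_trans (shift_dist_ge xyi))// lerDl shift_dist_ge0.
Qed.

Let ball x (e : R) : set full_shift := [set y | shift_dist x y < e].

Let ball_center x e : 0 < e -> ball x e x.
Proof.
move=> e0; apply: le_lt_trans e0; apply: shift_dist_le => // i.
by rewrite eqxx.
Qed.

Let ball_sym x y e : ball x e y -> ball y e x.
Proof. by rewrite /ball/= dist_sym. Qed.

Let ball_triangle x y z e1 e2 : ball x e1 y -> ball y e2 z ->
  ball x (e1 + e2) z.
Proof.
by move=> xy yz; apply: le_lt_trans (dist_triangle y x z) _; exact: ltrD.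
Qed.

Let entourageE : entourage = entourage_ ball.
Proof.
apply/funext => E; apply/propext; rewrite entourage_full_shiftP; split.
  move=> [n nE]; exists (2 ^- n); first exact: pow_gt0.
  by move=> [x y] /= /shift_dist_lt; exact: nE.
move=> [e /= e0 eE].
have [n ne] : exists n, 2 ^- n < e.
  have [n _ ne] := near_infty_natSinv_lt (PosNum e0).
  exists n; apply: le_lt_trans (ne n (leqnn n)).
  by rewrite lef_pV2 ?posrE ?exprn_gt0// -natrX ler_nat ltn_expl.
by exists n => -[x y] /shift_dist_lt xy; apply: eE => /=; exact: lt_trans ne.
Qed.

HB.instance Definition _ := @Uniform_isPseudoMetric.Build R full_shift
  ball ball_center ball_sym ball_triangle entourageE.

Let ballEdist x d : pseudometric_structure.ball x d = [set y | shift_dist x y < d].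
Proof. by []. Qed.

HB.instance Definition _ := @PseudoMetric_isMetric.Build R full_shift
  shift_dist shift_dist_ge0 dist_positivity ballEdist.

End full_shift_metric.

(* Numbered from 0: [chacon_block n] is the block b_(n+1), where b_1 = 0010. *)
Fixpoint chacon_block (n : nat) : seq bool :=
  if n is m.+1 then
    chacon_block m ++ chacon_block m ++ true :: chacon_block m
  else [:: false; false; true; false].

Definition subword (x : full_shift) (i : int) (k : nat) : seq bool :=
  [seq x (i + j%:Z) | j <- iota 0 k].

Definition chacon_set : set full_shift :=
  [set x | forall i k, exists n, infix (subword x i k) (chacon_block n)].

Lemma chacon_set_compact : compact chacon_set.
Proof.
apply: subclosed_compact full_shift_compact _ => // x clx i k.
pose V : set full_shift := [set y | agree_upto (`|i| + k) (x, y)].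
have /clx[y [chy xy]] : nbhs x V.
  rewrite -nbhs_entourageE; exists (agree_upto (`|i| + k)%N).
    by apply/entourage_full_shiftP; exists (`|i| + k)%N.
  by move=> y /xsectionP.
have [n nk] := chy i k; exists n; rewrite (_ : subword x i k = subword y i k)//.
apply/eq_in_map => j; rewrite mem_iota => /andP[_ jk]; apply: xy => /=; lia.
Qed.

Definition shift_by (n : int) (x : full_shift) : full_shift := fun i => x (i + n).

Lemma shift_by_continuous n : continuous (shift_by n).
Proof.
move=> x U; rewrite -nbhs_entourageE => -[E /entourage_full_shiftP[m mE] EU].
suff : nbhs_ entourage x (shift_by n @^-1` U) by [].
exists (agree_upto (m + `|n|)%N).
  by apply/entourage_full_shiftP; exists (m + `|n|)%N.
move=> y /xsectionP xy; apply: EU; apply/xsectionP; apply: mE => i /= im.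
by apply: xy => /=; lia.
Qed.

Lemma shift_by_chacon n x : chacon_set x -> chacon_set (shift_by n x).
Proof.
move=> chx i k; have [m chm] := chx (i + n) k; exists m.
rewrite (_ : subword _ i k = subword x (i + n) k)//.
by apply/eq_map => j; rewrite /shift_by addrAC.
Qed.

Lemma chacon_block_prefix m n : (m <= n)%N ->
  prefix (chacon_block m) (chacon_block n).
Proof.
move/subnK <-; elim: (n - m)%N => [|d IHd]; first exact: prefix_refl.
exact: (prefix_trans IHd (prefix_prefix _ _)).
Qed.

Lemma chacon_block_suffix m n : (m <= n)%N ->
  suffix (chacon_block m) (chacon_block n).
Proof.
move/subnK <-; elim: (n - m)%N => [|d IHd]; first exact: suffix_refl.
apply: (suffix_trans IHd); rewrite addSn /= -cat_rcons !catA.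
exact: suffix_suffix.
Qed.

Lemma size_chacon_block n : (n < size (chacon_block n))%N.
Proof. by elim: n => //= n IHn; rewrite !size_cat /=; lia. Qed.

(* The two-sided limit of the blocks: b_n ends at position -1 and b_n starts
   at position 0, for all n. *)
Definition chacon_point : full_shift := fun i =>
  match i with
  | Posz n => nth false (chacon_block n) n
  | Negz n => nth false (rev (chacon_block n)) n
  end.

Lemma nth_prefix (s t : seq bool) k : prefix s t -> (k < size s)%N ->
  nth false t k = nth false s k.
Proof. by move=> /prefixP[u ->] ks; rewrite nth_cat ks. Qed.

Lemma chacon_point_nth n (k : nat) : (k < size (chacon_block n))%N ->
  chacon_point k = nth false (chacon_block n) k.
Proof.
move=> kn; rewrite /=.
rewrite -(nth_prefix (chacon_block_prefix (leq_maxl k n)) (size_chacon_block k)).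
exact: (nth_prefix (chacon_block_prefix (leq_maxr k n)) kn).
Qed.

Lemma chacon_point_nthN n (k : nat) : (k < size (chacon_block n))%N ->
  chacon_point (Negz k) = nth false (chacon_block n) (size (chacon_block n) - k.+1).
Proof.
move=> kn; rewrite /= -nth_rev//.
have rev_prefix i j : (i <= j)%N ->
    prefix (rev (chacon_block i)) (rev (chacon_block j)).
  by move=> ij; rewrite prefix_rev chacon_block_suffix.
rewrite -(nth_prefix (rev_prefix _ _ (leq_maxl k n))) ?size_rev ?size_chacon_block//.
by rewrite (nth_prefix (rev_prefix _ _ (leq_maxr k n))) ?size_rev.
Qed.

Lemma chacon_point_in : chacon_set chacon_point.
Proof.
move=> i k; set n := (`|i| + k)%N; exists n.+1.
set b := chacon_block n; have nb : (n < size b)%N := size_chacon_block n.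
have [l il] : exists l : nat, l%:Z = i + (size b)%:Z.
  by exists (absz (i + (size b)%:Z)%R); lia.
suff -> : subword chacon_point i k = take k (drop l (b ++ b)).
  apply: (@infix_trans _ (drop l (b ++ b))).
    by rewrite -{2}(cat_take_drop k (drop _ _)) prefix_infix.
  apply: (@infix_trans _ (b ++ b)).
    by rewrite -{2}(cat_take_drop l (b ++ b)) suffix_infix.
  by rewrite /= -/b catA prefix_infix.
apply: (@eq_from_nth _ false).
  by rewrite size_map size_iota size_take size_drop size_cat; case: ifP; lia.
move=> j; rewrite size_map size_iota => jk.
rewrite (nth_map 0%N) ?size_iota// nth_iota// nth_take// nth_drop add0n nth_cat.
case: ltnP => lj.
  have -> : i + j%:Z = Negz (size b - (l + j)).-1 by lia.
  rewrite (@chacon_point_nthN n); last by rewrite -/b; lia.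
  by congr nth; rewrite -/b; lia.
have -> : i + j%:Z = (l + j - size b)%N by lia.
by rewrite (@chacon_point_nth n)// -/b; lia.
Qed.

Definition chacon_space : Type := set_type chacon_set.

HB.instance Definition _ := Uniform.copy chacon_space (set_type chacon_set).
HB.instance Definition _ (R : realType) : Metric R chacon_space :=
  Metric.copy chacon_space (set_type chacon_set).
HB.instance Definition _ := isPointed.Build chacon_space
  (exist _ chacon_point (mem_set chacon_point_in)).

Lemma chacon_space_compact : compact [set: chacon_space].
Proof.
move=> F PF _; pose v : chacon_space -> full_shift := fun x => \val x.
have Fch : (v @ F) chacon_set.
  by apply: (@filterS _ F _ setT); [move=> x _; exact: set_valP|exact: filterT].
have [x [chx Fx]] := @chacon_set_compact (v @ F) _ Fch.
exists (exist _ x (mem_set chx)); split => // A B FA.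
rewrite nbhsE => -[_ [[V oV <-] /= Vx] VB].
have [_ [[a Aa <-] Va]] : (v @` A) `&` V !=set0.
  apply: Fx; last exact: open_nbhs_nbhs.
  apply: (@filterS _ F _ A) => // a Aa.
  by exists a.
by exists a; split => //; exact: VB.
Qed.

Definition chacon_shift_by (n : int) (x : chacon_space) : chacon_space :=
  exist _ (shift_by n (\val x)) (mem_set (shift_by_chacon n (set_valP x))).

Lemma chacon_shift_by_continuous n : continuous (chacon_shift_by n).
Proof.
apply: continuous_comp_initial => x.
apply: (@continuous_comp _ _ _ (fun x : chacon_space => \val x) (shift_by n)).
  exact: initial_continuous.
exact: shift_by_continuous.
Qed.

Lemma chacon_shift_byK n : cancel (chacon_shift_by n) (chacon_shift_by (- n)).
Proof.
move=> x; apply/val_inj/funext => i /=.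
by rewrite /shift_by addrNK.
Qed.

Lemma chacon_shift_byNK n : cancel (chacon_shift_by (- n)) (chacon_shift_by n).
Proof. by move=> x; rewrite -{1}(opprK n) chacon_shift_byK. Qed.

Definition chacon_system (R : realType) : compact_system R :=
  @CompactSystem R chacon_space (chacon_shift_by 1) (chacon_shift_by (- 1))
    chacon_space_compact (chacon_shift_byK 1) (chacon_shift_byNK 1)
    (@chacon_shift_by_continuous 1) (@chacon_shift_by_continuous (- 1)).

(* Main.v *)
Require Import Defs.
From HB Require Import structures.
From mathcomp Require Import all_boot all_order all_algebra.
From mathcomp Require Import all_classical all_reals all_analysis.
From mathcomp Require Import measurable_realfun.
From mathcomp Require Import ssrAC ring lra zify.

(** The two halves of the statement rest on the way in which the blocks of a
    point of the Chacon subshift X are placed. The n-blocks of a point do not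
    overlap, and the next one starts h n or h n + 1 places further, where h n is
    their length.

    Weak rigidity. The heart is that the m-blocks of two points x and y in
    distinct orbits start at nearly independent times. Put on each m-block the
    function [pulse], of mean zero, and correlate its copies along an N-block of
    x and an N-block of y at offset s. Going up one level turns a correlation
    g (s) into 3 g (s) + (g (s - h) + g (s - h - 1)) + ... : the spacer
    makes averages of two consecutive translates appear, and n such averages
    bring a function that is a difference down to size 1 / sqrt n
    ([smooth_diff_le]). Hence the correlation is small ([pulse_corr_small])
    unless s is, up to a bounded error, a sum of boundedly many numbers
    h l and - h l. If this exception kept happening for N-blocks of arbitrarily
    high level, then x and y would be in the same orbit
    ([orbit_of_near_orbit]). So, by a second moment estimate, finitely many
    points in distinct orbits are enough for some long window to contain few
    times at which none of them starts an m-block ([rare_misses]).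

    An uncountable compact set A meets uncountably many orbits
    ([uncountable_orbits]); therefore most of the iterates of A contain a
    point that starts with an m-block. The window depends on A, but windows tile
    the trajectories ([covering]), so that, under an invariant measure for which the
    countable compacts are null, nearly every A contains a point starting with an
    m-block at any given time, with an error that tends to 0 as m grows. As every
    cylinder is met at a fixed place inside the m-blocks of suitable levels m, almost
    every A meets every cylinder, and is X. Conversely
    the Dirac mass at X is invariant, and X is uncountable because an invariant
    measure on X has no atoms ([chacon_uncountable]).

    Failure of rigidity. Let P be an invariant probability measure on X. The
    compact set [far x], the closure of the points T^(h k) x for k at least 3, is
    infinite because x is not periodic, and depends on x in an equivariant
    and measurable way; so its law is a nonfinitary invariant random compact. But
    T^(h k) x looks around the origin like x or like T^(-1) x, unless the origin is
    close to an end of its k-block, which has probability of order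
    1 / h k ([occurs_recurs]). These probabilities are summable, and thus, with
    positive probability, far x contains no point that starts with a 2-block. *)

Set Implicit Arguments.
Unset Strict Implicit.
Unset Printing Implicit Defensive.
Import Order.TTheory GRing.Theory Num.Theory.
Import numFieldNormedType.Exports.

Local Open Scope classical_set_scope.
Local Open Scope ring_scope.

(** * Blocks and recognizability *)

(** Starting one level below 0010, from a single letter, makes 0010 itself an
    instance of the recursion; every letter 1 is then a spacer. *)
Fixpoint block (n : nat) : seq bool :=
  if n is m.+1 then block m ++ block m ++ true :: block m else [:: false].

(** The heights of the towers in the cutting and stacking picture. *)
Definition h (n : nat) : nat := size (block n).

Lemma h0 : h 0 = 1%N. Proof. by []. Qed.

Lemma hS n : h n.+1 = (3 * h n + 1)%N.
Proof. by rewrite /h /= !size_cat /=; lia. Qed.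

Lemma h_gt0 n : (0 < h n)%N.
Proof. by case: n => [|n]; rewrite ?h0 ?hS ?addn1. Qed.

Lemma h_expn n : (2 * h n + 1 = 3 ^ n.+1)%N.
Proof. by elim: n => // n IHn; rewrite hS expnS -IHn; lia. Qed.

Lemma h_addn m l : (2 * h (m + l) + 1 = (2 * h m + 1) * 3 ^ l)%N.
Proof. by rewrite !h_expn -expnD addSn. Qed.

Lemma h_ge m l : (3 ^ l * h m <= h (m + l))%N.
Proof. have := h_addn m l; have := expn_gt0 3 l; nia. Qed.

Lemma h_le m n : (m <= n)%N -> (h m <= h n)%N.
Proof. by move/subnKC <-; apply: leq_trans (h_ge m (n - m)); rewrite leq_pmull// expn_gt0. Qed.

Lemma h_gt n : (n < h n)%N.
Proof. by elim: n => // n IHn; rewrite hS; lia. Qed.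

Definition occurs (x : int -> bool) n (a : int) : bool :=
  all (fun i : nat => x (a + i%:Z) == nth true (block n) i) (iota 0 (h n)).

Lemma occursP x n a :
  reflect (forall i : nat, (i < h n)%N -> x (a + i%:Z) = nth true (block n) i)
    (occurs x n a).
Proof.
apply: (iffP allP) => [xa i ih|xa i]; first by apply/eqP/xa; rewrite mem_iota.
by rewrite mem_iota add0n => /andP[_ ih]; apply/eqP/xa.
Qed.

Lemma occurs0 x a : occurs x 0 a = (x a == false).
Proof. by rewrite /occurs/= addr0 andbT. Qed.

Lemma occursS x n a : occurs x n.+1 a =
  [&& occurs x n a, occurs x n (a + (h n)%:Z), x (a + (2 * h n)%:Z)
    & occurs x n (a + (2 * h n).+1%:Z)].
Proof.
have nthS i : nth true (block n.+1) i =
  if (i < h n)%N then nth true (block n) i else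
  if (i < 2 * h n)%N then nth true (block n) (i - h n) else
  if i == (2 * h n)%N then true else nth true (block n) (i - (2 * h n).+1).
  rewrite /= !nth_cat -/(h n); case: ltnP => // hi; case: ltnP => hi2.
    by rewrite ifT//; lia.
  rewrite ifF; last by lia.
  have [->|ne] := eqVneq; first by rewrite (_ : (_ - _ - _ = 0)%N)//; lia.
  by rewrite (_ : (i - h n - h n)%N = (i - (2 * h n).+1).+1)//; lia.
have hn0 := h_gt0 n.
apply/occursP/and4P => [xa|[/occursP x1 /occursP x2 x3 /occursP x4] i ih].
  split.
  - by apply/occursP => i ih; rewrite xa ?nthS ?ih// hS; lia.
  - apply/occursP => i ih; rewrite -addrA -PoszD xa ?hS; last lia.
    rewrite nthS ifF; last by lia.
    by rewrite ifT; last lia; congr nth; lia.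
  - rewrite xa ?hS; last lia.
    by rewrite nthS ltnn eqxx ifF//; lia.
  - apply/occursP => i ih; rewrite -addrA -PoszD xa ?hS; last lia.
    rewrite nthS ifF; last by lia.
    rewrite ifF; last by lia.
    by rewrite ifF; [congr nth; lia|lia].
rewrite hS in ih; rewrite nthS; case: ltnP => i1; first exact: x1.
case: ltnP => i2.
  by rewrite -x2; last lia; congr x; lia.
have [->|i3] := eqVneq; first by rewrite x3.
by rewrite -x4; last lia; congr x; lia.
Qed.

Lemma occurs_first x n a : occurs x n a -> x a = false.
Proof.
elim: n => [|n IHn]; first by rewrite occurs0 => /eqP.
by rewrite occursS => /and4P[/IHn].
Qed.

(** The occurrences of the n-block in the (n+j)-block that are there by
    construction; [occurs_start] shows that there are no others. *)
Fixpoint start n j (p : int) : bool :=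
  if j is i.+1 then
    [|| start n i p, start n i (p - (h (n + i))%:Z)
      | start n i (p - (2 * h (n + i)).+1%:Z)]
  else p == 0.

Lemma start_bounds n j p : start n j p ->
  0 <= p /\ p + (h n)%:Z <= (h (n + j))%:Z.
Proof.
elim: j p => [|j IHj] p /=; first by move/eqP->; rewrite addn0 add0r.
by rewrite addnS hS => /or3P[] /IHj; lia.
Qed.

Lemma start_sep n j p p' : start n j p -> start n j p' -> p < p' ->
  p + (h n)%:Z <= p'.
Proof.
elim: j p p' => [|j IHj] p p' /=; first by move=> /eqP-> /eqP->.
move=> /or3P[] s1 /or3P[] s2 pp'; have := start_bounds s1;
  have := start_bounds s2; have := IHj _ _ s1 s2; lia.
Qed.

Lemma start_occurs x n j a p : occurs x (n + j) a -> start n j p ->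
  occurs x n (a + p).
Proof.
elim: j a p => [|j IHj] a p /=; first by rewrite addn0 => ? /eqP->; rewrite addr0.
rewrite addnS occursS => /and4P[ o1 o2 _ o3] /or3P[] s.
- exact: IHj o1 s.
- by rewrite (_ : a + p = a + (h (n + j))%:Z + (p - (h (n + j))%:Z)) ?(IHj _ _ o2 s)//; lia.
- by rewrite (_ : a + p = a + (2 * h (n + j)).+1%:Z + (p - (2 * h (n + j)).+1%:Z)) ?(IHj _ _ o3 s)//; lia.
Qed.

Lemma startS n j p : start n j.+1 p =
  [|| start n j p, start n j (p - (h (n + j))%:Z)
    | start n j (p - (2 * h (n + j)).+1%:Z)].
Proof. by []. Qed.

(** The recursion of [start] subdivides from the top level; the induction
    in [occurs_start] climbs from the bottom level. *)
Lemma start_refine n j p : start n j.+1 p =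
  [|| start n.+1 j p, start n.+1 j (p - (h n)%:Z)
    | start n.+1 j (p - (2 * h n).+1%:Z)].
Proof.
elim: j p => [|j IHj] p; first by rewrite /= addn0.
rewrite startS !IHj !startS !addSnnS.
have sw u v : p - u - v = p - v - u by lia.
rewrite ![p - (h n)%:Z - _]sw ![p - (2 * h n).+1%:Z - _]sw.
by rewrite !orbA (AC 9 (1*4*7*2*5*8*3*6*9)).
Qed.

Lemma start_origin n j : start n j 0.
Proof. by elim: j => //= j ->. Qed.

Lemma start_next x n j a p : occurs x (n + j) a -> start n j p ->
  [\/ p + (h n)%:Z = (h (n + j))%:Z, start n j (p + (h n)%:Z)
    | start n j (p + (h n).+1%:Z) /\ x (a + p + (h n)%:Z)].
Proof.
elim: j a p => [|j IHj] a p; first by move=> _ /eqP->; apply: Or31; rewrite addn0; lia.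
rewrite addnS occursS => /and4P[ o1 o2 o3 o4] /= /or3P[] s.
- case: (IHj _ _ o1 s) => [e|->|[-> ->]]; last by apply: Or33.
    by apply: Or32; rewrite e subrr start_origin orbT.
  by apply: Or32.
- case: (IHj _ _ o2 s) => [e|s'|[s' xs]].
  + apply: Or33; split; last by move: o3; congr is_true; congr x; lia.
    by rewrite (_ : p + _ - (_).+1%:Z = 0) ?start_origin ?orbT//; lia.
  + by apply: Or32; rewrite (_ : p + _ - _ = p - (h (n + j))%:Z + (h n)%:Z) ?s' ?orbT//; lia.
  + apply: Or33; split; last by move: xs; congr is_true; congr x; lia.
    by rewrite (_ : p + _ - (h (n + j))%:Z = p - (h (n + j))%:Z + (h n).+1%:Z) ?s' ?orbT//; lia.
- case: (IHj _ _ o4 s) => [e|s'|[s' xs]].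
  + by apply: Or31; rewrite hS; lia.
  + apply: Or32; rewrite (_ : p + _ - (2 * _).+1%:Z = p - (2 * h (n + j)).+1%:Z + (h n)%:Z) ?s' ?orbT//; lia.
  + apply: Or33; split; last by move: xs; congr is_true; congr x; lia.
    by rewrite (_ : p + _ - (2 * _).+1%:Z = p - (2 * h (n + j)).+1%:Z + (h n).+1%:Z) ?s' ?orbT//; lia.
Qed.

Lemma start_last n j : start n j ((h (n + j))%:Z - (h n)%:Z).
Proof.
elim: j => [|j IHj] /=; first by rewrite addn0 subrr.
rewrite addnS hS.
by rewrite [X in _ || (_ || start _ _ X)](_ : _ = (h (n + j))%:Z - (h n)%:Z) ?IHj ?orbT//; lia.
Qed.

Lemma start_prev n j p : start n j p ->
  [\/ p = 0, start n j (p - (h n)%:Z) | start n j (p - (h n).+1%:Z)].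
Proof.
elim: j p => [|j IHj] p; first by move=> /eqP->; apply: Or31.
have sl := start_last n j.
move=> /= /or3P[] s.
- by case: (IHj _ s) => [->|->|->]; [apply: Or31|apply: Or32|apply: Or33].
- case: (IHj _ s) => [e|s'|s'].
  + by apply: Or32; rewrite (_ : p - (h n)%:Z = (h (n + j))%:Z - (h n)%:Z) ?sl//; lia.
  + by apply: Or32; rewrite (_ : p - _ - (h (n + j))%:Z = p - (h (n + j))%:Z - (h n)%:Z) ?s' ?orbT//; lia.
  + by apply: Or33; rewrite (_ : p - _ - (h (n + j))%:Z = p - (h (n + j))%:Z - (h n).+1%:Z) ?s' ?orbT//; lia.
- case: (IHj _ s) => [e|s'|s'].
  + by apply: Or33; rewrite (_ : p - _ - (h (n + j))%:Z = (h (n + j))%:Z - (h n)%:Z) ?sl ?orbT//; lia.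
  + by apply: Or32; rewrite (_ : p - _ - (2 * h (n + j)).+1%:Z = p - (2 * h (n + j)).+1%:Z - (h n)%:Z) ?s' ?orbT//; lia.
  + by apply: Or33; rewrite (_ : p - _ - (2 * h (n + j)).+1%:Z = p - (2 * h (n + j)).+1%:Z - (h n).+1%:Z) ?s' ?orbT//; lia.
Qed.

Lemma start_cover n j t : 0 <= t < (h (n + j))%:Z ->
  exists2 p, start n j p & p <= t <= p + (h n)%:Z.
Proof.
elim: j t => [|j IHj] t; first by rewrite addn0 => t0; exists 0 => //; lia.
rewrite addnS hS => t0.
have [t1|t1] := ltrP t (h (n + j))%:Z.
  by have [|p s pt] := IHj t; [lia|exists p => //=; rewrite s].
have [t2|t2] := ltrP t (2 * h (n + j))%:Z.
  have [|p s pt] := IHj (t - (h (n + j))%:Z); first lia.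
  by exists (p + (h (n + j))%:Z) => /=; [rewrite addrK s orbT|lia].
have [t3|t3] := eqVneq t (2 * h (n + j))%:Z.
  exists ((2 * h (n + j))%:Z - (h n)%:Z) => /=; last by have := h_gt0 n; lia.
  by rewrite [X in _ || (start _ _ X || _)](_ : _ = (h (n + j))%:Z - (h n)%:Z) ?start_last ?orbT//; lia.
have [|p s pt] := IHj (t - (2 * h (n + j)).+1%:Z); first lia.
by exists (p + (2 * h (n + j)).+1%:Z) => /=; [rewrite addrK s !orbT|lia].
Qed.

Lemma start_letter x j a p : occurs x j a -> 0 <= p < (h j)%:Z ->
  x (a + p) = ~~ start 0 j p.
Proof.
elim: j a p => [|j IHj] a p; first by rewrite occurs0 h0 => /eqP xa p0; rewrite (_ : p = 0) ?addr0 ?xa//; lia.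
rewrite occursS hS => /and4P[ o1 o2 o3 o4] p0.
have out q : (q < 0) || ((h j)%:Z <= q) -> start 0 j q = false.
  by move=> qh; apply/negP => /start_bounds; have := h_gt0 0; rewrite add0n; lia.
have [p1|p1] := ltrP p (h j)%:Z.
  by rewrite (IHj _ _ o1); [rewrite /= add0n !(out (p - _)) ?orbF//; lia|lia].
have [p2|p2] := ltrP p (2 * h j)%:Z.
  rewrite (_ : a + p = a + (h j)%:Z + (p - (h j)%:Z)); last lia.
  rewrite (IHj _ _ o2); last lia.
  by rewrite /= add0n (out p) ?(out (p - (2 * _).+1%:Z)) ?orbF//; lia.
have [->|p3] := eqVneq p (2 * h j)%:Z.
  by rewrite o3 /= add0n !out//; have := h_gt0 j; lia.
rewrite (_ : a + p = a + (2 * h j).+1%:Z + (p - (2 * h j).+1%:Z)); last lia.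
rewrite (IHj _ _ o4); last lia.
by rewrite /= add0n (out p) ?(out (p - (h j)%:Z))//; lia.
Qed.

(** Recognizability. By induction on n, the n-blocks of an occurrence of
    the (n+1)-block are building blocks, so that a wrong occurrence is shifted by
    one or two n-blocks from a right one. Then a spacer of one of them meets the
    first letter of an n-block of the other, which is 0. *)
Lemma occurs_start x n j a p : occurs x (n + j) a -> occurs x n (a + p) ->
  0 <= p -> p + (h n)%:Z <= (h (n + j))%:Z -> start n j p.
Proof.
elim: n j p => [|n IHn] j p oj.
  rewrite occurs0 add0n h0 => /eqP xa p0 ph.
  have p1 : 0 <= p < (h j)%:Z by lia.
  by have := start_letter oj p1; rewrite xa; case: start.
have oj' : occurs x (n + j.+1) a by rewrite -addSnnS.
rewrite occursS hS => /and4P[ o1 o2 o3 o4] p0 ph.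
have [s1|//|s1] : [\/ start n.+1 j (p - (h n)%:Z), start n.+1 j p
    | start n.+1 j (p - (2 * h n).+1%:Z)].
  have : start n j.+1 p by apply: IHn => //; rewrite -addSnnS; lia.
  rewrite start_refine => /or3P[].
  - by apply: Or32.
  - by apply: Or31.
  - by apply: Or33.
- have := start_occurs oj s1; rewrite occursS => /and4P[_ _ + _].
  rewrite (_ : a + _ + _ = a + p + (h n)%:Z); last lia.
  by rewrite (occurs_first o2).
- case: (start_next oj s1) => [|s2|[_]].
  + by rewrite hS; have := h_gt0 n; lia.
  + have := start_occurs oj s2; rewrite occursS => /and4P[_ /occurs_first + _ _].
    rewrite (_ : a + _ + _ = a + p + (2 * h n)%:Z); first by rewrite o3.
    by rewrite hS; lia.
  + rewrite (_ : a + _ + _ = a + p + (h n)%:Z); first by rewrite (occurs_first o2).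
    by rewrite hS; lia.
Qed.

(** * The blocks of a point *)

(** What is used of a point of the subshift: its windows lie in long blocks,
    from which it inherits the structure of [start]. *)
Definition locally_chacon (x : int -> bool) := forall V k0 : nat,
  exists z k a, [/\ (k0 <= k)%N, occurs z k a, a <= - V%:Z, V%:Z < a + (h k)%:Z
    & forall i : int, (`|i| <= V)%N -> z i = x i].

Section blocks_of_a_point.
Variables (x : int -> bool) (n : nat).
Hypothesis xX : locally_chacon x.

Let local z (V : nat) m b : (forall i : int, (`|i| <= V)%N -> z i = x i) ->
  - V%:Z <= b -> b + (h m)%:Z <= V%:Z -> occurs z m b = occurs x m b.
Proof.
move=> zx Vb bV; apply: eq_in_all => i; rewrite mem_iota => /andP[_ ih].
by rewrite zx//; lia.
Qed.

Lemma occurs_sep a a' : occurs x n a -> occurs x n a' -> a < a' ->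
  a + (h n)%:Z <= a'.
Proof.
move=> oa oa' aa'.
have [z [k [b [nk ob bV Vb zx]]]] := xX (`|a| + `|a'| + h n)%N n.
have [j kE] : exists j, k = (n + j)%N by exists (k - n)%N; lia.
rewrite {}kE in ob Vb.
have st c : occurs x n c -> (`|c| <= `|a| + `|a'|)%N -> start n j (c - b).
  move=> oc ca; apply: (occurs_start ob); rewrite ?subrKC ?(local zx)//; lia.
have s1 : start n j (a - b) by apply: st => //; lia.
have s2 : start n j (a' - b) by apply: st => //; lia.
have := start_sep s1 s2; lia.
Qed.

Lemma occurs_next a : occurs x n a ->
  occurs x n (a + (h n)%:Z) \/
  occurs x n (a + (h n).+1%:Z) /\ x (a + (h n)%:Z).
Proof.
move=> oa.
have [z [k [b [nk ob bV Vb zx]]]] := xX (`|a| + 3 * h n)%N n.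
have [j kE] : exists j, k = (n + j)%N by exists (k - n)%N; lia.
have hn := h_gt0 n; rewrite {}kE in ob Vb.
have s : start n j (a - b).
  apply: (occurs_start ob); rewrite ?subrKC ?(local zx)//; lia.
case: (start_next ob s) => [|s'|[s']]; first lia.
  left; rewrite -(local zx); try lia.
  by rewrite (_ : a + _ = b + (a - b + (h n)%:Z)) ?(start_occurs ob s')//; lia.
rewrite (_ : b + _ + _ = a + (h n)%:Z) ?zx; try lia; move=> xa; right; split => //.
rewrite -(local zx); try lia.
by rewrite (_ : a + _ = b + (a - b + (h n).+1%:Z)) ?(start_occurs ob s')//; lia.
Qed.

Lemma occurs_prev a : occurs x n a ->
  occurs x n (a - (h n)%:Z) \/ occurs x n (a - (h n).+1%:Z).
Proof.
move=> oa.
have [z [k [b [nk ob bV Vb zx]]]] := xX (`|a| + 3 * h n)%N n.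
have [j kE] : exists j, k = (n + j)%N by exists (k - n)%N; lia.
have hn := h_gt0 n; rewrite {}kE in ob Vb.
have s : start n j (a - b).
  apply: (occurs_start ob); rewrite ?subrKC ?(local zx)//; lia.
case: (start_prev s) => [|s'|s']; first lia; [left|right];
  rewrite -(local zx); try lia.
  by rewrite (_ : a - _ = b + (a - b - (h n)%:Z)) ?(start_occurs ob s')//; lia.
by rewrite (_ : a - _ = b + (a - b - (h n).+1%:Z)) ?(start_occurs ob s')//; lia.
Qed.

Lemma occurs_cover t : exists2 a, occurs x n a & a <= t <= a + (h n)%:Z.
Proof.
have [z [k [b [nk ob bV Vb zx]]]] := xX (`|t| + 3 * h n)%N n.
have [j kE] : exists j, k = (n + j)%N by exists (k - n)%N; lia.
have hn := h_gt0 n; rewrite {}kE in ob Vb.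
have [|p s pt] := @start_cover n j (t - b); first lia.
exists (b + p); last lia.
by rewrite -(local zx) ?(start_occurs ob s)//; lia.
Qed.

Lemma occurs_parent a : occurs x n a ->
  exists2 c, c \in [:: 0; (h n)%:Z; (2 * h n).+1%:Z] & occurs x n.+1 (a - c).
Proof.
move=> oa.
have [z [k [b [nk ob bV Vb zx]]]] := xX (`|a| + 5 * h n + 2)%N n.+1.
have [j kE] : exists j, k = (n + j.+1)%N by exists (k - n.+1)%N; lia.
have hn := h_gt0 n; rewrite {}kE in ob Vb.
have : start n j.+1 (a - b).
  apply: (occurs_start ob); rewrite ?subrKC ?(local zx)//; lia.
have ob' : occurs z (n.+1 + j) b by rewrite addSnnS.
rewrite start_refine => /or3P[] /(start_occurs ob') o.
- exists 0; rewrite ?inE// -(local zx); rewrite ?hS; try lia.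
  by move: o; rewrite (_ : b + _ = a - 0)//; lia.
- exists (h n)%:Z; rewrite ?inE ?eqxx ?orbT// -(local zx); rewrite ?hS; try lia.
  by move: o; rewrite (_ : b + _ = a - (h n)%:Z)//; lia.
- exists (2 * h n).+1%:Z; rewrite ?inE ?eqxx ?orbT// -(local zx);
    rewrite ?hS; try lia.
  by move: o; rewrite (_ : b + _ = a - (2 * h n).+1%:Z)//; lia.
Qed.

End blocks_of_a_point.

(** * Windows recurring at sums of heights *)

Lemma occurs_ancestor x n j a : locally_chacon x -> occurs x n a ->
  exists2 p, start n j p & occurs x (n + j) (a - p).
Proof.
move=> xX; elim: j n a => [|j IHj] n a oa.
  by exists 0; rewrite ?addn0 ?subr0.
have [c c3 /IHj[p sp op]] := occurs_parent xX oa.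
exists (c + p); last by rewrite opprD addrA -addSnnS.
move: c3; rewrite start_refine !inE => /or3P[] /eqP->.
- by rewrite add0r sp.
- by rewrite (_ : (h n)%:Z + p - (h n)%:Z = p) ?sp ?orbT//; lia.
- by rewrite (_ : (2 * h n).+1%:Z + p - (2 * h n).+1%:Z = p) ?sp ?orbT//; lia.
Qed.

(** The exceptional points are those whose blocks around the origin grow on
    one side only, see [not_deep_boundary]. *)
Definition deep (x : int -> bool) := forall R : nat, exists n0, forall n,
  (n0 <= n)%N -> exists a, [/\ occurs x n a, a <= - R%:Z & R%:Z < a + (h n)%:Z].

Definition term_val (t : bool * nat) : int :=
  if t.1 then (h t.2)%:Z else - (h t.2)%:Z.

Definition term_sum (ts : seq (bool * nat)) : int := \sum_(t <- ts) term_val t.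

Lemma term_sum_cons t ts : term_sum (t :: ts) = term_val t + term_sum ts.
Proof. by rewrite /term_sum big_cons. Qed.

Lemma term_sum_cat ts us : term_sum (ts ++ us) = term_sum ts + term_sum us.
Proof. by rewrite /term_sum big_cat. Qed.

(** An n-block belongs to an l-block, and the l-blocks next to that one
    are separated from it by at most one spacer. *)
Lemma occurs_shift y n l b a : locally_chacon y -> (n <= l)%N ->
  occurs y n a ->
  exists2 e : int, (`|e| <= 1)%N & occurs y n (a + term_val (b, l) + e).
Proof.
move=> yX nl oa; rewrite -(subnKC nl); set j := (l - n)%N.
have [p sp op] := occurs_ancestor j yX oa.
case: b; rewrite /term_val /=.
  have [ o|[ o _]] := occurs_next yX op; have := start_occurs o sp.
    by exists 0 => //; rewrite (_ : a + _ + 0 = a - p + (h (n + j))%:Z + p)//; lia.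
  by exists 1 => //; rewrite (_ : a + _ + 1 = a - p + (h (n + j)).+1%:Z + p)//; lia.
have [ o|o] := occurs_prev yX op; have := start_occurs o sp.
  by exists 0 => //; rewrite (_ : a + _ + 0 = a - p - (h (n + j))%:Z + p)//; lia.
by exists (- 1) => //; rewrite (_ : a + _ - 1 = a - p - (h (n + j)).+1%:Z + p)//; lia.
Qed.

Lemma occurs_shifts y n a ts : locally_chacon y ->
  all (fun t => n <= t.2)%N ts -> occurs y n a ->
  exists2 e : int, (`|e| <= size ts)%N & occurs y n (a + term_sum ts + e).
Proof.
move=> yX; elim: ts a => [|[b l] ts IHts] a /=.
  by exists 0 => //; rewrite /term_sum big_nil !addr0.
case/andP=> nl nts oa.
have [e e1 /(IHts _ nts)[e' e's o]] := occurs_shift b yX nl oa.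
exists (e + e'); first lia.
rewrite term_sum_cons; move: o; congr is_true; congr occurs; lia.
Qed.

(** Otherwise each t in s fails from some n on, and beyond the largest of
    these finitely many n all of them fail. *)
Lemma uniform_pigeonhole (T : eqType) (s : seq T) (Q : T -> nat -> Prop) :
  (forall t m n, (m <= n)%N -> Q t n -> Q t m) ->
  (forall n, exists2 t, t \in s & Q t n) -> exists2 t, t \in s & forall n, Q t n.
Proof.
move=> Qm; apply: contraPP => no.
have {}no t : t \in s -> exists n, ~ Q t n.
  by move=> ts; apply/existsNP => Qt; apply: no; exists t.
move=> exQ; have [n nQ] : exists n, forall t, t \in s -> ~ Q t n.
  elim: s no {exQ} => [|t s IHs] no; first by exists 0%N.
  have [|n nQ] := IHs; first by move=> u us; apply: no; rewrite inE us orbT.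
  have [m mQ] := no t (mem_head _ _).
  exists (maxn n m) => u; rewrite inE => /predU1P[->|us].
    by apply: contra_not mQ; apply: Qm; exact: leq_maxr.
  by apply: contra_not (nQ u us); apply: Qm; exact: leq_maxl.
by have [t ts] := exQ n; exact: nQ.
Qed.

Lemma bounded_int_seq (B : nat) : exists s : seq int,
  forall r : int, (r \in s) = (`|r| <= B)%N.
Proof.
exists [seq i%:Z - B%:Z | i <- iota 0 (2 * B).+1] => r; apply/mapP/idP.
  by case=> i; rewrite mem_iota => ? ->; lia.
by move=> rB; exists (absz (r + B%:Z)%R); [rewrite mem_iota|]; lia.
Qed.

(** What is left of lying in the same orbit when the correlation of the
    blocks of x and y does not decay. *)
Definition near_orbit (x y : int -> bool) (B k : nat) := forall R : nat,
  exists (r : int) ts, [/\ (`|r| <= B)%N, (size ts <= k)%N &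
    forall u : int, (`|u| <= R)%N -> x u = y (u + r + term_sum ts)].

(** Large heights move a block of y around the origin almost onto another
    block of the same level. Hence the windows of x are read off y close to the
    origin, at boundedly many places, and one place serves all windows. *)
Lemma orbit_of_far_terms x y B k : locally_chacon y -> deep y ->
  (forall n0 R : nat, exists (r : int) ts,
    [/\ (`|r| <= B)%N, (size ts <= k)%N, all (fun t => n0 <= t.2)%N ts &
    forall u : int, (`|u| <= R)%N -> x u = y (u + r + term_sum ts)]) ->
  exists r, forall u, x u = y (u + r).
Proof.
move=> yX yI P; have [s sE] := bounded_int_seq (B + k).
pose Q (r : int) R := forall u : int, (`|u| <= R)%N -> x u = y (u + r).
have [| |r _ rQ] := @uniform_pigeonhole _ s Q.
- by move=> r m n mn rn u um; apply: rn; exact: leq_trans mn.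
- move=> R; have [n0 /(_ n0 (leqnn _))[a [ oa aR Ra]]] := yI (R + B + k)%N.
  have [r [ts [rB tsk far xy]]] := P n0 R.
  have [e ets oe] := occurs_shifts yX far oa.
  exists (r - e); first by rewrite sE; lia.
  move=> u uR; rewrite xy//.
  have [i iE] : exists i : nat, i%:Z = u + r - e - a.
    by exists (absz (u + r - e - a)%R); lia.
  have ih : (i < h n0)%N by lia.
  rewrite (_ : u + (r - e) = a + i%:Z) ?(occursP _ _ _ oa _ ih); last lia.
  by rewrite -(occursP _ _ _ oe _ ih); congr y; lia.
- by exists r => u; exact: (rQ `|u|%N u (leqnn _)).
Qed.

(** By induction on the number of heights: if they cannot all be taken
    arbitrarily large, then one of them is bounded, and is absorbed into the
    bounded error. *)
Lemma orbit_of_near_orbit x y B k : locally_chacon y -> deep y ->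
  near_orbit x y B k -> exists r, forall u, x u = y (u + r).
Proof.
move=> yX yI; elim: k B => [|k IHk] B xy.
  apply: (orbit_of_far_terms (B := B) (k := 0) yX yI) => n0 R.
  have [r [ts [rB]]] := xy R; rewrite leqn0 size_eq0 => /eqP-> ru.
  by exists r, [::].
have [P|] := pselect (forall n0 R : nat, exists (r : int) ts,
    [/\ (`|r| <= B)%N, (size ts <= k.+1)%N, all (fun t => n0 <= t.2)%N ts &
    forall u : int, (`|u| <= R)%N -> x u = y (u + r + term_sum ts)]).
  exact: orbit_of_far_terms P.
move=> /existsNP[n0 /existsNP[R0 nP]]; apply: (IHk (B + h n0)%N) => R.
have [r [ts [rB tsk xyu]]] := xy (maxn R R0).
have /allPn[[b l] tts /= ln0] : ~~ all (fun t => n0 <= t.2)%N ts.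
  apply/negP => far; apply: nP; exists r, ts; split => // u uR.
  by apply: xyu; lia.
case/splitPr: tts tsk xyu => s1 s2 tsk xyu.
exists (r + term_val (b, l)), (s1 ++ s2); split.
- have : (h l <= h n0)%N by apply: h_le; lia.
  by rewrite /term_val /=; case: b {xyu tsk}; lia.
- by move: tsk; rewrite !size_cat /=; lia.
- move=> u uR; rewrite xyu; last lia.
  by congr y; rewrite !term_sum_cat term_sum_cons; lia.
Qed.

(** A block ends before the place e, and the next one is preceded by a spacer
    at e if o holds, where eo = (e, o). *)
Definition boundary (x : int -> bool) n (eo : int * bool) :=
  [/\ occurs x n (eo.1 - (h n)%:Z), occurs x n (eo.1 + (eo.2 : nat)%:Z)
    & eo.2 -> x eo.1].

Lemma boundary_le x m n eo : (m <= n)%N -> boundary x n eo -> boundary x m eo.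
Proof.
move=> mn; rewrite -(subnK mn); elim: (n - m)%N => // j IHj.
case=> o1 o2 xe; apply: IHj; split => //.
  move: o1; rewrite addSn occursS hS => /and4P[_ _ _].
  by congr is_true; congr occurs; lia.
by move: o2; rewrite addSn occursS => /and4P[].
Qed.

Lemma not_deep_boundary x : locally_chacon x -> ~ deep x ->
  exists eo, forall n, boundary x n eo.
Proof.
move=> xX /existsNP[R nI].
have {}nI n : ~ exists a, [/\ occurs x n a, a <= - R%:Z & R%:Z < a + (h n)%:Z].
  move=> [a [ oa aR Ra]]; apply: nI; exists n => l nl.
  have [p sp op] := occurs_ancestor (l - n) xX oa.
  have := start_bounds sp; rewrite subnKC in op *; last exact: nl.
  by move=> pb; exists (a - p); split=> //; lia.
have [s sE] := bounded_int_seq R.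
have [| |eo _ eoP] := @uniform_pigeonhole _ [seq (e, o) | e <- s, o <- [:: true; false]]
  (fun eo n => boundary x n eo).
- by move=> eo m n; exact: boundary_le.
- move=> n; have [a oa /andP[aR Ra]] := occurs_cover n xX (- R%:Z).
  have aR' : a + (h n)%:Z <= R%:Z.
    by rewrite leNgt; apply/negP => ?; apply: (nI n); exists a.
  have es : a + (h n)%:Z \in s by rewrite sE; lia.
  have [ o|[ o xa]] := occurs_next xX oa.
    exists (a + (h n)%:Z, false); first by apply/allpairsP; exists (a + (h n)%:Z, false).
    by split; rewrite //= ?addrK ?addr0.
  exists (a + (h n)%:Z, true); first by apply/allpairsP; exists (a + (h n)%:Z, true).
  split; rewrite //= ?addrK//.
  by move: o; congr is_true; congr occurs; lia.
- by exists eo.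
Qed.

(** The blocks on both sides of the boundary become arbitrarily long, so
    that they determine the point. *)
Lemma boundary_inj x y eo : (forall n, boundary x n eo) ->
  (forall n, boundary y n eo) -> x = y.
Proof.
case: eo => e o xb yb; apply/funext => i.
have [] := xb (absz (i - e)%R); have [] := yb (absz (i - e)%R) => /=.
have := h_gt (absz (i - e)%R); set n := (absz (i - e)%R) => hn yl yr ye xl xr xe.
have [ie|ei] := ltrP i e.
  have -> : i = e - (h n)%:Z + (h n - n)%N%:Z by lia.
  by rewrite (occursP _ _ _ xl) ?(occursP _ _ _ yl)//; lia.
have [i0|i0] := eqVneq i e.
  case: o {xb yb} xe ye xr yr => [/(_ isT) + /(_ isT)|_ _].
    by rewrite i0 => -> ->.
  by rewrite i0 addr0 => /occurs_first -> /occurs_first ->.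
have -> : i = e + (o : nat)%:Z + (n - o)%N%:Z by case: o {xb yb xr yr xe ye}; lia.
by rewrite (occursP _ _ _ xr) ?(occursP _ _ _ yr)//; lia.
Qed.

Lemma countable_not_deep :
  countable [set x | locally_chacon x /\ ~ deep x].
Proof.
have sub : [set x | locally_chacon x /\ ~ deep x] `<=`
    \bigcup_(eo in [set: int * bool]) [set x | forall n, boundary x n eo].
  by move=> x [xX /(not_deep_boundary xX)[eo xeo]]; exists eo.
apply: sub_countable (subset_card_le sub) _.
apply: bigcup_countable => // eo _.
apply/countable_injP; exists (fun=> 0%N) => x y /[!inE] xb yb _.
exact: boundary_inj xb yb.
Qed.

Lemma countable_orbit (y : int -> bool) :
  countable [set x : int -> bool | exists r, forall u, x u = y (u + r)].
Proof.
have sub : [set x : int -> bool | exists r, forall u, x u = y (u + r)] `<=`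
    \bigcup_(r in [set: int]) [set (fun u => y (u + r))].
  by move=> x [r xr]; exists r => //; apply/funext.
apply: sub_countable (subset_card_le sub) _.
by apply: bigcup_countable => // r _; exact: countable1.
Qed.

(** * Correlations along the towers *)

Section correlation.
Variable R : realType.
Implicit Types f g : int -> R.

(** The sum of the three copies of f that an (n+1)-block contains, for H = h n. *)
Definition copies (H : nat) f : int -> R :=
  fun s => f s + f (s - H%:Z) + f (s - (2 * H).+1%:Z).

(** The reflection of [copies], that is, its adjoint for the sum over int. *)
Definition rcopies (H : nat) f : int -> R :=
  fun s => f s + f (s + H%:Z) + f (s + (2 * H).+1%:Z).

(** The function f on each of the m-blocks of an (m+M)-block. *)
Fixpoint spread m f M : int -> R :=
  if M is L.+1 then copies (h (m + L)) (spread m f L) else f.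

Fixpoint rspread m f M : int -> R :=
  if M is L.+1 then rcopies (h (m + L)) (rspread m f L) else f.

(** The effect on a correlation of replacing both functions by their three
    copies: the coefficients count the nine differences of the offsets 0, H and
    2 H + 1. *)
Definition bicopies (H : nat) g : int -> R :=
  fun s => 3 * g s + g (s - H%:Z) + g (s - H%:Z - 1)
    + g (s + H%:Z + 1) + g (s + H%:Z)
    + g (s - (2 * H).+1%:Z) + g (s + (2 * H).+1%:Z).

Fixpoint bispread m g M : int -> R :=
  if M is L.+1 then bicopies (h (m + L)) (bispread m g L) else g.

Definition supported (H : nat) f := forall t, f t != 0 -> 0 <= t < H%:Z.

Lemma supportedP H f t : supported H f -> (t < 0) || (H%:Z <= t) -> f t = 0.
Proof. by move=> fH tH; apply/eqP/negPn/negP => /fH; lia. Qed.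

Lemma copies_supported H f : supported H f -> supported (3 * H + 1) (copies H f).
Proof.
move=> fH t; apply: contraR => tH.
by rewrite /copies !(supportedP fH) ?addr0//; lia.
Qed.

Lemma spread_supported m f M : supported (h m) f ->
  supported (h (m + M)) (spread m f M).
Proof.
move=> fm; elim: M => [|M IHM] /=; first by rewrite addn0.
by rewrite addnS hS; exact: copies_supported.
Qed.

Definition corr H f g (s : int) : R := \sum_(t < H) f t%:Z * g (t%:Z + s).

Lemma sum_copies H f (phi : int -> R) : supported H f ->
  \sum_(t < 3 * H + 1) copies H f t%:Z * phi t%:Z =
  \sum_(t < H) f t%:Z * (phi t%:Z + phi (t%:Z + H%:Z) + phi (t%:Z + (2 * H).+1%:Z)).
Proof.
move=> fH.
rewrite (_ : (3 * H + 1 = H + (H + H.+1))%N); last lia.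
rewrite !big_split_ord /= big_ord_recl /= [copies H f (_ + (_ + 0))%N](_ : _ = 0).
  rewrite mul0r add0r -!big_split; apply: eq_bigr => t _ /=.
  have := ltn_ord t => tH.
  rewrite (_ : copies H f t%:Z = f t%:Z); last first.
    by rewrite /copies [f (_ - H%:Z)](supportedP fH) 1?[f (_ - _)](supportedP fH) ?addr0//; lia.
  rewrite (_ : copies H f (H + t)%N%:Z = f t%:Z); last first.
    rewrite /copies (supportedP fH) 1?[f (_ - (2 * H).+1%:Z)](supportedP fH); try lia.
    by rewrite add0r addr0; congr f; lia.
  rewrite (_ : copies H f _%:Z = f t%:Z); last first.
    rewrite /copies (supportedP fH) 1?[f (_ - H%:Z)](supportedP fH) /bump; try lia.
    by rewrite !add0r; congr f; lia.
  by rewrite !mulrDr addrA; congr (_ + _ * phi _ + _ * phi _); rewrite /bump; lia.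
by rewrite /copies !(supportedP fH) ?addr0//; lia.
Qed.

Lemma corr_copies H f g s : supported H f ->
  corr (3 * H + 1) (copies H f) (copies H g) s = bicopies H (corr H f g) s.
Proof.
move=> fH; rewrite /corr (sum_copies (fun t => copies H g (t + s)))//.
rewrite /bicopies mulr_sumr -!big_split; apply: eq_bigr => t _ /=.
rewrite /copies.
rewrite (_ : t%:Z + H%:Z + s - H%:Z = t%:Z + s); last lia.
rewrite (_ : t%:Z + (2 * H).+1%:Z + s - (2 * H).+1%:Z = t%:Z + s); last lia.
rewrite (_ : t%:Z + H%:Z + s - (2 * H).+1%:Z = t%:Z + (s - H%:Z - 1)); last lia.
rewrite (_ : t%:Z + (2 * H).+1%:Z + s - H%:Z = t%:Z + (s + H%:Z + 1)); last lia.
rewrite (_ : t%:Z + H%:Z + s = t%:Z + (s + H%:Z)); last lia.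
rewrite (_ : t%:Z + (2 * H).+1%:Z + s = t%:Z + (s + (2 * H).+1%:Z)); last lia.
rewrite -!addrA; ring.
Qed.

Lemma corr_spread m f g M s : supported (h m) f ->
  corr (h (m + M)) (spread m f M) (spread m g M) s = bispread m (corr (h m) f g) M s.
Proof.
move=> fm; elim: M s => [|M IHM] s /=; first by rewrite addn0.
rewrite addnS hS corr_copies; last exact: spread_supported.
by rewrite /bicopies !IHM.
Qed.

Lemma spread_add m f i j s : spread m f (i + j) s = spread (m + i) (spread m f i) j s.
Proof.
elim: j s => [|j IHj] s; first by rewrite addn0.
by rewrite addnS /= /copies !IHj addnA.
Qed.

Lemma rspread_le m f M (B : R) s : (forall s, f s <= B) ->
  rspread m f M s <= 3 ^+ M * B.
Proof.
move=> fB; elim: M s => [|M IHM] s /=; first by rewrite mul1r.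
by rewrite /rcopies exprS; have := IHM s; have := IHM (s + (h (m + M))%:Z);
  have := IHM (s + (2 * h (m + M)).+1%:Z); lra.
Qed.

Lemma rspread_copies m f H M s :
  rspread m (copies H f) M s = copies H (rspread m f M) s.
Proof.
elim: M s => // M IHM s /=; rewrite /rcopies !IHM /copies.
set H' := h _.
have sw u v : s + u - v = s - v + u by lia.
by rewrite !sw; lra.
Qed.

Lemma bicopies_rcopies f H s : bicopies H f s = rcopies H (copies H f) s.
Proof.
rewrite /bicopies /rcopies /copies !addrK.
rewrite (_ : s + H%:Z - (2 * H).+1%:Z = s - H%:Z - 1); last lia.
rewrite (_ : s + (2 * H).+1%:Z - H%:Z = s + H%:Z + 1); last lia.
lra.
Qed.

Lemma eq_rcopies H f g s : f =1 g -> rcopies H f s = rcopies H g s.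
Proof. by move=> fg; rewrite /rcopies !fg. Qed.

(** The kernel of [bispread] is the product of those of [spread] and of its
    reflection, which commute. *)
Lemma bispread_rspread m g M s : bispread m g M s = rspread m (spread m g M) M s.
Proof.
elim: M s => // M IHM s /=.
rewrite bicopies_rcopies; apply: eq_rcopies => u.
by rewrite rspread_copies /copies !IHM.
Qed.

Definition box (u v s : int) : R := if u <= s <= v then 1 else 0.

Lemma box_ge0 u v s : 0 <= box u v s.
Proof. by rewrite /box; case: ifP. Qed.

Lemma spread_box m u v M s : v - u < (h m)%:Z ->
  (0 <= spread m (box u v) M s <= 1) /\ (spread m (box u v) M s != 0 -> u <= s <= v + (h (m + M))%:Z - (h m)%:Z).
Proof.
move=> uv; elim: M s => [|M IHM] s /=.
  by rewrite /box addn0; case: (boolP (u <= s <= v)) => //= us; rewrite ?ler01 ?lexx ?eqxx//; split => //; lia.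
rewrite /copies addnS hS; set H := h (m + M) in IHM *; set b := spread _ _ _.
have b0 t : ~~ (u <= t <= v + H%:Z - (h m)%:Z) -> b t = 0.
  by move=> ut; apply/eqP; apply: contraR ut => /(IHM t).2.
have b1 t : 0 <= b t <= 1 by exact: (IHM t).1.
split; last first.
  by move=> n0; apply: contraR n0 => n0; rewrite !b0 ?addr0 ?eqxx//; lia.
have [i1|o1] := boolP (u <= s <= v + H%:Z - (h m)%:Z).
  by rewrite (b0 (s - H%:Z)) ?(b0 (s - (2 * H).+1%:Z)) ?addr0//; lia.
have [i2|o2] := boolP (u <= s - H%:Z <= v + H%:Z - (h m)%:Z).
  by rewrite (b0 s) ?(b0 (s - (2 * H).+1%:Z)) ?addr0 ?add0r//; lia.
by rewrite (b0 s) ?(b0 (s - H%:Z)) ?add0r.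
Qed.

Lemma bispread_le m f g M s : (forall s, f s <= g s) ->
  bispread m f M s <= bispread m g M s.
Proof.
move=> fg; elim: M s => //= M IHM s; rewrite /bicopies.
set H := h _.
have := (IHM s, IHM (s - H%:Z), IHM (s - H%:Z - 1), IHM (s + H%:Z + 1),
  IHM (s + H%:Z), IHM (s - (2 * H).+1%:Z), IHM (s + (2 * H).+1%:Z)).
by move=> [] [] [] [] [] []; lra.
Qed.

Lemma bispread_sum m (I : Type) (r : seq I) (f : I -> int -> R) M s :
  bispread m (fun s => \sum_(i <- r) f i s) M s = \sum_(i <- r) bispread m (f i) M s.
Proof.
elim: M s => //= M IHM s; rewrite /bicopies !IHM mulr_sumr -!big_split.
by [].
Qed.

(** The box is cut into N boxes of length h m; the copies of each of these
    under [spread] are disjoint, and [rspread] multiplies bounds by 3 ^ M. *)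
Lemma bispread_box m u (N : nat) M s :
  bispread m (box u (u + (N * h m)%:Z - 1)) M s <= N%:R * 3 ^+ M.
Proof.
pose b (i : nat) := box (u + (i * h m)%:Z) (u + (i.+1 * h m)%:Z - 1).
apply: (@le_trans _ _ (bispread m (fun s => \sum_(i <- iota 0 N) b i s) M s)).
  apply: bispread_le => t; rewrite /box; case: (boolP (_ <= _ <= _)) => /= ut.
    have hm := h_gt0 m.
    have [i iE] : exists i : nat, i = (`|t - u|%N %/ h m)%N by exists (`|t - u|%N %/ h m)%N.
    have iN : (i < N)%N by rewrite iE ltn_divLR//; lia.
    rewrite (bigD1_seq i) ?mem_iota ?iota_uniq//= /b /box ifT.
      by rewrite lerDl sumr_ge0// => j _; exact: box_ge0.
    have := leq_divM `|t - u|%N (h m); have := ltn_ceil `|t - u|%N hm.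
    by rewrite -iE; lia.
  by rewrite sumr_ge0// => j _; exact: box_ge0.
rewrite bispread_sum -[N in N%:R](size_iota 0) -sum1_size natr_sum mulr_suml.
apply: ler_sum => i _; rewrite mul1r bispread_rspread -[leRHS]mulr1.
by apply: rspread_le => t; have [] := @spread_box m (u + (i * h m)%:Z) (u + (i.+1 * h m)%:Z - 1) M t; [have := h_gt0 m; lia|lra].
Qed.

End correlation.

(** * Averages over consecutive shifts *)

Section smoothing.
Variable R : realType.
Implicit Types f g G : int -> R.

(** The operator 1 + z, where z is the unit translation: it is produced by two
    adjacent blocks, which may or may not have a spacer between them. *)
Definition smooth g : int -> R := fun s => g s + g (s - 1).

(** The operator 1 - z. *)
Definition bdiff g : int -> R := fun s => g s - g (s - 1).

Lemma sum_pascal n (psi : nat -> R) :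
  \sum_(j < n.+2) 'C(n.+1, j)%:R * psi j =
  \sum_(j < n.+1) 'C(n, j)%:R * (psi j + psi j.+1).
Proof.
rewrite big_ord_recl /= bin0.
rewrite (eq_bigr (fun j : 'I_n.+1 => 'C(n, j.+1)%:R * psi j.+1 + 'C(n, j)%:R * psi j.+1)); last first.
  by move=> j _; rewrite /bump /= !add1n binS natrD mulrDl.
rewrite big_split addrA.
rewrite (_ : 1%:R * _ + _ = \sum_(j < n.+1) 'C(n, j)%:R * psi j); last first.
  transitivity (\sum_(j < n.+2) 'C(n, j)%:R * psi j).
    rewrite [RHS]big_ord_recl /= bin0; congr (_ + _).
  by rewrite big_ord_recr /= bin_small// mul0r addr0.
by rewrite -big_split; apply: eq_bigr => j _; rewrite mulrDr.
Qed.

Lemma iter_smoothE n G s :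
  iter n smooth G s = \sum_(j < n.+1) 'C(n, j)%:R * G (s - j%:Z).
Proof.
elim: n G s => [|n IHn] G s; first by rewrite big_ord1 bin0 mul1r subr0.
rewrite iterSr IHn (sum_pascal n (fun j => G (s - j%:Z))).
by apply: eq_bigr => j _; rewrite /smooth; congr (_ * (_ + G _)); lia.
Qed.

(** This is the identity
    (n + 1) (1 - z) (1 + z)^n = (n + 1) (1 + z)^(n + 1) - 2 z d/dz (1 + z)^(n + 1). *)
Lemma iter_smooth_diff n G s : n.+1%:R * iter n smooth (bdiff G) s =
  \sum_(j < n.+2) 'C(n.+1, j)%:R * ((n.+1%:R - 2 * j%:R) * G (s - j%:Z)).
Proof.
elim: n G s => [|n IHn] G s.
  by rewrite !big_ord_recl big_ord0 /= /bump /= /bdiff !bin0 binn subr0; lra.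
rewrite (sum_pascal n.+1 (fun j => (n.+2%:R - 2 * j%:R) * G (s - j%:Z))).
have -> : n.+2%:R * iter n.+1 smooth (bdiff G) s =
    n.+1%:R * iter n smooth (bdiff (smooth G)) s + iter n.+1 smooth (bdiff G) s.
  rewrite -[n.+2%:R]natr1 mulrDl mul1r iterSr; congr (_ * _ + _).
  rewrite !iter_smoothE; apply: eq_bigr => j _; rewrite /smooth /bdiff; lra.
rewrite IHn iter_smoothE -big_split; apply: eq_bigr => j _ /=.
rewrite /smooth /bdiff (_ : s - j.+1%:Z = s - j%:Z - 1); last lia.
by rewrite -[n.+2%:R]natr1 -[j.+1%:R]natr1; ring.
Qed.

Lemma sum_binomial n : \sum_(j < n.+1) 'C(n, j)%:R = 2 ^+ n :> R.
Proof.
elim: n => [|n IHn]; first by rewrite big_ord1 bin0 expr0.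
under eq_bigr do rewrite -[_%:R]mulr1.
rewrite (sum_pascal n (fun=> 1)) exprS -IHn mulr_sumr.
by apply: eq_bigr => j _; lra.
Qed.

(** The variance of the binomial distribution. *)
Lemma sum_binomial_sqr n :
  \sum_(j < n.+1) 'C(n, j)%:R * (n%:R - 2 * j%:R) ^+ 2 = n%:R * 2 ^+ n :> R.
Proof.
elim: n => [|n IHn].
  by rewrite big_ord1 /= mulr0 subrr expr0n mulr0 mul0r.
rewrite (sum_pascal n (fun j => (n.+1%:R - 2 * j%:R) ^+ 2)).
rewrite (eq_bigr (fun j : 'I_n.+1 =>
    2 * ('C(n, j)%:R * (n%:R - 2 * j%:R) ^+ 2) + 2 * 'C(n, j)%:R)); last first.
  by move=> j _; rewrite -[n.+1%:R]natr1 -[j.+1%:R]natr1; ring.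
by rewrite big_split -!mulr_sumr /= IHn sum_binomial exprS -[n.+1%:R]natr1; ring.
Qed.

(** The absolute values of the coefficients of (1 - z) (1 + z)^n add up to
    at most 2^(n + 1) / sqrt (n + 1), by the variance of the binomial distribution
    and 2 |z| <= r + z^2 / r. Taking n + 1 = r^2 avoids square roots. *)
Lemma smooth_diff_le n r G B s : (0 < r)%N -> n.+1 = (r ^ 2)%N ->
  (forall s, `|G s| <= B) ->
  `|iter n smooth (bdiff G) s| <= 2 ^+ n.+1 * (B / r%:R).
Proof.
move=> r0 nr GB.
have rR : 0 < r%:R :> R by rewrite ltr0n.
have B0 : 0 <= B by exact: le_trans (GB 0).
have nrR : n.+1%:R = r%:R ^+ 2 :> R by rewrite nr natrX.
have n0 : 0 < n.+1%:R :> R by rewrite ltr0n.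
rewrite -(ler_pM2l n0) -[X in X * `|_| <= _](ger0_norm (ltW n0)) -normrM.
rewrite iter_smooth_diff; apply: le_trans (ler_norm_sum _ _ _) _.
have le1 (j : 'I_n.+2) : true ->
    `|'C(n.+1, j)%:R * ((n.+1%:R - 2 * j%:R) * G (s - j%:Z))| <=
    B / 2 * (r%:R * 'C(n.+1, j)%:R +
      r%:R^-1 * ('C(n.+1, j)%:R * (n.+1%:R - 2 * j%:R) ^+ 2)).
  move=> _; rewrite !normrM ger0_norm ?ler0n//.
  set z := n.+1%:R - 2 * j%:R; set c := 'C(_, _)%:R.
  have c0 : 0 <= c by rewrite ler0n.
  have z2 : `|z| <= (r%:R + r%:R^-1 * z ^+ 2) / 2.
    have zz : `|z| ^+ 2 = z ^+ 2 by rewrite real_normK ?num_real.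
    have : 0 <= r%:R^-1 * (r%:R - `|z|) ^+ 2.
      by rewrite mulr_ge0 ?sqr_ge0// invr_ge0 ltW.
    have -> : r%:R^-1 * (r%:R - `|z|) ^+ 2 =
      r%:R - 2 * `|z| + r%:R^-1 * `|z| ^+ 2 by field; rewrite lt0r_neq0.
    by rewrite zz; lra.
  apply: (@le_trans _ _ (c * ((r%:R + r%:R^-1 * z ^+ 2) / 2 * B))).
    by rewrite ler_wpM2l// ler_pM.
  by lra.
apply: le_trans (ler_sum _ le1) _.
rewrite -mulr_sumr big_split -!mulr_sumr /= sum_binomial sum_binomial_sqr nrR.
by rewrite le_eqVlt; apply/orP; left; apply/eqP; field; rewrite lt0r_neq0.
Qed.

Lemma iter_smooth_le k g B u v s : (forall s, `|g s| <= B) ->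
  (forall s, g s != 0 -> u <= s <= v) ->
  `|iter k smooth g s| <= 2 ^+ k * (B * box R u (v + k%:Z) s).
Proof.
move=> gB guv; elim: k s => [|k IHk] s /=.
  rewrite addr0 mul1r /box; case: ifP => [_|uv]; first by rewrite mulr1.
  by rewrite mulr0 normr_le0; apply: contraFT uv; exact: guv.
rewrite /smooth; apply: le_trans (ler_normD _ _) _.
have B0 : 0 <= B by exact: le_trans (gB 0).
have b1 : box R u (v + k%:Z) s <= box R u (v + k.+1%:Z) s.
  rewrite /box; case: ifP => [uv|_]; last by case: ifP.
  by rewrite ifT//; lia.
have b2 : box R u (v + k%:Z) (s - 1) <= box R u (v + k.+1%:Z) s.
  rewrite /box; case: ifP => [uv|_]; last by case: ifP.
  by rewrite ifT//; lia.
apply: le_trans (lerD (IHk s) (IHk (s - 1))) _.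
rewrite exprS -mulrDr [2 * _]mulrC -mulrA ler_wpM2l ?exprn_ge0//.
by rewrite mulrCA -mulrDr ler_wpM2l//; lra.
Qed.

End smoothing.

(** * Counting differences of digits *)

Section counting.
Variable R : realType.
Implicit Types (f g : int -> R) (phi : int -> R).

(** The sum of phi (c + D) over the differences D of two M-digit expansions in base
    3 that have fewer than j digit differences equal to 1 or -1, with the
    multiplicities of [bicopies], where H and H + 1 count as the same digit. *)
Fixpoint wsum M j phi (c : int) : R :=
  if M is L.+1 then
    3 * wsum L j phi c
    + 2 * wsum L j.-1 phi (c + (3 ^ L)%N%:Z)
    + 2 * wsum L j.-1 phi (c - (3 ^ L)%N%:Z)
    + wsum L j phi (c + (2 * 3 ^ L)%N%:Z) + wsum L j phi (c - (2 * 3 ^ L)%N%:Z)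
  else if (0 < j)%N then phi c else 0.

Lemma wsum0 M phi c : wsum M 0 phi c = 0.
Proof. by elim: M c => //= M IHM c; rewrite !IHM; lra. Qed.

Lemma wsum_le M j phi psi c : (forall D, phi D <= psi D) ->
  wsum M j phi c <= wsum M j psi c.
Proof.
move=> le; elim: M j c => [|M IHM] j c /=; first by case: ifP.
have := (IHM j c, IHM j.-1 (c + (3 ^ M)%N%:Z), IHM j.-1 (c - (3 ^ M)%N%:Z),
  IHM j (c + (2 * 3 ^ M)%N%:Z), IHM j (c - (2 * 3 ^ M)%N%:Z)).
by move=> [] [] [] []; lra.
Qed.

Lemma wsum_ext M j phi psi c : phi =1 psi -> wsum M j phi c = wsum M j psi c.
Proof. by move=> e; elim: M j c => [|M IHM] j c /=; rewrite ?e ?IHM. Qed.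

Lemma wsum_shift M j phi a c :
  wsum M j (fun D => phi (D + a)) c = wsum M j phi (c + a).
Proof.
elim: M j c => [|M IHM] j c //=; rewrite !IHM.
by rewrite ![c + _ + a]addrAC.
Qed.

Lemma wsum_sum M j (I : Type) (r : seq I) (f : I -> int -> R) c :
  wsum M j (fun D => \sum_(i <- r) f i D) c = \sum_(i <- r) wsum M j (f i) c.
Proof.
elim: M j c => [|M IHM] j c /=.
  by case: ifP => // _; rewrite big1.
by rewrite !IHM !mulr_sumr -!big_split.
Qed.

Lemma wsum_const0 M j c : wsum M j (fun=> 0) c = 0.
Proof.
by elim: M j c => [|M IHM] j c /=; [case: ifP|rewrite !IHM; lra].
Qed.

(** The recursion of [wsum] reads the highest digit; [wsum_pt] reads the lowest. *)
Lemma wsum_low M j phi c : wsum M.+1 j phi (3 * c) =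
  3 * wsum M j (fun D => phi (3 * D)) c
  + 2 * wsum M j.-1 (fun D => phi (3 * D + 1)) c
  + 2 * wsum M j.-1 (fun D => phi (3 * D - 1)) c
  + wsum M j (fun D => phi (3 * D + 2)) c + wsum M j (fun D => phi (3 * D - 2)) c.
Proof.
elim: M j c => [|M IHM] j c; first by rewrite /= expn0 muln1.
rewrite [LHS]/= -/(wsum M.+1 _ _ _).
have e1 (k : nat) : 3 * c + (k * 3 ^ M.+1)%N%:Z = 3 * (c + (k * 3 ^ M)%N%:Z).
  by rewrite expnS; lia.
have e2 (k : nat) : 3 * c - (k * 3 ^ M.+1)%N%:Z = 3 * (c - (k * 3 ^ M)%N%:Z).
  by rewrite expnS; lia.
have e3 := e1 1%N; have e4 := e2 1%N; rewrite !mul1n in e3 e4.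
rewrite -!/(wsum M.+1 _ _ _) e1 e2 e3 e4 !IHM /=.
lra.
Qed.

Definition pt (D : int) : int -> R := fun x => if x == D then 1 else 0.

(** Expansions in base 3 with M digits of absolute value at most 2, of which at
    most k are nonzero. *)
Fixpoint sparse M k (D : int) : Prop :=
  if M is L.+1 then
    (exists2 D', D = 3 * D' & sparse L k D') \/
    (exists k' D' d, [/\ k = k'.+1, d \in [:: 1; -1; 2; -2], D = 3 * D' + d
      & sparse L k' D'])
  else D = 0.

(** With the factor 3 ^ j in front, a digit difference 1 or -1 is charged
    with 1 / 3. The residue of D modulo 3 leaves either the digit 0, of weight 3, or
    two digits such as 1 and -2, of weight 2 / 3 + 1 = 3 * (5 / 9), and the second
    case occurs at least k times when D has no sparser expansion. *)
Lemma wsum_pt M j D k : (forall k', (k' < k)%N -> ~ sparse M k' D) ->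
  wsum M j (pt D) 0 <= 3 ^+ M * 3 ^+ j * (5 / 9) ^+ k.
Proof.
elim: M j D k => [|M IHM] j D k nS.
  rewrite /= mul1r /pt; case: k nS => [|k] nS; last first.
    by have [e|ne] := eqVneq 0 D; [have := nS 0%N isT => /(_ (esym e))|case: ifP => _; rewrite mulr_ge0 ?exprn_ge0//; lra].
  rewrite mulr1; apply: (@le_trans _ _ 1); first by case: ifP => //; case: ifP.
  by rewrite exprn_ege1//; lra.
have p5 l : 0 <= (5 / 9 : R) ^+ l by rewrite exprn_ge0//; lra.
have p3 l : 0 <= (3 : R) ^+ l by rewrite exprn_ge0.
case: j => [|j]; first by rewrite wsum0 !mulr_ge0.
rewrite -[in leLHS](mulr0 3) wsum_low /=.
have wadd0 i : wsum M i (fun x => pt D (3 * x)) 0 =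
    wsum M i (fun x => pt D (3 * x + 0)) 0.
  by apply: wsum_ext => x; rewrite addr0.
have wpt e i D' : D = 3 * D' + e ->
    wsum M i (fun x => pt D (3 * x + e)) 0 = wsum M i (pt D') 0.
  by move=> De; apply: wsum_ext => x; rewrite /pt De; congr (if _ then _ else _); lia.
have wpt0 e i : ~~ (3 %| D - e)%Z -> wsum M i (fun x => pt D (3 * x + e)) 0 = 0.
  move=> De; rewrite -[RHS](wsum_const0 M i 0); apply: wsum_ext => x.
  rewrite /pt ifF//; apply/negP => /eqP xD; move/negP: De; apply.
  by apply/dvdzP; exists x; rewrite -xD; lia.
have split_bound D1 D2 d1 d2 : d1 \in [:: 1; -1; 2; -2] -> d2 \in [:: 1; -1; 2; -2] ->
    D = 3 * D1 + d1 -> D = 3 * D2 + d2 ->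
    2 * wsum M j (pt D1) 0 + wsum M j.+1 (pt D2) 0 <=
    3 ^+ M.+1 * 3 ^+ j.+1 * (5 / 9) ^+ k.
  move=> d1s d2s D1E D2E.
  have nS1 k' l : (k'.+1 < k)%N -> (l <= k')%N -> ~ sparse M l D1.
    by move=> k'k lk' s1; apply: (nS l.+1); [lia|right; exists l, D1, d1].
  have bd1 : wsum M j (pt D1) 0 <= 3 ^+ M * 3 ^+ j * (5 / 9) ^+ k.-1.
    apply: IHM => l lk s1; apply: (nS l.+1); first lia.
    by right; exists l, D1, d1.
  have bd2 : wsum M j.+1 (pt D2) 0 <= 3 ^+ M * 3 ^+ j.+1 * (5 / 9) ^+ k.-1.
    apply: IHM => l lk s1; apply: (nS l.+1); first lia.
    by right; exists l, D2, d2.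
  have pM := p3 M; have pj := p3 j; have pk := p5 k.-1.
  rewrite !exprS in bd2 *.
  have pp : 0 <= 3 ^+ M * 3 ^+ j * (5 / 9) ^+ k.-1 :> R by rewrite !mulr_ge0.
  have : 3 ^+ M * 3 ^+ j * (5 / 9) ^+ k.-1 * 5 / 9 <= 3 ^+ M * 3 ^+ j * (5 / 9) ^+ k :> R.
    case: (k) => [|l] /=; first by rewrite expr0; nra.
    by rewrite [in leRHS]exprS; lra.
  lra.
have D3 : (exists D', D = 3 * D') \/ (exists D', D = 3 * D' + 1) \/ (exists D', D = 3 * D' - 1).
  have := divz_eq D 3; have := ltz_mod D (_ : 3 != 0); have := modz_ge0 D (_ : 3 != 0).
  move=> /(_ isT) m0 /(_ isT) m3 De.
  have [e|[e|e]] : (D %% 3)%Z = 0 \/ (D %% 3)%Z = 1 \/ (D %% 3)%Z = 2 by lia.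
  - by left; exists (D %/ 3)%Z; lia.
  - by right; left; exists (D %/ 3)%Z; lia.
  - by right; right; exists ((D %/ 3)%Z + 1); lia.
case: D3 => [[D' De]|[[D' De]|[D' De]]].
- rewrite (wpt0 1) ?(wpt0 (-1)) ?(wpt0 2) ?(wpt0 (-2)); try by rewrite De; lia.
  rewrite wadd0 (wpt 0 _ D') ?addr0//.
  have : wsum M j.+1 (pt D') 0 <= 3 ^+ M * 3 ^+ j.+1 * (5 / 9) ^+ k.
    by apply: IHM => l lk s1; apply: (nS l lk); left; exists D'.
  by rewrite [3 ^+ M.+1]exprS; lra.
- have w0 : wsum M j.+1 (fun x => pt D (3 * x)) 0 = 0.
    by rewrite wadd0 wpt0// De; lia.
  rewrite w0 (wpt0 (-1)) ?(wpt0 2); try by rewrite De; lia.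
  rewrite (wpt _ _ D')// (wpt (-2) _ (D' + 1)); last lia.
  have De2 : D = 3 * (D' + 1) + (-2) by lia.
  by have := split_bound D' (D' + 1) 1 (-2) isT isT De De2; lra.
- have w0 : wsum M j.+1 (fun x => pt D (3 * x)) 0 = 0.
    by rewrite wadd0 wpt0// De; lia.
  rewrite w0 (wpt0 1) ?(wpt0 (-2)); try by rewrite De; lia.
  rewrite (wpt _ _ D')// (wpt 2 _ (D' - 1)); last lia.
  have De2 : D = 3 * (D' - 1) + 2 by lia.
  by have := split_bound D' (D' - 1) (-1) 2 isT isT De De2; lra.
Qed.

Lemma smooth_bispread m g M s :
  bispread m (smooth g) M s = smooth (bispread m g M) s.
Proof.
elim: M s => // M IHM s /=; rewrite /bicopies !IHM /smooth.
set H := h _; set b := bispread _ _ _.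
rewrite ![s - 1 + _]addrAC [s + H%:Z - 1 + 1]addrAC.
lra.
Qed.

Lemma eq_bispread m f g M s : f =1 g -> bispread m f M s = bispread m g M s.
Proof. by move=> fg; elim: M s => //= M IHM s; rewrite /bicopies !IHM. Qed.

Lemma bispread_scale m a f M s :
  bispread m (fun s => a * f s) M s = a * bispread m f M s.
Proof. by elim: M s => //= M IHM s; rewrite /bicopies !IHM; lra. Qed.

Lemma bispread_shift m a f M s :
  bispread m (fun s => f (s + a)) M s = bispread m f M (s + a).
Proof.
elim: M s => //= M IHM s; rewrite /bicopies !IHM.
by rewrite ![_ + a - _]addrAC ![_ + a + _]addrAC.
Qed.

(** As 2 h (m + L) + 1 = q 3 ^ L for q = 2 h m + 1, the digit differences
    given by D move the offset by q D / 2, up to a bounded error. *)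
Definition close_to q E (s D : int) : R := if `|q * D - 2 * s| <= E then 1 else 0.

(** Each level at which the digits of the two indices differ by one lets the
    kernel pass from g j.+1 to the smoother g j; [wsum] counts the pairs of indices
    with fewer than j such levels, which never reach g 0. *)
Lemma bispread_smoothing m (g : nat -> int -> R) k X Y u v (E : nat) :
  0 <= X -> 0 <= Y ->
  (forall j s, (j < k)%N -> smooth (g j.+1) s = 2 * g j s) ->
  (forall s, `|g 0%N s| <= Y * box R u v s) ->
  (forall j s, (0 < j <= k)%N -> `|g j s| <= X * box R u v s) ->
  (forall s, u <= s <= v -> `|2 * s| <= E%:Z) ->
  forall M j s, (j <= k)%N ->
  `|bispread m (g j) M s| <=
    X * wsum M j (close_to (2 * h m + 1)%N%:Z (E + j)%N%:Z s) 0
    + Y * bispread m (box R (u - j%:Z) (v + j%:Z)) M s.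
Proof.
move=> X0 Y0 gS g0 gX Euv; elim=> [|M IHM] j s jk /=.
  case: j jk => [|j] jk /=.
    by rewrite subr0 addr0 mulr0 add0r.
  apply: le_trans (gX _ _ _) _ => //.
  rewrite -[leLHS]addr0 lerD//; last by rewrite mulr_ge0// box_ge0.
  rewrite ler_wpM2l// /box /close_to; case: ifP => [uv|_]; last by case: ifP.
  by have := Euv _ uv => ?; rewrite ifT//; lia.
set H := h (m + M) in IHM *; set q := (2 * h m + 1)%N in IHM *.
have HE : (2 * H + 1 = q * 3 ^ M)%N by rewrite /H /q h_addn.
have shiftw i (t b : int) (e : nat) :
    (forall D : int, `|q%:Z * D - 2 * t| <= e%:Z ->
       `|q%:Z * (D + b) - 2 * s| <= (E + j)%N%:Z) ->
    X * wsum M i (close_to q%:Z e%:Z t) 0 <= X * wsum M i (close_to q%:Z (E + j)%N%:Z s) b.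
  move=> st; rewrite ler_wpM2l// -[b in leRHS]add0r -wsum_shift.
  apply: wsum_le => D; rewrite /close_to; case: ifP => [/st ->//|_]; by case: ifP.
have w3 : X * wsum M j (close_to q%:Z (E + j)%N%:Z (s - (2 * H).+1%:Z)) 0 <=
    X * wsum M j (close_to q%:Z (E + j)%N%:Z s) (0 + (2 * 3 ^ M)%N%:Z).
  by rewrite add0r; apply: shiftw => D; rewrite mulrDr; lia.
have w4 : X * wsum M j (close_to q%:Z (E + j)%N%:Z (s + (2 * H).+1%:Z)) 0 <=
    X * wsum M j (close_to q%:Z (E + j)%N%:Z s) (0 - (2 * 3 ^ M)%N%:Z).
  by rewrite add0r; apply: shiftw => D; rewrite mulrDr; lia.
have := IHM j (s - (2 * H).+1%:Z) jk; have := IHM j (s + (2 * H).+1%:Z) jk.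
have := IHM j s jk.
set bj := box R (u - j%:Z) (v + j%:Z).
case: j jk => [|j] jk in shiftw w3 w4 bj *.
  rewrite /= /bicopies !wsum0 !mulr0 !add0r => i0 i1 i2.
  have := IHM 0%N (s - H%:Z) jk; have := IHM 0%N (s - H%:Z - 1) jk.
  have := IHM 0%N (s + H%:Z) jk; have := IHM 0%N (s + H%:Z + 1) jk.
  rewrite !wsum0 !mulr0 !add0r -/bj => i3 i4 i5 i6.
  move: i0 i1 i2 i3 i4 i5 i6; rewrite !ler_norml; lra.
have sm t : bispread m (g j.+1) M t + bispread m (g j.+1) M (t - 1) =
    2 * bispread m (g j) M t.
  rewrite -/(smooth (bispread m (g j.+1) M) t) -smooth_bispread -bispread_scale.
  by apply: eq_bispread => r; exact: gS.
have IHj t := IHM j t (ltnW jk).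
have w1 : X * wsum M j (close_to q%:Z (E + j)%N%:Z (s - H%:Z)) 0 <=
    X * wsum M j (close_to q%:Z (E + j.+1)%N%:Z s) (0 + (3 ^ M)%N%:Z).
  by rewrite add0r; apply: shiftw => D; rewrite mulrDr; lia.
have w2 : X * wsum M j (close_to q%:Z (E + j)%N%:Z (s + H%:Z + 1)) 0 <=
    X * wsum M j (close_to q%:Z (E + j.+1)%N%:Z s) (0 - (3 ^ M)%N%:Z).
  by rewrite add0r; apply: shiftw => D; rewrite mulrBr; lia.
have b1 t : Y * bispread m (box R (u - j%:Z) (v + j%:Z)) M t <= Y * bispread m bj M t.
  rewrite ler_wpM2l//; apply: bispread_le => r; rewrite /bj /box.
  by case: ifP => [ur|_]; [rewrite ifT//; lia|case: ifP].
have b2 t : Y * bispread m (box R (u - j%:Z) (v + j%:Z)) M t <= Y * bispread m bj M (t - 1).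
  rewrite -(bispread_shift m (-1)) ler_wpM2l//; apply: bispread_le => r.
  rewrite /bj /box; by case: ifP => [ur|_]; [rewrite ifT//; lia|case: ifP].
have := sm (s - H%:Z); have := sm (s + H%:Z + 1); rewrite addrK.
have := IHj (s - H%:Z); have := IHj (s + H%:Z + 1).
have := b1 (s - H%:Z); have := b2 (s - H%:Z).
have := b1 (s + H%:Z + 1); have := b2 (s + H%:Z + 1); rewrite addrK.
rewrite /= /bicopies !ler_norml.
set a1 := bispread m (g j.+1) M s.
move: w1 w2 w3 w4; rewrite /=.
move=> *; lra.
Qed.

End counting.

(** * Decay of the correlation of blocks *)

(** A digit d at place L stands for d heights of level m + L, because
    2 h (m + L) + 1 = (2 h m + 1) 3 ^ L. *)
Lemma sparse_term_sum m M k D : sparse M k D ->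
  exists2 ts, (size ts <= 2 * k)%N &
    `|(2 * h m + 1)%N%:Z * D - 2 * term_sum ts| <= (2 * k)%N%:Z.
Proof.
elim: M m k D => [|M IHM] m k D /=.
  by move=> ->; exists [::]; rewrite // /term_sum big_nil; lia.
case=> [[D' -> /(IHM m.+1)[ts sts]]|[k' [D' [d [-> d4 -> /(IHM m.+1)[ts sts]]]]]].
  by rewrite hS => le; exists ts => //; lia.
rewrite hS => le.
move: d4; rewrite !inE => /or4P[] /eqP->.
- by exists ((true, m) :: ts); rewrite /= ?term_sum_cons /term_val /=; lia.
- by exists ((false, m) :: ts); rewrite /= ?term_sum_cons /term_val /=; lia.
- by exists ((true, m) :: (true, m) :: ts); rewrite /= ?term_sum_cons /term_val /=; lia.
- by exists ((false, m) :: (false, m) :: ts); rewrite /= ?term_sum_cons /term_val /=; lia.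
Qed.

Section correlation_small.
Variable R : realType.
Implicit Types (f g : int -> R).

Lemma spread_diff m f M s : spread m (bdiff f) M s = bdiff (spread m f M) s.
Proof.
elim: M s => // M IHM s /=; rewrite /copies !IHM /bdiff.
by rewrite ![s - 1 - _]addrAC; lra.
Qed.

(** The copies of f are disjoint. *)
Lemma spreadP m f M t : supported (h m) f ->
  (spread m f M t = 0 /\ forall p, start m M p -> ~~ (0 <= t - p < (h m)%:Z)) \/
  (exists p, [/\ start m M p, 0 <= t - p < (h m)%:Z & spread m f M t = f (t - p)]).
Proof.
move=> fm; elim: M t => [|M IHM] t /=.
  have [tm|tm] := boolP (0 <= t < (h m)%:Z); [right|left].
    by exists 0; rewrite subr0.
  by split; [apply/eqP; apply: contraR tm => /fm|move=> p /eqP->; rewrite subr0].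
set H := h (m + M).
have out u : ~~ (0 <= u < H%:Z) -> spread m f M u = 0.
  by move=> uH; apply/eqP; apply: contraR uH; exact: spread_supported.
have outp u p : ~~ (0 <= u < H%:Z) -> start m M p -> ~~ (0 <= u - p < (h m)%:Z).
  by move=> uH /start_bounds; rewrite -/H; lia.
have hm := h_gt0 m.
have sw u p : t - u - p = t - (p + u) by lia.
rewrite /copies -/H.
have [t1|o1] := boolP (0 <= t < H%:Z).
  rewrite (out (t - H%:Z)) ?(out (t - (2 * H).+1%:Z)) ?addr0; try lia.
  have [[-> np]|[p [sp tp ->]]] := IHM t; last by right; exists p; rewrite sp.
  left; split => // p /or3P[]; first exact: np.
    by move/(outp (t - H%:Z)); rewrite sw subrK; apply; lia.
  by move/(outp (t - (2 * H).+1%:Z)); rewrite sw subrK; apply; lia.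
have [t2|o2] := boolP (0 <= t - H%:Z < H%:Z).
  rewrite (out t) ?(out (t - (2 * H).+1%:Z)) ?addr0 ?add0r; try lia.
  have [[-> np]|[p [sp tp ->]]] := IHM (t - H%:Z).
    left; split => // p /or3P[].
    - by apply: outp.
    - by move/np; rewrite sw subrK.
    - by move/(outp (t - (2 * H).+1%:Z)); rewrite sw subrK; apply; lia.
  by right; exists (p + H%:Z); rewrite addrK sp orbT -sw.
rewrite (out t) ?(out (t - H%:Z)) ?add0r; try lia.
have [[-> np]|[p [sp tp ->]]] := IHM (t - (2 * H).+1%:Z).
  left; split => // p /or3P[].
  - by apply: outp.
  - by move/(outp (t - H%:Z)); rewrite sw subrK; apply; lia.
  - by move/np; rewrite sw subrK.
by right; exists (p + (2 * H).+1%:Z); rewrite addrK sp !orbT -sw.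
Qed.

Lemma spread_norm_le m f M t B : supported (h m) f -> 0 <= B ->
  (forall u, `|f u| <= B) -> `|spread m f M t| <= B.
Proof.
move=> fm B0 fB.
by have [[-> _]|[p [_ _ ->]]] := spreadP M t fm; rewrite ?normr0.
Qed.

(** A primitive of [pulse] with support in the block, which makes
    [smooth_diff_le] applicable. *)
Definition ramp m (t : int) : R :=
  if 0 <= t < (h m)%:Z then (h m)%:R - 1 - t%:~R else 0.

(** By [pulseE], this is h m - 1 at the start of an m-block and -1 at its other
    letters: it has mean zero, and -1 signals that no m-block starts. *)
Definition pulse m : int -> R := bdiff (ramp m).

Lemma pulseE m t : pulse m t =
  if t == 0 then (h m)%:R - 1 else if 0 < t < (h m)%:Z then -1 else 0.
Proof.
rewrite /pulse /bdiff /ramp; have hm := h_gt0 m.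
have [->|t0] := eqVneq t 0; first by rewrite /= !ifT ?ifF; [lra|lia..].
case: (boolP (0 < t < _)) => tm.
  by rewrite !ifT; [rewrite intrB; lra|lia..].
rewrite ifF; last by lia.
case: ifP => // tm'; last lra.
have -> : t - 1 = (h m)%:Z - 1 by lia.
by rewrite rmorphB /= -pmulrn; lra.
Qed.

Lemma ramp_supported m : supported (h m) (ramp m).
Proof. by move=> t; rewrite /ramp; case: ifP => //; rewrite eqxx. Qed.

Lemma pulse_supported m : supported (h m) (pulse m).
Proof.
move=> t; rewrite pulseE; have := h_gt0 m => hm.
have [->|t0] := eqVneq t 0; first lia.
by case: (boolP (0 < t < _)); rewrite ?eqxx//; lia.
Qed.

Lemma ramp_norm_le m t : `|ramp m t| <= (h m)%:R.
Proof.
rewrite /ramp; case: ifP => [tm|_]; last by rewrite normr0 ler0n.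
have t0 : 0 <= t%:~R :> R by rewrite ler0z; lia.
have : t%:~R <= (h m)%:R - 1 :> R.
  rewrite -[(h m)%:R]/((h m)%:Z%:~R) -[1]/(1%:~R) -rmorphB /= ler_int; lia.
by move=> th; rewrite ler_norml; lra.
Qed.

Lemma pulse_norm_le m t : `|pulse m t| <= (h m)%:R.
Proof.
have h1 : 1 <= (h m)%:R :> R by rewrite ler1n h_gt0.
rewrite pulseE; case: ifP => _; first by rewrite ler_norml; lra.
by case: ifP => _; rewrite ?normrN ?normr1 ?normr0//; lra.
Qed.

Definition pulses m M : int -> R := spread m (pulse m) M.

Definition pulse_corr m M : int -> R :=
  corr (h (m + M)) (pulses m M) (pulses m M).

Lemma pulses_supported m M : supported (h (m + M)) (pulses m M).
Proof. exact/spread_supported/pulse_supported. Qed.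

Lemma pulses_norm_le m M t : `|pulses m M t| <= (h m)%:R.
Proof.
apply: spread_norm_le; [exact: pulse_supported|exact: ler0n|exact: pulse_norm_le].
Qed.

Lemma corr_norm_le H f g B s : (forall t, `|f t| <= B) -> (forall t, `|g t| <= B) ->
  `|corr H f g s| <= H%:R * B ^+ 2.
Proof.
move=> fB gB; apply: le_trans (ler_norm_sum _ _ _) _.
rewrite mulr_natl -[X in _ *+ X]card_ord -sumr_const; apply: ler_sum => t _.
by rewrite normrM expr2 ler_pM.
Qed.

Lemma pulse_corrD m i M s :
  pulse_corr m (i + M) s = bispread (m + i) (pulse_corr m i) M s.
Proof.
rewrite /pulse_corr -corr_spread; last exact: pulses_supported.
rewrite addnA; apply: eq_bigr => t _.
by rewrite /pulses !spread_add.
Qed.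

Lemma pulse_corr_diff m i s : pulse_corr m i s =
  bdiff (corr (h (m + i)) (pulses m i) (spread m (ramp m) i)) s.
Proof.
rewrite /pulse_corr /corr /bdiff -sumrB; apply: eq_bigr => t _.
by rewrite -mulrBr addrA -/(bdiff _ _) -spread_diff.
Qed.

Lemma pulse_corr_supported m i s : pulse_corr m i s != 0 ->
  - (h (m + i))%:Z <= s <= (h (m + i))%:Z.
Proof.
apply: contraR => sh; rewrite /pulse_corr /corr big1// => t _.
rewrite [X in _ * X](supportedP (@pulses_supported m i)) ?mulr0//.
by have := ltn_ord t; lia.
Qed.

(** Bernoulli's inequality for 1 / x. *)
Lemma exists_expr_le (x e : R) : 0 < x -> x < 1 -> 0 < e -> exists k : nat, x ^+ k <= e.
Proof.
move=> x0 x1 e0.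
have y0 : 0 < x^-1 - 1 by rewrite subr_gt0 invf_gt1.
have [k ke] : exists k : nat, e^-1 / (x^-1 - 1) < k%:R.
  by exists (Num.bound (e^-1 / (x^-1 - 1))); rewrite archi_boundP// divr_ge0 ?invr_ge0 ?ltW.
exists k; rewrite -[leRHS]invrK -[leLHS]invrK lef_pV2 ?posrE ?invr_gt0 ?exprn_gt0//.
have bern : 1 + k%:R * (x^-1 - 1) <= x^-1 ^+ k.
  elim: (k) => [|l IHl]; first by rewrite mul0r addr0.
  have : 0 <= l%:R * (x^-1 - 1) ^+ 2 by rewrite mulr_ge0 ?sqr_ge0.
  rewrite [_ ^+ l.+1]exprS -natr1; have : 0 < x^-1 by rewrite invr_gt0.
  set z := x^-1 in y0 IHl *; set w := z ^+ l in IHl *; move: (l%:R) IHl => b IHl z0 bb.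
  by have := ler_wpM2l (ltW z0) IHl; rewrite expr2 in bb; lra.
rewrite -exprVn; apply: le_trans bern.
by move: ke; rewrite ltr_pdivrMr//; lra.
Qed.

(** The condition confines D to an interval of length at most six, starting
    from the quotient of 2 s - E by q. *)
Lemma close_to_le q E s D : 0 < q -> 2 * E <= 5 * q ->
  close_to R q E s D <= \sum_(i <- iota 0 7) pt R (((2 * s - E) %/ q)%Z + i%:Z) D.
Proof.
move=> q0 Eq; set D0 := ((2 * s - E) %/ q)%Z.
have [l1 l2] : D0 * q <= 2 * s - E /\ 2 * s - E < (D0 + 1) * q.
  have := divz_eq (2 * s - E) q; have := modz_ge0 (2 * s - E) (lt0r_neq0 q0).
  by have := ltz_pmod (2 * s - E) q0; rewrite -/D0; lia.
have pt0 i D' : 0 <= pt R i D' by rewrite /pt; case: ifP.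
rewrite /close_to; case: ifP => [nD|_]; last by apply: sumr_ge0 => *; exact: pt0.
have [b1 b2] : D0 <= D /\ D < D0 + 7.
  by split; [rewrite leNgt|rewrite ltNge]; apply/negP => ?; nia.
have [i iD] : exists i : nat, D = D0 + i%:Z by exists `|D - D0|%N; lia.
rewrite (bigD1_seq i) ?iota_uniq ?mem_iota//=; last lia.
by rewrite -iD {1}/pt eqxx lerDl; apply: sumr_ge0 => *; exact: pt0.
Qed.

(** The smoothing is applied up to r^2 - 1 times. The pairs of blocks where
    this succeeds contribute a term of order 1 / r by [smooth_diff_le], the others
    are counted by [wsum_pt]. *)
Lemma pulse_corr_le m i M s (r k : nat) :
  (0 < r)%N -> (r ^ 2 <= h (m + i))%N ->
  (forall D : int, `|(2 * h (m + i) + 1)%N%:Z * D - 2 * s| <= (20 * (2 * h (m + i) + 1))%N%:Z ->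
    forall k', (k' < k)%N -> ~ sparse M k' D) ->
  `|pulse_corr m (i + M) s| <=
    (h (m + (i + M)))%:R * ((h m)%:R ^+ 2 *
      (7 * 3 ^+ (r ^ 2)%N * (5 / 9) ^+ k + 12 / r%:R)).
Proof.
move=> r0 rh nS; rewrite pulse_corrD.
set H := h (m + i) in rh nS *; set q := (2 * H + 1)%N in nS.
have [k0 k0E] : exists k0, k0.+1 = (r ^ 2)%N by exists (r ^ 2).-1; rewrite prednK// expn_gt0 r0.
have k0H : (k0 < H)%N by lia.
set B : R := H%:R * (h m)%:R ^+ 2.
have B0 : 0 <= B by rewrite mulr_ge0 ?exprn_ge0 ?ler0n.
set G := corr H (pulses m i) (spread m (ramp m) i).
have GB t : `|G t| <= B.
  apply: corr_norm_le => u; first exact: pulses_norm_le.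
  by apply: spread_norm_le; [exact: ramp_supported|exact: ler0n|exact: ramp_norm_le].
have CB t : `|pulse_corr m i t| <= B.
  by apply: corr_norm_le => u; exact: pulses_norm_le.
pose g j : int -> R := fun t => 2 ^- (k0 - j) * iter (k0 - j) (@smooth R) (pulse_corr m i) t.
have p2 n : 0 < (2 : R) ^+ n by rewrite exprn_gt0.
have gS j t : (j < k0)%N -> smooth (g j.+1) t = 2 * g j t.
  move=> jk; rewrite /smooth /g -mulrDr (_ : (k0 - j = (k0 - j.+1).+1)%N); last lia.
  by rewrite iterS -/(smooth _ _) exprS; field; rewrite lt0r_neq0.
have sup n t : `|iter n (@smooth R) (pulse_corr m i) t| <=
    2 ^+ n * (B * box R (- H%:Z) (H%:Z + n%:Z) t).
  by apply: iter_smooth_le => // u; exact: pulse_corr_supported.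
have boxle n t : (n <= k0)%N ->
    box R (- H%:Z) (H%:Z + n%:Z) t <= box R (- H%:Z) (H%:Z + k0%:Z) t.
  by move=> nk; rewrite /box; case: ifP => [?|_]; [rewrite ifT//; lia|case: ifP].
have gE j t : `|g j t| = 2 ^- (k0 - j) * `|iter (k0 - j) (@smooth R) (pulse_corr m i) t|.
  by rewrite normrM ger0_norm// invr_ge0 ltW.
have gX j t : (0 < j <= k0)%N -> `|g j t| <= B * box R (- H%:Z) (H%:Z + k0%:Z) t.
  move=> jk; rewrite gE.
  rewrite -(ler_pM2l (p2 (k0 - j)%N)) mulVKf ?lt0r_neq0//.
  apply: le_trans (sup _ _) _.
  apply: ler_wpM2l; first exact: ltW.
  by apply: ler_wpM2l => //; apply: boxle; lia.
have g0 t : `|g 0%N t| <= 2 * B / r%:R * box R (- H%:Z) (H%:Z + k0%:Z) t.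
  rewrite gE subn0.
  rewrite -(ler_pM2l (p2 k0)) mulVKf ?lt0r_neq0//.
  rewrite /box; case: ifP => tb; last first.
    by have := sup k0 t; rewrite /box tb !mulr0.
  rewrite mulr1 (_ : 2 ^+ k0 * _ = 2 ^+ k0.+1 * (B / r%:R)); last by rewrite exprS; lra.
  have -> : iter k0 (@smooth R) (pulse_corr m i) t = iter k0 (@smooth R) (bdiff G) t.
    by rewrite !iter_smoothE; apply: eq_bigr => j _; rewrite pulse_corr_diff.
  exact: smooth_diff_le.
have Y0 : 0 <= 2 * B / r%:R by rewrite !mulr_ge0// invr_ge0.
have Eb t : - H%:Z <= t <= H%:Z + k0%:Z -> `|2 * t| <= (4 * H)%N%:Z by lia.
have -> : bispread (m + i) (pulse_corr m i) M s = bispread (m + i) (g k0) M s.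
  by apply: eq_bispread => t; rewrite /g subnn expr0 invr1 mul1r.
have sm := bispread_smoothing (m + i) B0 Y0 gS g0 gX Eb M s (leqnn k0).
apply: (le_trans sm).
rewrite -/H -/q.
have qE : 2 * (4 * H + k0)%N%:Z <= 5 * q%:Z :> int by rewrite /q; lia.
have q0 : 0 < q%:Z :> int by rewrite /q; lia.
have MH : 3 ^+ M * H%:R <= (h (m + (i + M)))%:R :> R.
  by rewrite -natrX -natrM ler_nat addnA h_ge.
have w1 : wsum M k0 (close_to R q%:Z (4 * H + k0)%N%:Z s) 0 <=
    7 * (3 ^+ M * 3 ^+ (r ^ 2)%N * (5 / 9) ^+ k).
  set D0 := ((2 * s - (4 * H + k0)%N%:Z) %/ q%:Z)%Z.
  apply: le_trans (wsum_le _ _ _ (fun D => close_to_le s D q0 qE)) _.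
  rewrite wsum_sum.
  apply: (@le_trans _ _ (\sum_(i <- iota 0 7) 3 ^+ M * 3 ^+ (r ^ 2)%N * (5 / 9) ^+ k)).
    rewrite big_seq [leRHS]big_seq; apply: ler_sum => j; rewrite mem_iota => j7.
    apply: le_trans (wsum_pt (k := k) _ _ _) _.
      move=> k' k'k; apply: nS k'k.
      have := divz_eq (2 * s - (4 * H + k0)%N%:Z) q%:Z; rewrite -/D0.
      have := modz_ge0 (2 * s - (4 * H + k0)%N%:Z) (lt0r_neq0 q0).
      have := ltz_pmod (2 * s - (4 * H + k0)%N%:Z) q0.
      have : 0 <= q%:Z * j%:Z <= 6 * q%:Z by nia.
      have : (4 * H + k0)%N%:Z <= 3 * q%:Z :> int by rewrite /q; lia.
      rewrite mulrDr (mulrC q%:Z D0); move: (D0 * q%:Z) (q%:Z * j%:Z) => u w.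
      by move: (_ %% _)%Z => v; lia.
    have p59 : 0 <= (5 / 9 : R) by lra.
    rewrite (ler_wpM2r (exprn_ge0 _ p59))//.
    by rewrite ler_wpM2l ?exprn_ge0// -k0E exprS ler_peMl ?exprn_ge0// ler1n.
  by rewrite /= !big_cons big_nil; move: (_ * _ * _) => z; lra.
have w2 : bispread (m + i) (box R (- H%:Z - k0%:Z) (H%:Z + k0%:Z + k0%:Z)) M s <=
    6 * 3 ^+ M.
  apply: le_trans (bispread_box R (m + i) (- H%:Z - k0%:Z) 6 M s).
  apply: bispread_le => t; rewrite /box -/H.
  by case: ifP => [?|_]; [rewrite ifT//; lia|case: ifP].
have pA : 0 <= 7 * 3 ^+ (r ^ 2)%N * (5 / 9) ^+ k + 12 / r%:R :> R.
  by rewrite addr_ge0 ?mulr_ge0 ?exprn_ge0 ?invr_ge0//; lra.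
have := ler_wpM2l B0 w1; have := ler_wpM2l Y0 w2 => v2 v1.
have := ler_wpM2r (mulr_ge0 (sqr_ge0 (h m)%:R) pA) MH.
apply: le_trans; apply: le_trans (lerD v1 v2) _.
by rewrite /B le_eqVlt; apply/orP; left; apply/eqP; ring.
Qed.

(** First r is chosen to make 12 / r small, then k to compensate the
    constant 3 ^ (r ^ 2). *)
Lemma pulse_corr_small m (e : R) : 0 < e -> exists i k E : nat, forall M s,
  (forall D : int, `|(2 * h (m + i) + 1)%N%:Z * D - 2 * s| <= E%:Z ->
    forall k', (k' < k)%N -> ~ sparse M k' D) ->
  `|pulse_corr m (i + M) s| <= e * (h (m + (i + M)))%:R.
Proof.
move=> e0; have hm : 0 < (h m)%:R ^+ 2 :> R by rewrite exprn_gt0// ltr0n h_gt0.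
set d := e / (h m)%:R ^+ 2.
have d0 : 0 < d by rewrite divr_gt0.
pose r := (Num.bound (24 / d)).+1.
have rd : 12 / r%:R <= d / 2.
  have rR : 0 < r%:R :> R by rewrite ltr0n.
  rewrite ler_pdivrMr//; have : 24 / d < r%:R.
    by apply: lt_trans (archi_boundP _) _; rewrite ?ltr_nat// divr_ge0// ltW.
  by rewrite ltr_pdivrMr//; lra.
have p3 : 0 < 7 * 3 ^+ (r ^ 2)%N :> R by rewrite mulr_gt0 ?exprn_gt0.
have [k kd] : exists k : nat, (5 / 9) ^+ k <= d / 2 / (7 * 3 ^+ (r ^ 2)%N).
  by apply: exists_expr_le; [lra|lra|rewrite !divr_gt0].
exists (r ^ 2)%N, k, (20 * (2 * h (m + r ^ 2) + 1))%N => M s nS.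
have rh : (r ^ 2 <= h (m + r ^ 2))%N.
  by apply: leq_trans (ltnW (h_gt _)); exact: leq_addl.
apply: le_trans (pulse_corr_le (k := k) _ rh nS) _ => //.
have fin : 7 * 3 ^+ (r ^ 2)%N * (5 / 9) ^+ k + 12 / r%:R <= d.
  by move: kd; rewrite ler_pdivlMr//; lra.
rewrite [leRHS]mulrC ler_wpM2l//.
by rewrite -[e](divfK (lt0r_neq0 hm)) -/d mulrC ler_wpM2r// ltW.
Qed.

End correlation_small.

(** * Offsets between the blocks of two orbits *)

(** One block after the other, with at most one spacer between them. *)
Lemma occurs_multiple_le x n (C : nat) a a' : locally_chacon x ->
  occurs x n a -> occurs x n a' -> 0 <= a - a' <= (C * h n)%N%:Z ->
  exists j e : nat, [/\ (j <= C)%N, (e <= C)%N & a = a' + (j * h n + e)%N%:Z].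
Proof.
move=> xX oa; elim: C a' => [|C IHC] a' oa' aa'.
  by exists 0%N, 0%N; split => //; lia.
have [->|ne] := eqVneq a a'; first by exists 0%N, 0%N; split=> //; lia.
have sep : a' + (h n)%:Z <= a by apply: (occurs_sep xX oa' oa); lia.
have [ o|[ o _]] := occurs_next xX oa'.
  have [|j [e [jC eC ->]]] := IHC _ o; first by rewrite mulSn in aa'; lia.
  by exists j.+1, e; split => //; [lia|rewrite mulSn; lia].
have [e|ne'] := eqVneq a (a' + (h n)%:Z).
  by exists 1%N, 0%N; split => //; rewrite e mul1n; lia.
have [|j [e [jC eC ->]]] := IHC _ o; first by rewrite mulSn in aa'; lia.
by exists j.+1, e.+1; split => //; rewrite mulSn; lia.
Qed.

Lemma occurs_multiple x n (C : nat) a a' : locally_chacon x ->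
  occurs x n a -> occurs x n a' -> `|a - a'| <= (C * h n)%N%:Z ->
  exists b (j : nat) (e : int), [/\ (j <= C)%N, `|e| <= C%:Z
    & a = a' + term_sum (nseq j (b, n)) + e].
Proof.
have sumE b j : term_sum (nseq j (b, n)) = term_val (b, n) * j%:Z.
  elim: j => [|j IHj]; first by rewrite /term_sum big_nil mulr0.
  by rewrite /= term_sum_cons IHj; lia.
move=> xX oa oa' aa'; have [le|lt] := lerP a' a.
  have [|j [e [jC eC aE]]] := occurs_multiple_le (C := C) xX oa oa'; first lia.
  by exists true, j, e%:Z; rewrite sumE /term_val /=; split => //; lia.
have [|j [e [jC eC aE]]] := occurs_multiple_le (C := C) xX oa' oa; first lia.
by exists false, j, (- e%:Z); rewrite sumE /term_val /=; split => //; lia.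
Qed.

Lemma term_sum_opp ts : term_sum [seq (~~ t.1, t.2) | t <- ts] = - term_sum ts.
Proof.
elim: ts => [|[b l] ts IHts]; first by rewrite /term_sum !big_nil oppr0.
by rewrite /= !term_sum_cons IHts /term_val; case: b => /=; lia.
Qed.

(** Otherwise, for N as large as we please, an N-block of x and an N-block of y
    are at an offset that is nearly a sum of few heights. The N-block of x around
    the origin is at a sum of heights from the former, so that the windows of x
    are read off y at a sum of heights, and [orbit_of_near_orbit] puts x and y in
    one orbit. *)
Lemma offset_not_sparse x y m k E C : locally_chacon x -> locally_chacon y ->
  deep x -> deep y -> ~ (exists r, forall u, x u = y (u + r)) ->
  exists N0, forall N, (N0 <= N)%N -> forall a b : nat, (a <= C * h N)%N ->
    occurs x N a%:Z -> occurs y N b%:Z ->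
    forall D : int, `|(2 * h m + 1)%N%:Z * D - 2 * (a%:Z - b%:Z)| <= E%:Z ->
    forall k', (k' < k)%N -> ~ sparse (N - m) k' D.
Proof.
move=> xX yX xI yI; apply: contra_notP => /forallNP nfar.
apply: (@orbit_of_near_orbit x y (E + 2 * k + C.+1) (2 * k + C.+1) yX yI) => R.
have [n0 xR] := xI R.
have /existsNP[N /not_implyP[nN]] := nfar n0.
move=> /existsNP[a /existsNP[b /not_implyP[aC /not_implyP[ oa /not_implyP[ ob]]]]].
move=> /existsNP[D /not_implyP[DE /existsNP[k' /not_implyP[k'k /contrapT sp]]]].
have [a0 [ oa0 a0R Ra0]] := xR N nN.
have [ts tsk tsD] := sparse_term_sum m sp.
have [|c [j [e [jC eC aE]]]] := @occurs_multiple x N C.+1 a%:Z a0 xX oa oa0.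
  by rewrite mulSn; lia.
exists (b%:Z - a0 - term_sum (nseq j (c, N)) + term_sum ts),
  ([seq (~~ t.1, t.2) | t <- ts] ++ nseq j (c, N)); split.
- lia.
- by rewrite size_cat size_map size_nseq; lia.
- move=> u uR; rewrite term_sum_cat term_sum_opp.
  have [i iE] : exists i : nat, i%:Z = u - a0 by exists (absz (u - a0)%R); lia.
  have ih : (i < h N)%N by lia.
  transitivity (x (a0 + i%:Z)); first by congr x; lia.
  by rewrite (occursP _ _ _ oa0 _ ih) -(occursP _ _ _ ob _ ih); congr y; lia.
Qed.

(** By strong induction, removing the last element with the H - 1 places before it. *)
Lemma count_separated (P : pred nat) H lo n : (0 < H)%N ->
  (forall a b, P a -> P b -> (a < b)%N -> (a + H <= b)%N) ->
  (H * count P (iota lo n) <= n + H)%N.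
Proof.
move=> H0 sep; have [k] := ubnP n; elim: k n => // k IHk [|n] nk; first by rewrite muln0.
rewrite -addn1 iotaD count_cat /= addn0.
have [Pn|Pn] := boolP (P (lo + n)%N); last by rewrite addn0; have := IHk n; lia.
have cE : count P (iota lo n) = count P (iota lo (n.+1 - H)).
  have [Hn|Hn] := leqP H n.
    rewrite -[in LHS](subnKC (_ : (n.+1 - H <= n)%N)) ?iotaD ?count_cat; last lia.
    rewrite -[RHS]addn0; congr addn; apply/eqP; rewrite -leqn0 leqNgt -has_count.
    apply/hasPn => b; rewrite mem_iota => bn; apply/negP => Pb.
    by have := sep _ _ Pb Pn; lia.
  rewrite (_ : (n.+1 - H = 0)%N) //=; last lia.
  apply/eqP; rewrite -leqn0 leqNgt -has_count; apply/hasPn => b.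
  rewrite mem_iota => bn; apply/negP => Pb.
  by have := sep _ _ Pb Pn; lia.
rewrite cE mulnDr muln1.
have [Hn|Hn] := leqP H n; first by have := IHk (n.+1 - H)%N; lia.
by rewrite (_ : (n.+1 - H = 0)%N) /= ?muln0; lia.
Qed.

(** * Correlations over a long window *)

Section windows.
Variable R : realType.

Definition starts (x : int -> bool) N W : seq nat :=
  [seq a : nat <- iota 0 (W.+1 - h N) | occurs x N a%:Z].

Lemma mem_starts x N W a :
  (a \in starts x N W) = occurs x N a%:Z && (a + h N <= W)%N.
Proof. by rewrite mem_filter mem_iota; congr (_ && _); lia. Qed.

Lemma starts_uniq x N W : uniq (starts x N W).
Proof. by rewrite filter_uniq ?iota_uniq. Qed.

Lemma occurs_sep_nat x N : locally_chacon x -> forall a b : nat,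
  occurs x N a%:Z -> occurs x N b%:Z -> (a < b)%N -> (a + h N <= b)%N.
Proof. by move=> xX a b oa ob ab; have := occurs_sep xX oa ob; lia. Qed.

Lemma size_starts_le x N W : locally_chacon x -> (h N <= W)%N ->
  (h N * size (starts x N W) <= W.+1)%N.
Proof.
move=> xX hW; rewrite size_filter.
have := @count_separated (fun a : nat => occurs x N a%:Z) (h N) 0 (W.+1 - h N)
  (h_gt0 N) (occurs_sep_nat xX); lia.
Qed.

Definition superpose (f : int -> R) (s : seq nat) (t : int) : R :=
  \sum_(a <- s) f (t - a%:Z).

Lemma superposeP f x N W t : locally_chacon x -> supported (h N) f ->
  (superpose f (starts x N W) t = 0 /\
    forall a : nat, a \in starts x N W -> ~~ (0 <= t - a%:Z < (h N)%:Z)) \/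
  (exists a : nat, [/\ a \in starts x N W, 0 <= t - a%:Z < (h N)%:Z
    & superpose f (starts x N W) t = f (t - a%:Z)]).
Proof.
move=> xX fN; have [/hasP[a aS ta]|/hasPn na] :=
  boolP (has (fun a : nat => 0 <= t - a%:Z < (h N)%:Z) (starts x N W)).
  right; exists a; split=> //; rewrite /superpose (bigD1_seq a) ?starts_uniq//=.
  rewrite big_seq_cond big1 ?addr0// => b /andP[bS ba].
  rewrite (supportedP fN)//; move: aS bS; rewrite !mem_starts => /andP[ oa _] /andP[ ob _].
  have [lt|gt|e] := ltngtP a b; last by rewrite e eqxx in ba.
    by have := occurs_sep_nat xX oa ob lt; lia.
  by have := occurs_sep_nat xX ob oa gt; lia.
left; split=> //; rewrite /superpose big_seq big1// => a /na ta.
by rewrite (supportedP fN)//; lia.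
Qed.

Lemma sum_window f (phi : int -> R) H a W : supported H f -> (a + H <= W)%N ->
  \sum_(t < W) f (t%:Z - a%:Z) * phi t%:Z =
  \sum_(t < H) f t%:Z * phi (t%:Z + a%:Z).
Proof.
move=> fH aW; have [b bE] : exists b, W = (a + (H + b))%N by exists (W - a - H)%N; lia.
subst W; rewrite !big_split_ord /= big1 ?add0r => [|t _]; last first.
  by rewrite (supportedP fH) ?mul0r//; have := ltn_ord t; lia.
rewrite [X in _ + X]big1 ?addr0 => [|t _]; last first.
  by rewrite (supportedP fH) ?mul0r//; lia.
by apply: eq_bigr => t _; congr (f _ * phi _); lia.
Qed.

Lemma superpose_corr m M x y W : locally_chacon x ->
  \sum_(t < W) superpose (pulses R m M) (starts x (m + M) W) t%:Z *
     superpose (pulses R m M) (starts y (m + M) W) t%:Z =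
  \sum_(a <- starts x (m + M) W) \sum_(b <- starts y (m + M) W)
     pulse_corr R m M (a%:Z - b%:Z).
Proof.
move=> xX; under eq_bigr do rewrite {1}/superpose mulr_suml.
rewrite exchange_big big_seq [RHS]big_seq; apply: eq_bigr => a.
rewrite mem_starts => /andP[_ aW].
rewrite (sum_window (superpose (pulses R m M) (starts y (m + M) W))
  (@pulses_supported R m M) aW).
transitivity (\sum_(t < h (m + M)) \sum_(b <- starts y (m + M) W)
    pulses R m M t%:Z * pulses R m M (t%:Z + (a%:Z - b%:Z))).
  apply: eq_bigr => t _; rewrite /superpose mulr_sumr; apply: eq_bigr => b _.
  by rewrite addrA.
by rewrite exchange_big.
Qed.

(** An N-block of x overlaps at most three N-blocks of y. *)
Lemma superpose_corr_le m M x y W (e : R) : locally_chacon x -> locally_chacon y ->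
  0 <= e -> (h (m + M) <= W)%N ->
  (forall a b : nat, a \in starts x (m + M) W -> b \in starts y (m + M) W ->
    `|pulse_corr R m M (a%:Z - b%:Z)| <= e * (h (m + M))%:R) ->
  \sum_(t < W) superpose (pulses R m M) (starts x (m + M) W) t%:Z *
     superpose (pulses R m M) (starts y (m + M) W) t%:Z <= 3 * e * W.+1%:R.
Proof.
move=> xX yX e0 hW small; rewrite superpose_corr//.
set N := (m + M)%N in hW small *; set H := h N in hW small *.
have H0 : 0 < H%:R :> R by rewrite ltr0n h_gt0.
have row a : a \in starts x N W ->
    \sum_(b <- starts y N W) pulse_corr R m M (a%:Z - b%:Z) <= 3 * e * H%:R.
  move=> aS; pose P (b : nat) := [&& occurs y N b%:Z, (a < b + H)%N & (b < a + H)%N].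
  apply: (@le_trans _ _ (\sum_(b <- starts y N W) (if P b then e * H%:R else 0))).
    rewrite big_seq [leRHS]big_seq; apply: ler_sum => b bS.
    case: ifPn => Pb; first exact: le_trans (ler_norm _) (small _ _ aS bS).
    rewrite /pulse_corr /corr big1// => t _.
    rewrite [X in _ * X](supportedP (@pulses_supported R m M)) ?mulr0//.
    move: bS Pb; rewrite mem_starts /P -/N -/H => /andP[-> _] /=.
    have := ltn_ord t; rewrite -/N -/H; lia.
  rewrite -big_mkcond /= big_const_seq iter_addr addr0 -[leLHS]mulr_natl -[leRHS]mulrA.
  rewrite ler_wpM2r ?mulr_ge0// ?(ltW H0)// ler_nat.
  have cP : (count P (starts y N W) <= count P (iota (a.+1 - H) (2 * H)))%N.
    rewrite -!size_filter; apply: uniq_leq_size.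
      by rewrite filter_uniq ?starts_uniq.
    move=> b; rewrite !mem_filter => /andP[Pb _]; rewrite Pb /=.
    by move/and3P: Pb => [_ p1 p2]; rewrite mem_iota; lia.
  have := @count_separated P H (a.+1 - H) (2 * H) (h_gt0 N).
  have sepP b b' : P b -> P b' -> (b < b')%N -> (b + H <= b')%N.
    by move=> /and3P[ ob _ _] /and3P[ ob' _ _]; exact: (occurs_sep_nat yX).
  have := h_gt0 N; rewrite -/H; move=> H1 /(_ sepP); nia.
apply: (@le_trans _ _ (\sum_(a <- starts x N W) 3 * e * H%:R)).
  by rewrite big_seq [leRHS]big_seq; exact: ler_sum.
rewrite big_const_seq count_predT iter_addr addr0 -[leLHS]mulr_natr -[leLHS]mulrA.
rewrite ler_wpM2l ?mulr_ge0// -natrM ler_nat.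
exact: size_starts_le.
Qed.

End windows.

(** * Places outside the blocks of a window *)

Section misses.
Variable R : realType.

(** The indicator function of the m-blocks of an (m+M)-block. *)
Definition covered m M : int -> R := spread m (box R 0 ((h m)%:Z - 1)) M.

Lemma box_supported m : supported (h m) (box R 0 ((h m)%:Z - 1)).
Proof. by move=> t; rewrite /box; case: ifP; rewrite ?eqxx//; lia. Qed.

Lemma sum_spread m f M : supported (h m) f ->
  \sum_(t < h (m + M)) spread m f M t%:Z = 3 ^+ M * \sum_(t < h m) f t%:Z :> R.
Proof.
move=> fm; elim: M => [|M IHM] /=; first by rewrite addn0 mul1r.
have := sum_copies (fun=> 1) (spread_supported (M := M) fm).
rewrite (addnS m M) hS => sc.
transitivity (\sum_(t < 3 * h (m + M) + 1)
    copies (h (m + M)) (spread m f M) t%:Z * 1).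
  by apply: eq_bigr => t _; rewrite mulr1.
by rewrite sc -mulr_suml IHM exprS; ring.
Qed.

Lemma sum_covered m M :
  \sum_(t < h (m + M)) covered m M t%:Z = 3 ^+ M * (h m)%:R.
Proof.
rewrite /covered sum_spread; last exact: box_supported.
congr (_ * _); rewrite (eq_bigr (fun=> 1)) ?sumr_const ?card_ord// => t _.
by rewrite /box ifT//; have := ltn_ord t; lia.
Qed.

(** The indicator function of the places that are in no m-block of an
    (m+M)-block contained in the window. *)
Definition defect m M x W (t : int) : R :=
  1 - superpose (covered m M) (starts x (m + M) W) t.

Lemma sum_defect m M x W :
  \sum_(t < W) defect m M x W t%:Z =
  W%:R - (size (starts x (m + M) W))%:R * (3 ^+ M * (h m)%:R).
Proof.
rewrite /defect sumrB sumr_const card_ord; congr (_ - _).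
rewrite /superpose exchange_big big_seq.
rewrite (eq_bigr (fun=> 3 ^+ M * (h m)%:R)).
  by rewrite -big_seq big_const_seq count_predT iter_addr addr0 mulr_natl.
move=> a; rewrite mem_starts => /andP[_ aW].
have sw := @sum_window R _ (fun=> 1) _ a W (spread_supported (M := M) (@box_supported m)) aW.
rewrite -sum_covered; transitivity (\sum_(t < W) covered m M (t%:Z - a%:Z) * 1).
  by apply: eq_bigr => t _; rewrite mulr1.
by rewrite sw; apply: eq_bigr => t _; rewrite mulr1.
Qed.

Lemma defectP m M x W t : locally_chacon x ->
  (defect m M x W t = 1 /\ superpose (pulses R m M) (starts x (m + M) W) t = 0) \/
  (defect m M x W t = 0 /\ exists a : nat, exists p,
     [/\ a \in starts x (m + M) W, start m M p, 0 <= t - a%:Z - p < (h m)%:Z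
       & superpose (pulses R m M) (starts x (m + M) W) t = pulse R m (t - a%:Z - p)]).
Proof.
move=> xX; rewrite /defect.
have si := spread_supported (M := M) (@box_supported m).
have [[-> na]|[a [aS ta ->]]] := superposeP W t xX si.
  left; rewrite subr0; split => //.
  have [[->//]|[a [aS ta _]]] := superposeP W t xX (@pulses_supported R m M).
  by move/negP: (na a aS).
have -> : superpose (pulses R m M) (starts x (m + M) W) t = pulses R m M (t - a%:Z).
  have [[_ na]|[b [bS tb ->]]] := superposeP W t xX (@pulses_supported R m M).
    by move/negP: (na a aS).
  move: aS bS; rewrite !mem_starts => /andP[ oa _] /andP[ ob _].
  have [lt|gt|->//] := ltngtP a b.
    by have := occurs_sep_nat xX oa ob lt; lia.
  by have := occurs_sep_nat xX ob oa gt; lia.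
have [[-> np]|[p [sp tp ->]]] := spreadP M (t - a%:Z) (@box_supported m).
  left; rewrite subr0; split => //.
  have [[e _]|[p [sp tp _]]] := spreadP M (t - a%:Z) (@pulse_supported R m).
    exact: e.
  by move/negP: (np p sp).
right; split; first by rewrite /box ifT ?subrr//; lia.
have [[_ np]|[p' [sp' tp' pE]]] := spreadP M (t - a%:Z) (@pulse_supported R m).
  by move/negP: (np p sp).
by exists a, p'; split.
Qed.

Lemma superpose_miss m M x W t : locally_chacon x -> ~~ occurs x m t ->
  superpose (pulses R m M) (starts x (m + M) W) t = defect m M x W t - 1.
Proof.
move=> xX nt; have [[-> ->]|[-> [a [p [aS sp tp ->]]]]] := defectP m M W t xX.
  by rewrite subrr.
rewrite pulseE ifF ?ifT ?sub0r//.
  rewrite lt_neqAle andbC; move: tp => /andP[-> ->]; rewrite andbT eq_sym.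
  apply/eqP => tE; move/negP: nt; apply.
  move: aS; rewrite mem_starts => /andP[ oa _].
  by have := start_occurs oa sp; rewrite (_ : a%:Z + p = t)//; lia.
apply/eqP => tE; move/negP: nt; apply.
move: aS; rewrite mem_starts => /andP[ oa _].
by have := start_occurs oa sp; rewrite (_ : a%:Z + p = t)//; lia.
Qed.

Lemma superpose_norm_le m M x W t : locally_chacon x ->
  `|superpose (pulses R m M) (starts x (m + M) W) t| <= (h m)%:R.
Proof.
move=> xX; have [[_ ->]|[_ [a [p [_ _ _ ->]]]]] := defectP m M W t xX.
  by rewrite normr0.
exact: pulse_norm_le.
Qed.

Lemma defect_ge0 m M x W t : locally_chacon x -> 0 <= defect m M x W t.
Proof. by move=> xX; have [[-> _]|[-> _]] := defectP m M W t xX. Qed.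

Lemma size_starts_ge x N W : locally_chacon x ->
  (W <= size (starts x N W) * (h N).+1 + 2 * h N)%N.
Proof.
move=> xX; have [WH|HW] := leqP W (2 * h N); first exact: leq_trans WH (leq_addl _ _).
have hN := h_gt0 N.
have cov t : (h N <= t < W - h N)%N ->
    (1 <= \sum_(a <- starts x N W) (a <= t < a + (h N).+1))%N.
  move=> tW; have [a oa ta] := occurs_cover N xX t%:Z.
  have [b bE] : exists b : nat, a = b%:Z by exists `|a|%N; lia.
  subst a; have bS : b \in starts x N W by rewrite mem_starts oa; lia.
  by rewrite (bigD1_seq b) ?starts_uniq//= (_ : (b <= t < _)%N = true)//; lia.
have : (\sum_(h N <= t < W - h N) 1 <=
    \sum_(h N <= t < W - h N) \sum_(a <- starts x N W) (a <= t < a + (h N).+1))%N.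
  by rewrite big_nat [leqRHS]big_nat; apply: leq_sum.
rewrite sum_nat_const_nat muln1 exchange_big.
have : (\sum_(a <- starts x N W) \sum_(h N <= t < W - h N) (a <= t < a + (h N).+1) <=
    \sum_(a <- starts x N W) (h N).+1)%N.
  apply: leq_sum => a _; rewrite -big_mkcond /= sum1_count.
  rewrite -size_filter -[leqRHS](size_iota a); apply: uniq_leq_size.
    by rewrite filter_uniq ?iota_uniq.
  by move=> t; rewrite mem_filter !mem_iota => /andP[].
rewrite [X in (_ <= X)%N -> _]big_const_seq count_predT iter_addn addn0 mulnC.
move=> u1 u2; have := leq_trans u2 u1; lia.
Qed.

End misses.

(** * A second moment estimate *)

Section rare_misses.
Variable R : realType.

(** The three terms account for the two ends of the window, for the
    spacers between (m+M)-blocks and for the spacers inside them. *)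
Lemma sum_defect_le m M x (C : nat) : locally_chacon x -> (0 < C)%N ->
  \sum_(t < C * h (m + M)) defect R m M x (C * h (m + M)) t%:Z <=
  (C * h (m + M))%:R *
    (2 / C%:R + (h (m + M)).+1%:R^-1 + (2 * (h m)%:R)^-1).
Proof.
move=> xX C0; rewrite sum_defect.
set s := size _; set H := h (m + M).
have sW : (C * H <= s * H.+1 + 2 * H)%N := size_starts_ge _ (C * H) xX.
have HR : 0 < H%:R :> R by rewrite ltr0n h_gt0.
have hR : 0 < (h m)%:R :> R by rewrite ltr0n h_gt0.
have CR : 0 < C%:R :> R by rewrite ltr0n.
have H1 : 0 < H.+1%:R :> R by rewrite ltr0n.
set b : R := H.+1%:R^-1; set a : R := (2 * (h m)%:R)^-1.
have b01 : 0 <= b <= 1 by rewrite invr_ge0 ltW//= invf_le1// ler1n.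
have a0 : 0 <= a by rewrite invr_ge0 mulr_ge0// ltW.
(* The m-blocks fill an (m+M)-block but for a proportion below 1 / (2 h m). *)
have copies_ge : H%:R * (1 - a) <= 3 ^+ M * (h m)%:R.
  have HE : 2 * H%:R + 1 = (2 * (h m)%:R + 1) * 3 ^+ M :> R.
    have : (2 * H + 1)%:R = ((2 * h m + 1) * 3 ^ M)%:R :> R by rewrite h_addn.
    by rewrite natrM ![(_ + 1)%:R]natrD !natrM natrX.
  have ha : (h m)%:R * a = 1 / 2 by rewrite /a; field; rewrite lt0r_neq0.
  have p31 : 1 <= 3 ^+ M :> R by rewrite exprn_ege1// ler1n.
  move: HE p31; move: (3 ^+ M) => T HE T1.
  have H3 : H%:R = (h m)%:R * T + (T - 1) / 2 by lra.
  have a1 : T * (h m)%:R * a = T / 2 by rewrite -mulrA ha; lra.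
  have a2 : 0 <= a * (T - 1) by rewrite mulr_ge0 ?subr_ge0.
  by rewrite H3; lra.
have sR : C%:R * H%:R - 2 * H%:R <= s%:R * (H%:R + 1) :> R.
  have : (C * H)%:R <= (s * H.+1 + 2 * H)%:R :> R by rewrite ler_nat.
  by rewrite natrD !natrM -[H.+1%:R]natr1; lra.
have s0 : 0 <= s%:R :> R by rewrite ler0n.
have bH : b * (H%:R + 1) = 1 by rewrite natr1 mulVf// lt0r_neq0.
have sb : (C%:R * H%:R - 2 * H%:R) * (1 - b) <= s%:R * H%:R.
  have := ler_wpM2r (_ : 0 <= 1 - b) sR => /(_ _)/le_trans; apply; first lra.
  by rewrite -mulrA (_ : (H%:R + 1) * (1 - b) = H%:R)//; lra.
have final : C%:R * H%:R - s%:R * (3 ^+ M * (h m)%:R) <=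
    C%:R * H%:R * (2 / C%:R + b + a).
  have e1 : s%:R * H%:R * (1 - a) <= s%:R * (3 ^+ M * (h m)%:R).
    by rewrite -mulrA ler_wpM2l.
  have CC : C%:R * H%:R * (2 / C%:R) = 2 * H%:R :> R.
    by rewrite mulrC mulrA divfK ?lt0r_neq0.
  have CH0 : 0 <= C%:R * H%:R :> R by rewrite mulr_ge0// ltW.
  have [a1|a1] := lerP a 1.
    have e2 : (C%:R * H%:R - 2 * H%:R) * (1 - b) * (1 - a) <= s%:R * H%:R * (1 - a).
      by rewrite ler_wpM2r//; lra.
    have e3 : 0 <= C%:R * H%:R * (a * b) by rewrite !mulr_ge0//; lra.
    have e4 : 0 <= H%:R * (1 - (1 - b) * (1 - a)).
      have : (1 - b) * (1 - a) <= 1 * 1 by rewrite ler_pM//; lra.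
      by move=> ?; rewrite mulr_ge0 ?ler0n//; lra.
    by rewrite mulrDr mulrDr CC; lra.
  have e2 : 0 <= s%:R * (3 ^+ M * (h m)%:R) :> R by rewrite !mulr_ge0 ?exprn_ge0 ?ler0n.
  have e3 : C%:R * H%:R * 1 <= C%:R * H%:R * a by rewrite ler_wpM2l// ltW.
  have e4 : 0 <= C%:R * H%:R * b by rewrite mulr_ge0//; lra.
  by rewrite mulrDr mulrDr CC; lra.
by rewrite natrM.
Qed.

Definition missed (K m : nat) (x : nat -> int -> bool) (t : int) : bool :=
  [forall i : 'I_K, ~~ occurs (x i) m t].

(** At a missed time all K functions have the value -1, apart from the
    defects, so that v is close to - K; the square enters by 2 |v| <= c + v^2 / c. *)
Lemma missed_le K m M (x : nat -> int -> bool) W (t : int) (d : R) :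
  (forall i, locally_chacon (x i)) -> (0 < K)%N -> 0 < d ->
  let v := \sum_(i < K) superpose (pulses R m M) (starts (x i) (m + M) W) t in
  K%:R * (missed K m x t)%:R <=
    d * K%:R / 2 + v ^+ 2 / (2 * (d * K%:R)) + \sum_(i < K) defect R m M (x i) W t.
Proof.
move=> xX K0 d0 /=; set v := \sum_(i < K) superpose _ _ _; have KR : 0 < K%:R :> R by rewrite ltr0n.
have dK : 0 < d * K%:R by rewrite mulr_gt0.
set c := d * K%:R in dK *.
(* From c^-1 (c - |v|)^2 >= 0. *)
have amgm : `|v| <= c / 2 + v ^+ 2 / (2 * c).
  have vv : `|v| ^+ 2 = v ^+ 2 by rewrite real_normK ?num_real.
  have : 0 <= c^-1 * (c - `|v|) ^+ 2 by rewrite mulr_ge0 ?sqr_ge0// invr_ge0 ltW.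
  have -> : c^-1 * (c - `|v|) ^+ 2 = c - 2 * `|v| + 2 * (`|v| ^+ 2 / (2 * c)).
    by field; rewrite lt0r_neq0.
  by rewrite vv; lra.
have D0 : 0 <= \sum_(i < K) defect R m M (x i) W t.
  by apply: sumr_ge0 => i _; exact: defect_ge0.
rewrite /missed; case: (boolP [forall _, _]) => [/forallP miss|_]; last first.
  by rewrite mulr0; have := normr_ge0 v; lra.
rewrite mulr1; have vE : v = \sum_(i < K) defect R m M (x i) W t - K%:R.
  rewrite /v (eq_bigr (fun i : 'I_K => defect R m M (x i) W t - 1)).
    by rewrite sumrB sumr_const card_ord.
  by move=> i _; exact: superpose_miss.
have := ler_norm (- v); rewrite normrN; lra.
Qed.

(** The second moment of the sum of the functions [superpose] of K points: the
    off-diagonal terms are small by [pulse_corr_small], which applies to points in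
    distinct orbits by [offset_not_sparse], so that the diagonal, of order K, is small
    compared with K^2. *)
Lemma rare_misses (e : R) m (x : nat -> int -> bool) : 0 < e -> 4 <= e * (h m)%:R ->
  (forall i, locally_chacon (x i)) -> (forall i, deep (x i)) ->
  (forall i j, i != j -> ~ exists r, forall u, x i u = x j (u + r)) ->
  exists K W, (0 < W)%N /\ (\sum_(t < W) missed K m x t%:Z)%:R <= e * W%:R :> R.
Proof.
move=> e0 em xX xI xO.
have hm0 : 0 < (h m)%:R :> R by rewrite ltr0n h_gt0.
set h2 : R := (h m)%:R ^+ 2.
have h20 : 0 <= h2 by rewrite sqr_ge0.
(* Divided by W K^2, the diagonal of the second moment is h2 / K, the rest at most 6 e'. *)
pose K := (Num.bound (8 * h2 / e ^+ 2)).+1.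
have KR : 0 < K%:R :> R by rewrite ltr0n.
have ee : 0 < e ^+ 2 by rewrite exprn_gt0.
have Kb : 8 * h2 <= K%:R * e ^+ 2.
  have : 8 * h2 / e ^+ 2 < K%:R.
    by apply: lt_trans (archi_boundP _) _; rewrite ?ltr_nat// !mulr_ge0// invr_ge0 ltW.
  by rewrite ltr_pdivrMr// => /ltW.
pose C := (Num.bound (16 / e)).+1.
have CR : 0 < C%:R :> R by rewrite ltr0n.
have Cb : 2 / C%:R <= e / 8.
  have : 16 / e < C%:R.
    by apply: lt_trans (archi_boundP _) _; rewrite ?ltr_nat// divr_ge0// ltW.
  by rewrite ltr_pdivrMr// ler_pdivrMr//; lra.
set e' := e ^+ 2 / 48; have e'0 : 0 < e' by rewrite divr_gt0.
have [i0 [k [E small]]] := pulse_corr_small m e'0.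
(* The exceptional offsets are avoided for all pairs at once by taking M large. *)
have /choice[N0 N0P] : forall ij : 'I_K * 'I_K, exists N0, ij.1 != ij.2 ->
    forall N, (N0 <= N)%N -> forall a b : nat, (a <= C * h N)%N ->
    occurs (x ij.1) N a%:Z -> occurs (x ij.2) N b%:Z ->
    forall D : int, `|(2 * h (m + i0) + 1)%N%:Z * D - 2 * (a%:Z - b%:Z)| <= E%:Z ->
    forall k', (k' < k)%N -> ~ sparse (N - (m + i0)) k' D.
  move=> [i j]; have [->|ij] := eqVneq i j; first by exists 0%N.
  have [N0 N0P] := offset_not_sparse (m + i0) k E C (xX i) (xX j) (xI i) (xI j)
    (xO i j ij).
  by exists N0 => _.
have [B Bb] : exists B : nat, 8 / e < B%:R.
  by exists (Num.bound (8 / e)); rewrite archi_boundP// divr_ge0// ltW.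
have [M0 M0P] : exists M0, forall ij, (N0 ij <= M0)%N.
  by exists (\max_ij N0 ij)%N => ij; exact: leq_bigmax.
have [M ME] : exists M, M = (M0 + B)%N by eexists.
have [N NE] : exists N, N = (m + (i0 + M))%N by eexists.
have NN0 ij : (N0 ij <= N)%N.
  by apply: leq_trans (M0P ij) _; clear -NE ME; lia.
have BN : (B < (h N).+1)%N.
  by rewrite ltnS; apply: leq_trans (ltnW (h_gt N)); clear -NE ME; lia.
have Hb : (h N).+1%:R^-1 <= e / 8 :> R.
  rewrite -[e / 8]invrK lef_pV2 ?posrE ?invr_gt0 ?divr_gt0 ?ltr0n// invf_div.
  by apply/ltW/(lt_trans Bb); rewrite ltr_nat.
exists K, (C * h N)%N; split; first by rewrite muln_gt0 h_gt0.
set W := (C * h N)%N.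
have WR : 1 <= W%:R :> R by rewrite ler1n muln_gt0 h_gt0.
set f := fun i : 'I_K => superpose (pulses R m (i0 + M)) (starts (x i) N W).
have HW : (h N <= W)%N by rewrite leq_pmull.
have pair i j : \sum_(t < W) f i t%:Z * f j t%:Z <=
    (if i == j then W%:R * h2 else 6 * e' * W%:R).
  case: eqVneq => [->|ij].
    apply: (@le_trans _ _ (\sum_(t < W) h2)).
      apply: ler_sum => t _; rewrite -expr2 -[X in X ^+ 2]/(f j t%:Z).
      rewrite -(real_normK (num_real (f j t%:Z))) ler_pXn2r ?nnegrE//.
      by rewrite /f NE; exact: superpose_norm_le.
    by rewrite sumr_const card_ord mulr_natl.
  apply: (@le_trans _ _ (3 * e' * W.+1%:R)); last first.
    rewrite -[W.+1%:R]natr1 (_ : 6 * e' * W%:R = 3 * e' * (W%:R + W%:R)); last lra.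
    by rewrite ler_wpM2l ?mulr_ge0 ?(ltW e'0)//; lra.
  rewrite /f NE; apply: superpose_corr_le => //; first exact: ltW.
    by rewrite -NE.
  move=> a b; rewrite -NE !mem_starts => /andP[ oa aW] /andP[ ob _].
  rewrite NE; apply: small => D DE k' k'k.
  have := N0P (i, j) ij N (NN0 _) a b _ oa ob D DE k' k'k.
  rewrite (_ : (N - (m + i0) = M)%N); last by rewrite NE addnA addKn.
  by apply; apply: leq_trans aW; exact: leq_addr.
set d := e / 2; have d0 : 0 < d by rewrite divr_gt0.
have defs i : \sum_(t < W) defect R m (i0 + M) (x i) W t%:Z <= W%:R * (3 * e / 8).
  have hb : (2 * (h m)%:R)^-1 <= e / 8.
    rewrite -[e / 8]invrK lef_pV2 ?posrE ?invr_gt0 ?divr_gt0 ?mulr_gt0// invf_div.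
    by rewrite ler_pdivrMr//; lra.
  have tot : 2 / C%:R + (h N).+1%:R^-1 + (2 * (h m)%:R)^-1 <= 3 * e / 8.
    move: Cb Hb hb; move: (2 / C%:R) ((h N).+1%:R^-1) ((2 * (h m)%:R)^-1).
    by move=> u v w; lra.
  have sd := sum_defect_le m (i0 + M) (xX i) (ltn0Sn (Num.bound (16 / e))).
  rewrite -NE -/C -/W in sd; apply: (le_trans sd).
  by apply: ler_wpM2l.
have sq : \sum_(t < W) (\sum_(i < K) f i t%:Z) ^+ 2 <=
    K%:R * (W%:R * h2) + K%:R ^+ 2 * (6 * e' * W%:R).
  have -> : \sum_(t < W) (\sum_(i < K) f i t%:Z) ^+ 2 =
      \sum_(i < K) \sum_(j < K) \sum_(t < W) f i t%:Z * f j t%:Z.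
    under [RHS]eq_bigr do rewrite exchange_big.
    rewrite [RHS]exchange_big; apply: eq_bigr => t _.
    by rewrite expr2 mulr_suml; apply: eq_bigr => i _; rewrite mulr_sumr.
  apply: (@le_trans _ _ (\sum_(i < K) (W%:R * h2 + K%:R * (6 * e' * W%:R)))); last first.
    by rewrite sumr_const card_ord -[leLHS]mulr_natl mulrDr [K%:R * (K%:R * _)]mulrA -expr2.
  apply: ler_sum => i _; rewrite (bigD1 i)//=.
  apply: lerD; first by have := pair i i; rewrite eqxx.
  apply: (@le_trans _ _ (\sum_(j < K | j != i) 6 * e' * W%:R)).
    by apply: ler_sum => j ji; have := pair i j; rewrite eq_sym (negbTE ji).
  rewrite sumr_const -[leLHS]mulr_natl; apply: ler_wpM2r.
    by apply: mulr_ge0 => //; apply: mulr_ge0 => //; exact: ltW.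
  by rewrite ler_nat -[leqRHS]card_ord max_card.
have key : K%:R * (\sum_(t < W) missed K m x t%:Z)%:R <=
    \sum_(t < W) (d * K%:R / 2 + (\sum_(i < K) f i t%:Z) ^+ 2 / (2 * (d * K%:R)) +
      \sum_(i < K) defect R m (i0 + M) (x i) W t%:Z).
  rewrite natr_sum mulr_sumr; apply: ler_sum => t _.
  by have := @missed_le K m (i0 + M) x W t%:Z d xX (ltn0Sn _) d0; rewrite /f NE.
have defsum : \sum_(t < W) \sum_(i < K) defect R m (i0 + M) (x i) W t%:Z <=
    K%:R * (W%:R * (3 * e / 8)).
  rewrite exchange_big /=; apply: (@le_trans _ _ (\sum_(i < K) W%:R * (3 * e / 8))).
    by apply: ler_sum => i _; exact: defs.
  by rewrite sumr_const card_ord -[leLHS]mulr_natl.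
rewrite -(ler_pM2l KR); apply: (le_trans key).
rewrite !big_split /= sumr_const card_ord -[_ *+ W]mulr_natl.
have dK0 : 0 < 2 * (d * K%:R) by apply: mulr_gt0 => //; apply: mulr_gt0.
have sq' : (\sum_(t < W) (\sum_(i < K) f i t%:Z) ^+ 2) / (2 * (d * K%:R)) <=
    K%:R * W%:R * (e / 4).
  rewrite ler_pdivrMr//; apply: (le_trans sq).
  have fin (k' w z : R) : w * k' * (8 * z) <= w * k' * (k' * e ^+ 2) ->
      k' * (w * z) + k' ^+ 2 * (6 * (e ^+ 2 / 48) * w) <=
      k' * w * (e / 4) * (2 * (e / 2 * k')) by lra.
  apply: fin; apply: ler_wpM2l => //; exact: mulr_ge0.
have fin (k' w S : R) : 0 <= k' * w * e -> S <= k' * w * (e / 4) ->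
    w * (e / 2 * k' / 2) + S + k' * (w * (3 * e / 8)) <= k' * (e * w) by lra.
have KWe : 0 <= K%:R * W%:R * e by apply: mulr_ge0; [exact: mulr_ge0|exact: ltW].
apply: le_trans (fin _ _ _ KWe sq'); apply: lerD => //.
by rewrite -mulr_suml.
Qed.

End rare_misses.

(** * The Chacon subshift *)

Lemma chacon_blockE n : chacon_block n = block n.+1.
Proof. by elim: n => [//|n IHn]; rewrite [LHS]/= IHn. Qed.

Lemma block_prefix m n : (m <= n)%N -> prefix (block m) (block n).
Proof.
move/subnK <-; elim: (n - m)%N => [|d IHd]; first exact: prefix_refl.
exact: (prefix_trans IHd (prefix_prefix _ _)).
Qed.

Lemma chacon_window (x : full_shift) (V k0 : nat) : chacon_set x ->
  exists k u v, [/\ (k0 <= k)%N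
    & block k = u ++ subword x (- V%:Z) (2 * V).+1 ++ v].
Proof.
move=> /(_ (- V%:Z) (2 * V).+1)[n]; rewrite chacon_blockE => inf.
exists (maxn n.+1 k0).
have /infixP[u [v uv]] := infix_trans inf
  (prefixW (block_prefix (leq_maxl n.+1 k0))).
by exists u, v; split; [exact: leq_maxr|].
Qed.

Lemma size_subword x i k : size (subword x i k) = k.
Proof. by rewrite size_map size_iota. Qed.

Lemma nth_subword x i k b j : (j < k)%N ->
  nth b (subword x i k) j = x (i + j%:Z).
Proof.
by move=> jk; rewrite (nth_map 0%N) ?size_iota// nth_iota// add0n.
Qed.

Lemma chacon_locally (x : full_shift) : chacon_set x -> locally_chacon x.
Proof.
move=> xX V k0; have [k [u [v [k0k kE]]]] := chacon_window V k0 xX.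
pose a : int := - V%:Z - (size u)%:Z.
exists (fun i => nth true (block k) (absz (i - a)%R)), k, a; split => //.
- by apply/occursP => i ih; congr nth; lia.
- by rewrite /a; lia.
- by rewrite /h kE !size_cat size_subword /a; lia.
- move=> i iV; have [j jE] : exists j : nat, j%:Z = i + V%:Z by exists (absz (i + V%:Z)%R); lia.
  have -> : absz (i - a)%R = (size u + j)%N by rewrite /a; lia.
  rewrite kE nth_cat ifF; last lia.
  rewrite addKn nth_cat size_subword ifT; last lia.
  by rewrite nth_subword; [congr x|]; lia.
Qed.

(** Every word of the system is a word of some block, hence of all blocks of
    higher level. *)
Lemma chacon_occurs (x : full_shift) (R : nat) : chacon_set x ->
  forall m0, exists m (p : nat), (m0 <= m)%N /\ forall (y : int -> bool) t,
    occurs y m t -> forall i : int, (`|i| <= R)%N -> y (t + (p + R)%N%:Z + i) = x i.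
Proof.
move=> xX m0; have [k [u [v [k0k kE]]]] := chacon_window R m0 xX.
exists k, (size u); split => // y t oy i iR.
have [j jE] : exists j : nat, j%:Z = i + R%:Z by exists (absz (i + R%:Z)%R); lia.
have -> : t + (size u + R)%N%:Z + i = t + (size u + j)%N%:Z by lia.
rewrite (occursP _ _ _ oy); last by rewrite /h kE !size_cat size_subword; lia.
rewrite kE nth_cat ifF; last lia.
rewrite addKn nth_cat size_subword ifT; last lia.
by rewrite nth_subword; [congr x|]; lia.
Qed.

(** For 0 < n <= h l, the letter n places before the end of an l-block is the
    same in all l-blocks, but n places later comes a letter 0 if another block
    follows, and 1 if a spacer does. *)
Lemma aperiodic (x : int -> bool) (n : int) : locally_chacon x ->
  (forall u, x (u + n) = x u) -> n = 0.
Proof.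
move=> xX xn; apply/eqP/negPn/negP => n0.
wlog npos : n xn n0 / 0 < n.
  move=> W; have [n1|n1|n1] := ltgtP n 0.
  - by apply: (W (- n)); rewrite ?oppr_eq0 ?oppr_gt0// => u; rewrite -xn subrK.
  - exact: (W n).
  - by rewrite n1 in n0.
have [l [i [hE il]]] : exists l i : nat, h l = (i + absz n)%N /\ (i < h l)%N.
  by exists (absz n), (h (absz n) - absz n)%N; have := h_gt (absz n); lia.
have [a oa _] := occurs_cover l.+1 xX 0.
move: oa; rewrite occursS => /and4P[ o1 o2 x2 _].
have := occurs_first o2; rewrite -(_ : a + i%:Z + n = a + (h l)%:Z); last lia.
rewrite xn (occursP _ _ _ o1)// -(occursP _ _ _ o2)// -xn.
by rewrite (_ : _ + n = a + (2 * h l)%:Z) ?x2//; lia.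
Qed.

(** * Orbits in an uncountable set *)

Definition same_orbit (x y : int -> bool) := exists r, forall u, x u = y (u + r).

Lemma same_orbit_sym x y : same_orbit x y -> same_orbit y x.
Proof. by move=> [r xy]; exists (- r) => u; rewrite xy subrK. Qed.

(** The points are chosen one by one; at each step only countably many points
    are forbidden, namely those of finitely many orbits and those that are not
    deep. *)
Lemma uncountable_orbits (S : set (int -> bool)) :
  (forall x, S x -> locally_chacon x) -> ~ countable S ->
  exists x : nat -> int -> bool, [/\ forall i, S (x i),
    forall i, deep (x i) & forall i j, i != j -> ~ same_orbit (x i) (x j)].
Proof.
move=> SX uncS.
pose d : int -> bool := fun=> true.
have /choice[f fP] : forall s : seq (int -> bool), exists y, [/\ S y, deep y
    & forall i, (i < size s)%N -> ~ same_orbit y (nth d s i)].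
  move=> s; apply: contrapT => no; apply: uncS.
  have sub : S `<=` [set x | locally_chacon x /\ ~ deep x] `|`
      \bigcup_(i in [set: nat]) [set x | same_orbit x (nth d s i)].
    move=> y Sy; have [iy|niy] := pselect (deep y).
      right; apply: contrapT => nos; apply: no; exists y; split => // i _ yi.
      by apply: nos; exists i.
    by left; split => //; exact: SX.
  apply: sub_countable (subset_card_le sub) _.
  rewrite -bigcup2E; apply: bigcup_countable => // -[|[|i]] _ /=.
  - exact: countable_not_deep.
  - by apply: bigcup_countable => // i _; exact: countable_orbit.
  - exact: countable0.
pose pts := fix pts n := if n is m.+1 then rcons (pts m) (f (pts m)) else [::].
have size_pts n : size (pts n) = n by elim: n => //= n IHn; rewrite size_rcons IHn.
have nth_pts i n : (i < n)%N -> nth d (pts n) i = f (pts i).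
  elim: n => // n IHn; rewrite ltnS leq_eqVlt => /predU1P[->|lt] /=.
    by rewrite nth_rcons size_pts ltnn eqxx.
  by rewrite nth_rcons size_pts lt IHn.
have lt_orb i j : (i < j)%N -> ~ same_orbit (f (pts j)) (f (pts i)).
  by move=> ij; rewrite -(nth_pts _ _ ij); case: (fP (pts j)) => _ _; apply; rewrite size_pts.
exists (fun i => f (pts i)); split.
- by move=> i; case: (fP (pts i)).
- by move=> i; case: (fP (pts i)).
- move=> i j; case: ltngtP => // ij _; last exact: lt_orb.
  by move=> /same_orbit_sym; exact: lt_orb.
Qed.

(** * The hyperspace of the Chacon subshift *)

Section hyperspace_topology.
Variable R : realType.
Local Notation X := (chacon_system R).
Local Notation K := (borel_hyperspace X).
Implicit Types (A B : K) (x y : chacon_space).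

Definition pt_seq x : full_shift := \val x.

Lemma pt_seqP x : chacon_set (pt_seq x). Proof. exact: set_valP. Qed.

Lemma pt_seq_inj : injective pt_seq. Proof. exact: val_inj. Qed.

Definition agree n x y := agree_upto n (pt_seq x, pt_seq y).

Lemma agree_sym n x y : agree n x y -> agree n y x.
Proof. by move=> xy i /xy. Qed.

Lemma agree_trans n y x z : agree n x y -> agree n y z -> agree n x z.
Proof. by move=> xy yz i iln; rewrite [LHS](xy i iln); exact: yz. Qed.

Lemma agree_refl n x : agree n x x. Proof. by []. Qed.

Lemma mdist_agree n (x y : X) : mdist x y < 2 ^- n <-> agree n x y.
Proof. exact: shift_dist_lt. Qed.

(** Closeness in the Hausdorff distance, in terms of words only. *)
Definition same_words n A B :=
  (forall a, hset A a -> exists2 b, hset B b & agree n a b) /\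
  (forall b, hset B b -> exists2 a, hset A a & agree n a b).

Lemma pow2_gt0 n : 0 < 2 ^- n :> R. Proof. by rewrite invr_gt0 exprn_gt0. Qed.

Lemma pow2_lt (e : R) : 0 < e -> exists n, 2 ^- n < e.
Proof.
move=> e0; have [n _ ne] := near_infty_natSinv_lt (PosNum e0).
exists n; apply: le_lt_trans (ne n (leqnn n)).
by rewrite lef_pV2 ?posrE ?exprn_gt0// -natrX ler_nat ltn_expl.
Qed.

Lemma same_words_dist n (A B : hyperspace X) : mdist A B < 2 ^- n -> same_words n A B.
Proof.
rewrite /mdist /= /hausdorff_dist gt_max => /andP[AB BA]; split=> [a Aa|b Bb].
  have [|b Bb] := @point_dist_lt R X a B (2 ^- n).
    exact: le_lt_trans (point_dist_le_excess B Aa) AB.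
  by move=> /mdist_agree ab; exists b.
have [|a Aa] := @point_dist_lt R X b A (2 ^- n).
  exact: le_lt_trans (point_dist_le_excess A Bb) BA.
by move=> /mdist_agree ba; exists a => //; exact: agree_sym.
Qed.

Lemma dist_same_words n (A B : hyperspace X) : same_words n A B -> mdist A B <= 2 ^- n.
Proof.
have half C D : (forall a, hset C a -> exists2 b, hset D b & agree n a b) ->
    @excess R X C D <= 2 ^- n.
  move=> CD; apply: ge_sup.
    by have [c Cc] := hset_neq0 C; exists (point_dist c D), c.
  move=> _ [c Cc <-]; have [d Dd /mdist_agree cd] := CD c Cc.
  exact: le_trans (point_dist_le c Dd) (ltW cd).
move=> [AB BA]; rewrite /mdist /= /hausdorff_dist ge_max !half//.
by move=> b /BA[a Aa ab]; exists a => //; exact: agree_sym.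
Qed.

Lemma open_words (O : set (hyperspace X)) :
  open O <-> forall A, O A -> exists n, forall B, same_words n A B -> O B.
Proof.
split=> [Oop A OA|O_words].
  have /metricType_numDomainType.nbhs_mdistP[e /= e0 eO] : nbhs A O.
    exact: open_nbhs_nbhs.
  have [n ne] := pow2_lt e0; exists n => B /dist_same_words AB.
  by apply: eO => /=; exact: le_lt_trans AB ne.
rewrite openE => A /O_words[n nO]; apply/metricType_numDomainType.nbhs_mdistP.
exists (2 ^- n); first exact: pow2_gt0.
by move=> B /= /same_words_dist; exact: nO.
Qed.

Definition hits (U : set chacon_space) : set K := [set A | hset A `&` U !=set0].

Definition cyl n x : set chacon_space := [set y | agree n x y].

Definition word n x : seq bool := subword (pt_seq x) (- n%:Z) (2 * n).+1.

Lemma word_agree n x y : word n x = word n y <-> agree n x y.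
Proof.
split=> [xy i iln|xy].
  have := congr1 (fun s => nth true s (absz (i + n%:Z)%R)) xy.
  rewrite !nth_subword; [|lia|lia].
  by rewrite (_ : - n%:Z + _ = i)//; lia.
by apply/eq_in_map => j; rewrite mem_iota => jn; apply: xy => /=; lia.
Qed.

Definition word_set n s : set chacon_space := [set y | word n y = s].

Lemma open_measurable_K (O : set (hyperspace X)) : open O -> measurable (O : set K).
Proof. exact: sub_sigma_algebra. Qed.

Lemma hits_cyl_measurable n x : measurable (hits (cyl n x)).
Proof.
apply: open_measurable_K; apply/open_words => A [a [Aa xa]].
exists n => B [AB _]; have [b Bb ab] := AB a Aa.
by exists b; split => //; exact: agree_trans xa ab.
Qed.

Lemma induced_mapE A : hset (induced_map A) = chacon_shift_by 1 @` hset A.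
Proof. by []. Qed.

Lemma agree_shift n (k : int) x y : agree (n + absz k) x y ->
  agree n (chacon_shift_by k x) (chacon_shift_by k y).
Proof. by move=> xy i /= iln; apply: xy; lia. Qed.

Lemma induced_map_measurable :
  measurable_fun [set: K] (@induced_map R X).
Proof.
apply: (@measurability _ _ K K setT _ (@open (hyperspace X) : set (set K))) => // _ [ O Oo <-]; rewrite setTI.
apply: open_measurable_K; apply/open_words => A OA.
have [n nO] := (open_words O).1 Oo _ OA.
exists (n + 1)%N => B [AB BA]; apply: nO; split.
  move=> _ [a Aa <-]; have [b Bb ab] := AB a Aa.
  by exists (chacon_shift_by 1 b); [exists b|exact: (@agree_shift n 1)].
move=> _ [b Bb <-]; have [a Aa ab] := BA b Bb.
by exists (chacon_shift_by 1 a); [exists a|exact: (@agree_shift n 1)].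
Qed.

Lemma hset_closed A x : (forall n, hits (cyl n x) A) -> hset A x.
Proof.
move=> nA; apply: (compact_closed _ (@hset_compact _ _ A)).
  exact: metric_hausdorff.
move=> U /metricType_numDomainType.nbhs_mdistP[e /= e0 eU].
have [n ne] := pow2_lt e0; have [a [Aa xa]] := nA n.
exists a; split => //; apply: eU => /=.
by apply: lt_trans ne; exact/mdist_agree.
Qed.

End hyperspace_topology.

(** * A covering lemma *)

Section covering.
Context d (T : measurableType d) (R : realType).
Variables (P : probability T R) (f : T -> T).
Hypothesis mf : measurable_fun [set: T] f.
Hypothesis invf : forall E, measurable E -> P (f @^-1` E) = P E.

Lemma iter_measurable t : measurable_fun [set: T] (iter t f).
Proof.
elim: t => [|t IHt]; first exact: measurable_id.
exact: (measurableT_comp mf IHt).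
Qed.

Definition visit (E : set T) t : set T := iter t f @^-1` E.

Lemma visit_measurable E t : measurable E -> measurable (visit E t).
Proof. by move=> mE; rewrite -[visit _ _]setTI; exact: iter_measurable. Qed.

Lemma visit_measure E t : measurable E -> P (visit E t) = P E.
Proof.
move=> mE; elim: t => [//|t IHt]; rewrite -IHt -(invf (visit_measurable t mE)).
by congr (P _); apply/funext => x; rewrite /visit /preimage /= -iterSr.
Qed.

(** Windows of length at most L, and single steps paid for by q, are laid one
    after the other; the last window may stick out, which costs at most L. *)
Lemma tiling (c q : nat -> R) (e : R) (L : nat) : 0 <= e ->
  (forall t, 0 <= c t <= 1) -> (forall t, 0 <= q t) ->
  (forall t, 1 <= q t \/ exists W, (0 < W <= L)%N /\
     \sum_(t <= s < t + W) c s <= e * W%:R) ->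
  forall H, \sum_(0 <= t < H) c t <= e * H%:R + L%:R + \sum_(0 <= t < H) q t.
Proof.
move=> e0 c01 q0 cq H.
suff : forall n t, (n + t = H)%N ->
    \sum_(t <= s < H) c s <= e * n%:R + L%:R + \sum_(t <= s < H) q s.
  by apply; rewrite addn0.
move=> n; have [k] := ubnP n; elim: k n => // k IHk n nk t ntH.
have sq a b : 0 <= \sum_(a <= s < b) q s by apply: sumr_ge0.
have en (m : nat) : 0 <= e * m%:R by rewrite mulr_ge0.
have [nL|Ln] := leqP n L.
  apply: (@le_trans _ _ (\sum_(t <= s < H) 1)); first by apply: ler_sum => s _; have := c01 s; lra.
  rewrite big_const_nat iter_addr addr0.
  have : (1 *+ (H - t) : R) <= L%:R by rewrite ler_nat; lia.
  by have := sq t H; have := en n; lra.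
have [q1|[W [W0L cW]]] := cq t.
  have tH : (t < H)%N by lia.
  have nk' : (n.-1 < k)%N by lia.
  have ntH' : (n.-1 + t.+1 = H)%N by lia.
  have IH := IHk n.-1 nk' t.+1 ntH'.
  have nle : e * n.-1%:R <= e * n%:R by rewrite ler_wpM2l// ler_nat leq_pred.
  by rewrite (big_ltn tH) [in leRHS](big_ltn tH); have := c01 t; lra.
have tW : (t <= t + W)%N by lia.
have WH : (t + W <= H)%N by lia.
have nk' : (n - W < k)%N by lia.
have ntH' : (n - W + (t + W) = H)%N by lia.
have IH := IHk (n - W)%N nk' (t + W)%N ntH'.
rewrite (big_cat_nat tW WH) [in leRHS](big_cat_nat tW WH) /=.
have -> : n%:R = (n - W)%:R + W%:R :> R by rewrite -natrD subnK//; lia.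
by have := sq t (t + W)%N; lra.
Qed.

Lemma integral_visits E H : measurable E ->
  (\int[P]_x (\sum_(0 <= t < H) (\1_(visit E t) x)%:E) = (H%:R * fine (P E))%:E)%E.
Proof.
move=> mE; rewrite ge0_integral_sum//; last first.
  by move=> t; apply/measurable_EFinP/measurable_indic/visit_measurable.
rewrite (eq_bigr (fun=> (fine (P E))%:E)).
  by rewrite sumEFin sumr_const_nat subn0 mulr_natl.
move=> t _; rewrite integral_indic//; last exact: visit_measurable.
by rewrite setIT fineK ?fin_num_measure//; exact: visit_measure.
Qed.

(** If every orbit outside N has an initial window of which a proportion at most e
    is spent in E, then such windows tile the orbits, and E has measure at most
    e, up to the error coming from the exceptional points. *)
Lemma covering (E N : set T) (e eta : R) : measurable E -> measurable N ->
  0 <= e -> 0 < eta -> (P N <= eta%:E)%E ->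
  (forall x, ~ N x -> exists W, (0 < W)%N /\
     \sum_(0 <= t < W) \1_(visit E t) x <= e * W%:R :> R) ->
  fine (P E) <= e + 3 * eta.
Proof.
move=> mE mN e0 eta0 PN good.
(* The points with a good window of length W, and of length at most L. *)
pose Q1 W : set T := [set x | \sum_(0 <= t < W) \1_(visit E t) x <= e * W%:R :> R].
have mQ1 W : measurable (Q1 W).
  have mS : measurable_fun [set: T] (fun x => \sum_(0 <= t < W) \1_(visit E t) x : R).
    by apply: measurable_sum => t; apply/measurable_indic/visit_measurable.
  rewrite (_ : Q1 W = (fun x => \sum_(0 <= t < W) \1_(visit E t) x : R) @^-1`
    [set` `]-oo, e * W%:R]]).
    by rewrite -[_ @^-1` _]setTI; apply: mS.
  by apply/seteqP; split => x; rewrite /= in_itv.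
pose Q L : set T := \bigcup_(W in [set W | (0 < W <= L)%N]) Q1 W.
have mQ L : measurable (Q L) by apply: bigcup_measurable.
have ndQ : nondecreasing_seq Q.
  move=> L L' LL'; apply/subsetPset => x [W /= WL QW]; exists W => //=.
  by move: WL; lia.
have mUQ : measurable (\bigcup_L Q L) by apply: bigcup_measurable.
have QN : ~` N `<=` \bigcup_L Q L.
  by move=> x /good[W [W0 QW]]; exists W => //; exists W => //=; rewrite W0 leqnn.
have PUQ : ((1 - eta)%:E <= P (\bigcup_L Q L))%E.
  apply: (@le_trans _ _ (P (~` N))); last first.
    by rewrite le_measure ?inE//; exact: measurableC.
  by rewrite probability_setC// EFinB leeB.
have [L PQL] : exists L, 1 - 2 * eta <= fine (P (Q L)).
  have cv : fine \o (P \o Q) @ \oo --> fine (P (\bigcup_L Q L)).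
    apply: fine_cvg; rewrite fineK ?fin_num_measure//.
    exact: nondecreasing_cvg_mu.
  have lt1 : 1 - 2 * eta < fine (P (\bigcup_L Q L)).
    have : 1 - eta <= fine (P (\bigcup_L Q L)).
      by rewrite -lee_fin fineK ?fin_num_measure.
    lra.
  have /cvgrPdist_lt/(_ (fine (P (\bigcup_L Q L)) - (1 - 2 * eta))) := cv.
  rewrite subr_gt0 => /(_ lt1)[L _ /(_ L (leqnn L))] /=.
  rewrite ltr_norml => /andP[_ ?]; exists L; lra.
have PQc : fine (P (~` Q L)) <= 2 * eta.
  rewrite probability_setC// fineB ?fin_num_measure//=; lra.
have bound H : H%:R * fine (P E) <= e * H%:R + L%:R + H%:R * (2 * eta).
  have pw x : \sum_(0 <= t < H) \1_(visit E t) x <=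
      e * H%:R + L%:R + \sum_(0 <= t < H) \1_(visit (~` Q L) t) x :> R.
    apply: tiling => // [t|t].
      by rewrite indicE; case: (_ \in _); rewrite /= ?ler01 ?lexx.
    rewrite !indicE; have [xt|nxt] := pselect (Q L (iter t f x)); last first.
      by left; rewrite mem_set.
    right; have [W /= WL QW] := xt; exists W; split => //.
    apply: le_trans QW; rewrite -{1}[t]add0n big_addn addKn le_eqVlt; apply/orP; left.
    apply/eqP; apply: eq_bigr => s _; rewrite !indicE; congr (_%:R); congr nat_of_bool.
    by apply/idP/idP; rewrite !inE /visit /preimage /= iterD.
  pose S F x : \bar R := (\sum_(0 <= t < H) (\1_(visit F t) x : R)%:E)%E.
  have mS F : measurable F -> measurable_fun setT (S F).
    move=> mF; apply: emeasurable_sum => t.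
    by apply/measurable_EFinP/measurable_indic/visit_measurable.
  have mQc : measurable (~` Q L) by exact: measurableC.
  have S0 F x : (0 <= S F x)%E by apply: sume_ge0 => t _; rewrite lee_fin.
  have c0 : 0 <= e * H%:R + L%:R by rewrite addr_ge0// mulr_ge0.
  have le : (\int[P]_x S E x <=
      \int[P]_x ((e * H%:R + L%:R)%:E + S (~` Q L) x))%E.
    apply: ge0_le_integral => //.
    - exact: mS.
    - by apply: emeasurable_funD => //; exact: mS.
    - by move=> x _; rewrite /S !sumEFin -EFinD lee_fin; exact: pw.
  have iE := integral_visits H mE; have iQ := integral_visits H mQc.
  move: le; rewrite ge0_integralD//; last exact: mS.
  have iC : (\int[P]_x (e * H%:R + L%:R)%:E = (e * H%:R + L%:R)%:E :> \bar R)%E.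
    transitivity ((e * H%:R + L%:R)%:E * P setT)%E; first exact: integral_cst.
    by rewrite -[RHS]mule1; congr (_ * _)%E; exact: probability_setT.
  rewrite [X in (X <= _)%E]iE [X in (_ <= _ + X)%E]iQ [X in (_ <= X + _)%E]iC.
  rewrite -EFinD lee_fin => /le_trans; apply.
  by rewrite lerD2l ler_wpM2l.
rewrite -subr_le0; apply/ler_addgt0Pr => z z0; rewrite add0r.
pose H := (Num.bound (L%:R / z)).+1.
have Hz : L%:R <= H%:R * z.
  have : L%:R / z < H%:R.
    by apply: lt_trans (archi_boundP _) _; rewrite ?ltr_nat// divr_ge0// ltW.
  by rewrite ltr_pdivrMr// => /ltW.
have HR : 0 < H%:R :> R by rewrite ltr0n.
have b := bound H.
have eta_ge0 : 0 <= H%:R * eta by rewrite mulr_ge0 ?ltW.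
rewrite -(ler_pM2l HR); move: Hz b eta_ge0; move: (H%:R) (fine _) => u v.
lra.
Qed.

End covering.

(** * Random compacts that are not countable *)

Section uncountable_case.
Variable R : realType.
Local Notation X := (chacon_system R).
Local Notation K := (borel_hyperspace X).
Implicit Types (A B : K) (x y : chacon_space).

Definition block_free m : set K :=
  [set B | forall b, hset B b -> ~~ occurs (pt_seq b) m 0].

Lemma iter_induced_mapE t A :
  hset (iter t (@induced_map R X) A) = chacon_shift_by t%:Z @` hset A.
Proof.
elim: t => [|t IHt].
  apply/seteqP; split => [a Aa|_ [a Aa <-]].
    by exists a => //; apply/pt_seq_inj/funext => i; rewrite /pt_seq /= /shift_by addr0.
  by rewrite (_ : chacon_shift_by 0 a = a)//; apply/pt_seq_inj/funext => i; rewrite /pt_seq /= /shift_by addr0.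
have sE a : chacon_shift_by 1 (chacon_shift_by t%:Z a) = chacon_shift_by t.+1%:Z a.
  by apply/pt_seq_inj/funext => i; rewrite /pt_seq /= /shift_by; congr (set_val a _); lia.
rewrite iterS induced_mapE IHt; apply/seteqP; split => [_ [_ [a Aa <-] <-]|_ [a Aa <-]].
  by exists a; rewrite ?sE.
by exists (chacon_shift_by t%:Z a); rewrite ?sE//; exists a.
Qed.

Lemma occurs_shift_by x m (t u : int) :
  occurs (pt_seq (chacon_shift_by t x)) m u = occurs (pt_seq x) m (u + t).
Proof.
apply: eq_in_all => i _; congr (_ == _).
by rewrite /pt_seq /= /shift_by; congr (set_val x _); lia.
Qed.

Lemma block_free_window A m (e : R) : ~ countable (hset A) -> 0 < e ->
  4 <= e * (h m)%:R -> exists W, (0 < W)%N /\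
  \sum_(0 <= t < W) \1_(visit (@induced_map R X) (block_free m) t) A <= e * W%:R :> R.
Proof.
move=> uncA e0 em.
have SX (s : int -> bool) : (pt_seq @` hset A) s -> locally_chacon s.
  by move=> [a Aa <-]; exact/chacon_locally/pt_seqP.
have uncS : ~ countable (pt_seq @` hset A).
  apply: contra_not uncA => /countable_injP[f finj].
  apply/countable_injP; exists (f \o pt_seq) => a b aA bA /= fab.
  apply: pt_seq_inj; apply: finj fab; rewrite inE.
    by exists a => //; rewrite inE in aA.
  by exists b => //; rewrite inE in bA.
have [x [xS xI xO]] := uncountable_orbits SX uncS.
have [k [W [W0 WK]]] := rare_misses e0 em (fun i => SX _ (xS i)) xI xO.
exists W; split => //; apply: le_trans WK; rewrite natr_sum big_mkord.
apply: ler_sum => t _; rewrite indicE ler_nat.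
case: (boolP (A \in _)) => //; rewrite inE /visit /preimage /block_free /= => At.
suff -> : missed k m x t%:Z by [].
apply/forallP => i; have [a Aa <-] := xS i.
rewrite -[t%:Z]add0r -occurs_shift_by; apply: At.
by rewrite iter_induced_mapE; exists a.
Qed.

(** An iterate of A that contains a point starting with an m-block hits the
    cylinder a fixed time later, because m is a level whose block contains the word
    of x. By [rare_misses] most iterates of an uncountable A are like this, and the
    countable A are covered by a measurable set of measure at most e, since they are
    null for the completion. *)
Lemma hits_cyl_ae (mu : probability K R) n x : is_IRC mu -> countable_null mu ->
  mu (~` hits (cyl n x)) = 0%E.
Proof.
move=> irc null.
have mH : measurable (~` hits (cyl n x) : set K).
  by apply: measurableC; exact: hits_cyl_measurable.
have mf := @induced_map_measurable R.
suff small (e : R) : 0 < e -> fine (mu (~` hits (cyl n x))) <= 4 * e.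
  have f0 : fine (mu (~` hits (cyl n x))) = 0.
    apply/eqP; rewrite eq_le fine_ge0// andbT; apply/ler_addgt0Pr => z z0.
    by rewrite add0r; have := small (z / 4); rewrite divr_gt0// => /(_ isT); lra.
  by rewrite -[LHS]fineK ?fin_num_measure// f0.
move=> e0.
have [m [p [mB mp]]] := chacon_occurs n (pt_seqP x) (Num.bound (4 / e)).
have em : 4 <= e * (h m)%:R.
  have : 4 / e < (h m)%:R.
    apply: lt_trans (archi_boundP _) _; first by rewrite divr_ge0// ltW.
    by rewrite ltr_nat; apply: leq_ltn_trans mB (h_gt m).
  by rewrite ltr_pdivrMr// => /ltW; rewrite mulrC.
pose E := visit (@induced_map R X) (~` hits (cyl n x)) (p + n).
have mE : measurable E by exact: visit_measurable.
have muE : mu E = mu (~` hits (cyl n x)) by exact: visit_measure.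
have Efree : E `<=` block_free m.
  move=> B EB b Bb; apply/negP => ob; apply: EB.
  exists (chacon_shift_by (p + n)%N%:Z b); split.
    by rewrite iter_induced_mapE; exists b.
  move=> i iln; have := mp _ _ ob i iln; rewrite /pt_seq /= /shift_by => <-.
  by congr (set_val b _); lia.
have [N mN [PN KN]] : exists2 N : set K, measurable N &
    (mu N <= e%:E)%E /\ @countable_compacts R X `<=` N.
  have : (mu_ext mu (@countable_compacts R X) < e%:E)%E.
    by rewrite (_ : mu_ext mu _ = 0%E) ?lte_fin.
  move=> /ereal_inf_lt[_ [F [mF KF] <-] Fe].
  exists (\bigcup_k F k); first exact: bigcup_measurable.
  split => //; apply: ltW; apply: le_lt_trans Fe.
  apply: generalized_Boole_inequality; first exact: mF.
  exact: bigcup_measurable.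
rewrite -muE.
have := @covering _ K R mu (@induced_map R X) mf irc E N e e mE mN (ltW e0) e0 PN.
have good A : ~ N A -> exists W, (0 < W)%N /\
    \sum_(0 <= t < W) \1_(visit (@induced_map R X) E t) A <= e * W%:R :> R.
  move=> NA; have uncA : ~ countable (hset A) by move=> cA; apply: NA; exact: KN.
  have [W [W0 WA]] := block_free_window uncA e0 em.
  exists W; split => //; apply: le_trans WA; apply: ler_sum => t _.
  rewrite !indicE ler_nat; case: (boolP (A \in _)) => //; rewrite inE => EA.
  by rewrite mem_set//; exact: Efree.
by move=> /(_ good); lra.
Qed.

Lemma cyl_countable n : exists c : nat -> set chacon_space,
  forall x, exists i, c i = cyl n x.
Proof.
exists (fun i => word_set n (odflt [::] (unpickle i))) => x.
exists (pickle (word n x)); rewrite pickleK /=.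
apply/seteqP; split => [y /word_agree/agree_sym//|y /agree_sym xy].
exact/word_agree.
Qed.

Lemma whole_spaceP A : (forall n x, hits (cyl n x) A) -> A = whole_space X.
Proof.
move=> hA; apply: hyperspace_eq; apply/seteqP; split => // x _.
by apply: hset_closed => n; exact: hA.
Qed.

Lemma not_wholeE : [set A : K | A <> whole_space X] =
  \bigcup_n \bigcup_(x in [set: chacon_space]) ~` hits (cyl n x).
Proof.
apply/seteqP; split => [A nA|A [n _ [x _ nx]] AX].
  apply: contrapT => nh; apply: nA; apply: whole_spaceP => n x.
  by apply: contrapT => nx; apply: nh; exists n => //; exists x.
by apply: nx; rewrite AX; exists x; split.
Qed.

(** As a countable union, the set of compacts other than X is measurable,
    and is null as soon as the complements of the cylinder events are. *)
Lemma not_whole_cover : exists H : nat -> set K,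
  [set A : K | A <> whole_space X] = \bigcup_i H i /\
  forall i, H i = set0 \/ exists n x, H i = ~` hits (cyl n x).
Proof.
have /choice[c cP] : forall n, exists c : nat -> set chacon_space,
    forall x, exists i, c i = cyl n x := cyl_countable.
pose H i := if unpickle i is Some (n, j) then
  if `[< exists x, c n j = cyl n x >] then ~` hits (R := R) (c n j) else set0
  else set0.
exists H; split; last first.
  move=> i; rewrite /H; case: unpickle => [[n j]|]; last by left.
  by case: asboolP => [[x cx]|nx]; [right; exists n, x; rewrite cx|left].
rewrite not_wholeE; apply/seteqP; split => [A [n _ [x _ nx]]|A [i _]].
  have [j cj] := cP n x; exists (pickle (n, j)) => //; rewrite /H pickleK.
  by case: asboolP => [ex|nex]; [rewrite cj|case: nex; exists x].
rewrite /H; case: unpickle => [[n j]|//]; case: asboolP => [[x cx]|//] nx.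
by exists n => //; exists x => //; rewrite -cx.
Qed.

Lemma not_whole_measurable : measurable [set A : K | A <> whole_space X].
Proof.
have [H [-> HP]] := not_whole_cover; apply: bigcup_measurable => i _.
have [->|[n [x ->]]] := HP i; first exact: measurable0.
by apply: measurableC; exact: hits_cyl_measurable.
Qed.

Lemma is_dirac_wholeP (mu : probability K R) :
  mu [set A : K | A <> whole_space X] = 0%E -> is_dirac_whole mu.
Proof.
move=> mu0 E mE; rewrite diracE.
have mN := not_whole_measurable.
have null F : measurable F -> F `<=` [set A : K | A <> whole_space X] -> mu F = 0%E.
  move=> mF FN; apply/eqP; rewrite -measure_le0 -[leRHS]mu0.
  by apply: le_measure => //; rewrite inE.
have [EX|nEX] := boolP (whole_space X \in E); last first.
  by apply: null => // A EA AX; move: nEX; rewrite -AX mem_set.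
have muC : mu (~` E) = 0%E.
  apply: null; first exact: measurableC.
  by move=> A nEA AX; apply: nEA; rewrite AX; rewrite inE in EX.
have := probability_setC mu (measurableC mE).
by rewrite setCK muC sube0.
Qed.

Lemma IRC_dirac (mu : probability K R) : is_IRC mu -> countable_null mu ->
  is_dirac_whole mu.
Proof.
move=> irc null; apply: is_dirac_wholeP.
have [H [HE HP]] := not_whole_cover.
have H0 i : mu (H i) = 0%E.
  by have [->|[n [x ->]]] := HP i; [rewrite measure0|exact: hits_cyl_ae].
have mHi i : measurable (H i).
  have [->|[n [x ->]]] := HP i; first exact: measurable0.
  by apply: measurableC; exact: hits_cyl_measurable.
apply/eqP; rewrite -measure_le0 HE.
have /le_trans -> // : (mu (\bigcup_i H i) <= \sum_(0 <= i <oo) mu (H i))%E.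
  by apply: generalized_Boole_inequality => //; exact: bigcup_measurable.
by rewrite eseries0.
Qed.

End uncountable_case.

(** * Measures determined by clopen sets *)

Lemma fmap_ultra (S T : Type) (f : S -> T) (U : set_system S) :
  UltraFilter U -> UltraFilter (f @ U).
Proof.
move=> UU; split; first exact: fmap_proper_filter.
move=> G PG UG; apply/seteqP; split => // A GA.
have [//|UA] := in_ultra_setVsetC (f @^-1` A) UU.
have : G (A `&` ~` A) by apply: filterI => //; exact: UG.
by rewrite setICr => /filter_ex[].
Qed.

(** A bounded sequence converges along every ultrafilter, by compactness. *)
Lemma ultra_cvg (R : realType) (U : set_system nat) (u : nat -> R) :
  UltraFilter U -> (forall n, 0 <= u n <= 1) -> exists l : R, u @ U --> l.
Proof.
move=> UU u01.
have := @segment_compact R 0 1; rewrite compact_ultra.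
move=> /(_ (u @ U) (fmap_ultra u UU))[].
  by apply: (@filterS _ U _ setT); [move=> n _ /=; rewrite in_itv /=|exact: filterT].
by move=> l [_ ul]; exists l.
Qed.

(** The alias carries the algebra of clopen sets as its measurable sets, on which
    the extension of a content starts. *)
Definition clopen_alias (T : Type) : Type := T.

Section clopen_ring.
Variable T : ptopologicalType.
HB.instance Definition _ := Pointed.copy (clopen_alias T) T.

Fact clopen_display : measure_display. Proof. by []. Qed.

Lemma clopen_setC (A : set T) : clopen A -> clopen (~` A).
Proof. exact: clopenC. Qed.

HB.instance Definition _ := @isAlgebraOfSets.Build clopen_display (clopen_alias T)
  (@clopen T) (@clopen0 T) (@clopenU T) clopen_setC.
End clopen_ring.

Section clopen_measure.
Variables (T : ptopologicalType) (R : realType) (m : set T -> R).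
Hypothesis Tc : compact [set: T].
Hypothesis m0 : forall D, 0 <= m D.
Hypothesis m1 : m setT = 1.
Hypothesis mU : forall C D, clopen C -> clopen D -> C `&` D = set0 ->
  m (C `|` D) = m C + m D.

Lemma clopen_bigU (F : nat -> set T) n : (forall k, clopen (F k)) ->
  clopen (\big[setU/set0]_(k < n) F k).
Proof.
by move=> Fc; elim/big_ind : _ => //; [exact: clopen0|exact: clopenU].
Qed.

Lemma clopen_content0 : m set0 = 0.
Proof.
by apply: (addrI (m set0)); rewrite -mU ?set0I ?setU0 ?addr0//; exact: clopen0.
Qed.

Lemma clopen_content_sum (F : nat -> set T) n : (forall k, clopen (F k)) ->
  trivIset setT F -> m (\big[setU/set0]_(k < n) F k) = \sum_(k < n) m (F k).
Proof.
move=> Fc Ft; elim: n => [|n IHn]; first by rewrite !big_ord0 clopen_content0.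
rewrite !big_ord_recr /= mU ?IHn//; first exact: clopen_bigU.
rewrite -bigcup_mkord; apply/seteqP; split => // x [[k /= kn Fkx] Fnx].
have kE : k = n by apply: Ft => //; exists x.
by rewrite kE ltnn in kn.
Qed.

(** A closed subset of a compact space is compact. *)
Lemma clopen_bigcup_finite (F : nat -> set T) : (forall k, clopen (F k)) ->
  clopen (\bigcup_k F k) -> exists N, \bigcup_k F k `<=` \big[setU/set0]_(k < N) F k.
Proof.
move=> Fc [_ Fcl]; have := subclosed_compact Fcl Tc (@subsetT _ _).
rewrite compact_cover => /(_ nat setT F)[||D _ FD]//.
  by move=> k _; exact: (Fc k).1.
have [N DN] := fset_bounded D S; exists N => x /FD[k kD Fx].
by rewrite -bigcup_mkord; exists k => //=; exact: DN.
Qed.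

Definition clopen_mu (D : set (clopen_alias T)) : \bar R := (m D)%:E.

Lemma clopen_mu_sigma_additive : semi_sigma_additive clopen_mu.
Proof.
move=> F Fc Ft UFc; have [N FN] := clopen_bigcup_finite Fc UFc.
apply: cvg_near_cst; exists N => // n /= Nn.
rewrite sumEFin big_mkord -clopen_content_sum//; congr (m _)%:E.
rewrite -bigcup_mkord; apply/seteqP; split => [x [k _ Fx]|x /FN]; first by exists k.
rewrite -bigcup_mkord => -[k /= kN Fx]; exists k => //=; exact: leq_trans kN Nn.
Qed.

HB.instance Definition _ := isMeasure.Build _ _ _ clopen_mu
  (congr1 EFin clopen_content0) (fun D => m0 D) clopen_mu_sigma_additive.

(** Caratheodory's extension. Countable additivity on the clopen sets holds by
    [clopen_bigcup_finite]: when disjoint clopen sets have a clopen union, all but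
    finitely many of them are empty. *)
Lemma clopen_measure_exists :
  exists P : probability (g_sigma_algebraType (@clopen T)) R,
    forall D, clopen D -> P D = (m D)%:E.
Proof.
pose mu : {measure set (clopen_alias T) -> \bar R} := clopen_mu.
have muE D : clopen D -> measure_extension mu D = (m D)%:E.
  by move=> Dc; rewrite /measure_extension /= measurable_mu_extE.
have nuT : measure_extension mu setT = 1%E by rewrite muE ?m1//; exact: clopenT.
pose P : probability (g_sigma_algebraType (@clopen T)) R :=
  HB.pack_for (probability (g_sigma_algebraType (@clopen T)) R)
   (measure_extension mu)
   (@Measure_isProbability.Build _ _ _ (measure_extension mu) nuT).
by exists P.
Qed.

End clopen_measure.

(** * Existence of invariant measures *)

Section frequencies.
Variables (T : Type) (R : realType) (f : T -> T) (x : T).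
Implicit Types C D : set T.

Definition frequency D N : R := (\sum_(t < N.+1) \1_D (iter t f x)) / N.+1%:R.

Lemma frequency_ge0_le1 D N : 0 <= frequency D N <= 1.
Proof.
rewrite divr_ge0 ?sumr_ge0//= ler_pdivrMr ?ltr0Sn// mul1r.
have <- : \sum_(t < N.+1) 1 = N.+1%:R :> R by rewrite sumr_const card_ord.
by apply: ler_sum => t _; rewrite indicE lern1 leq_b1.
Qed.

Lemma frequencyU C D N : C `&` D = set0 ->
  frequency (C `|` D) N = frequency C N + frequency D N.
Proof.
move=> CD; rewrite -mulrDl -big_split /=; congr (_ / _); apply: eq_bigr => t _.
rewrite !indicE in_setU; have [tC|] := boolP (_ \in C); have [tD|] := boolP (_ \in D) => //=.
- exfalso; suff : (C `&` D) (iter t f x) by rewrite CD.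
  by split; [move: tC|move: tD]; rewrite inE.
- by rewrite addr0.
- by rewrite add0r.
- by rewrite addr0.
Qed.

Lemma frequencyT N : frequency setT N = 1.
Proof.
rewrite /frequency (eq_bigr (fun=> 1)) => [|t _]; last by rewrite indicT.
by rewrite sumr_const card_ord divff ?pnatr_eq0.
Qed.

Lemma frequency_preimage D N :
  `|frequency D N - frequency (f @^-1` D) N| <= N.+1%:R^-1.
Proof.
have E : \sum_(t < N.+1) \1_D (iter t f x) + \1_D (iter N.+1 f x) =
    \1_D x + \sum_(t < N.+1) \1_(f @^-1` D) (iter t f x) :> R.
  by rewrite -(big_ord_recr N.+1 (fun t : 'I_N.+2 => \1_D (iter t f x))) big_ord_recl.
rewrite -mulrBl normrM [X in _ * X]ger0_norm ?invr_ge0//.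
rewrite ler_piMl ?invr_ge0//.
have : 0 <= (\1_D x : R) <= 1 by rewrite indicE; case: (_ \in _); rewrite /= ?lexx ?ler01.
have : 0 <= (\1_D (iter N.+1 f x) : R) <= 1.
  by rewrite indicE; case: (_ \in _); rewrite /= ?lexx ?ler01.
by move: E; rewrite ler_norml; move=> E /andP[? ?] /andP[? ?]; apply/andP; split; lra.
Qed.

End frequencies.

(** The method of Krylov and Bogoliubov. Limits along one ultrafilter exist for
    the frequencies of all sets at the same time, and are additive; invariance
    holds because a set and its preimage have frequencies that differ by at most
    1 / N. *)
Lemma invariant_probability (T : ptopologicalType) (R : realType) (f : T -> T) :
  compact [set: T] -> continuous f ->
  exists P : probability (g_sigma_algebraType (@clopen T)) R,
    forall E : set (g_sigma_algebraType (@clopen T)), measurable E ->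
      P [set x : T | E (f x)] = P E.
Proof.
move=> Tc fc.
have [U [UU oU]] := ultraFilterLemma eventually_filter.
have PU : ProperFilter U by exact: ultra_proper.
have /choice[m mP] : forall D : set T, exists l : R, frequency R f point D @ U --> l.
  by move=> D; apply: ultra_cvg => n; exact: frequency_ge0_le1.
have m_eq D l : frequency R f point D @ U --> (l : R) -> m D = l.
  by move=> Dl; apply: (cvg_unique _ (mP D) Dl); exact: norm_hausdorff.
have m0 D : 0 <= m D.
  rewrite -(cvg_lim (@norm_hausdorff _ R) (mP D)); apply: limr_ge.
    by apply/cvg_ex; exists (m D).
  by apply: (@filterS _ U _ setT); [move=> n _; case/andP: (frequency_ge0_le1 R f point D n)|exact: filterT].
have m1 : m setT = 1.
  apply: m_eq; rewrite (_ : frequency _ _ _ _ = cst 1); first exact: cvg_cst.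
  by apply/funext => n; rewrite frequencyT.
have mU C D : clopen C -> clopen D -> C `&` D = set0 -> m (C `|` D) = m C + m D.
  move=> _ _ CD; apply: m_eq.
  rewrite (_ : frequency _ _ _ _ = frequency R f point C \+ frequency R f point D).
    exact: cvgD.
  by apply/funext => n; exact: frequencyU.
have mf D : m (f @^-1` D) = m D.
  apply: m_eq.
  pose d n := frequency R f point D n - frequency R f point (f @^-1` D) n.
  have dn : `|d n| @[n --> \oo] --> (0 : R).
    apply: (@squeeze_cvgr _ _ _ _ (cst 0) (@harmonic R)); [|exact: cvg_cst|exact: cvg_harmonic].
    by near=> n; rewrite normr_ge0 /=; exact: frequency_preimage.
  have d0 : d @ U --> (0 : R).
    by move=> A A0; apply: oU; exact: (norm_cvg0 dn).
  rewrite -[m D]subr0 (_ : frequency _ _ _ _ = frequency R f point D \- d).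
    exact: (cvgB (mP D) d0).
  by apply/funext => n /=; rewrite /d subKr.
have [P Pm] := clopen_measure_exists Tc m0 m1 mU.
have fclopen D : clopen D -> clopen (f @^-1` D).
  by move=> Dc; apply: (@preimage_clopen T T f D).
have mf' : measurable_fun [set: g_sigma_algebraType (@clopen T)]
    (f : g_sigma_algebraType (@clopen T) -> g_sigma_algebraType (@clopen T)).
  apply: (@measurability _ _ (g_sigma_algebraType (@clopen T)) (g_sigma_algebraType (@clopen T)) setT _ (@clopen T)) => // _ [D Dc <-].
  by rewrite setTI; apply: sub_sigma_algebra; exact: fclopen.
exists P => E mE.
pose Q := distribution P (mfun_Sub (mem_set mf')).
have -> : P [set x : T | E (f x)] = Q E by [].
apply: (@measure_unique _ R (g_sigma_algebraType (@clopen T)) (@clopen T) (fun=> setT) _ _ _ _ Q P) => //.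
- exact: clopenI.
- by move=> _; exact: clopenT.
- by rewrite bigcup_const//; exists 0%N.
- move=> D Dc; have QD : Q D = (m D)%:E by rewrite -mf; exact: (Pm _ (fclopen _ Dc)).
  exact: etrans QD (esym (Pm _ Dc)).
- move=> k; have QT : Q setT = 1%E by exact: probability_setT.
  by apply: le_lt_trans (ltry (1 : R)); rewrite -QT.
Unshelve. all: by end_near. Qed.

(** * Measures on the Chacon subshift *)

Section invariant_measure.
Variable R : realType.
Local Notation Y := (g_sigma_algebraType (@clopen chacon_space)).
Implicit Types (x y : chacon_space) (D : set chacon_space).

(** Dependence on finitely many coordinates. *)
Definition determined D := exists n, forall x y, agree n x y -> D x -> D y.

Lemma determined_open D : determined D -> open D.
Proof.
move=> [n nD]; rewrite openE => x Dx.
apply/(@metricType_numDomainType.nbhs_mdistP R (chacon_system R)).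
exists (2 ^- n); first exact: pow2_gt0.
by move=> y /= /mdist_agree xy; exact: nD xy Dx.
Qed.

Lemma determinedC D : determined D -> determined (~` D).
Proof. by move=> [n nD]; exists n => x y xy nDx Dy; apply/nDx/(nD y) => //; exact: agree_sym. Qed.

Lemma determined_clopen D : determined D -> clopen D.
Proof.
move=> Dd; split; first exact: determined_open.
by rewrite -[D]setCK; apply: open_closedC; apply/determined_open/determinedC.
Qed.

Lemma determined_measurable D : determined D -> measurable (D : set Y).
Proof. by move=> /determined_clopen; exact: sub_sigma_algebra. Qed.

Lemma determined_shift D (t : int) : determined D ->
  determined (chacon_shift_by t @^-1` D).
Proof.
by move=> [n nD]; exists (n + absz t)%N => x y /agree_shift xy /=; exact: nD.
Qed.

Definition block_at n (t : int) : set chacon_space := [set x | occurs (pt_seq x) n t].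

Lemma block_at_determined n t : determined (block_at n t).
Proof.
exists (absz t + h n)%N => x y xy /= /occursP ox; apply/occursP => i ih.
by rewrite -ox//; apply/esym/xy => /=; lia.
Qed.

Lemma block_atS n (t u : int) : chacon_shift_by u @^-1` block_at n t = block_at n (t + u).
Proof. by apply/seteqP; split => x /=; rewrite /block_at /= occurs_shift_by. Qed.

Lemma cyl_determined n x : determined (cyl n x).
Proof. by exists n => y z yz xy; exact: agree_trans xy yz. Qed.

Variable P : probability Y R.
Hypothesis invP : forall E : set Y, measurable E ->
  P [set x : chacon_space | E (chacon_shift_by 1 x)] = P E.

Lemma block_at_measurable n t : measurable (block_at n t : set Y).
Proof. by apply: determined_measurable; exact: block_at_determined. Qed.

Lemma block_at_measure n t : P (block_at n t) = P (block_at n 0).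
Proof.
have S u : P (block_at n (u + 1)) = P (block_at n u).
  by rewrite -(invP (block_at_measurable n u)) -block_atS.
elim/int_rec: t => [//|k IH|k IH]; first by rewrite -addn1 PoszD S.
by rewrite -[RHS]IH -[in RHS](subrK 1 (- k%:Z)) S -addn1 PoszD opprD.
Qed.

(** The events that an n-block starts at 0, ..., h n - 1 are disjoint and
    have the same probability. *)
Lemma block_at_measure_le n t : (P (block_at n t) <= ((h n)%:R^-1)%:E)%E.
Proof.
rewrite block_at_measure.
pose F (i : nat) : set Y := if (i < h n)%N then block_at n i%:Z else set0.
have mF i : measurable (F i).
  by rewrite /F; case: ifP => // _; exact: block_at_measurable.
have tF : trivIset setT F.
  have lt_disj i j x : F i x -> F j x -> (i < j)%N -> False.
    rewrite /F; case: ifP => // ih xi; case: ifP => // jh xj ij.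
    have := occurs_sep (chacon_locally (pt_seqP x)) xi xj; lia.
  move=> i j _ _ [x [Fi Fj]]; have [ij|ji|//] := ltngtP i j.
    by case: (lt_disj i j x).
  by case: (lt_disj j i x).
have mU : measurable (\big[setU/set0]_(i < h n) F i).
  by apply: bigsetU_measurable => i _; exact: mF.
have := probability_le1 P mU.
rewrite (measure_bigsetU P mF tF (h n)).
rewrite (eq_bigr (fun=> P (block_at n 0))) => [|i _]; last first.
  by rewrite /F ltn_ord; exact: block_at_measure.
have /fineK <- : P (block_at n 0) \is a fin_num.
  by apply: fin_num_measure; exact: block_at_measurable.
rewrite sumEFin !lee_fin sumr_const card_ord -[_ *+ _]mulr_natr.
by rewrite -ler_pdivlMr ?ltr0n ?h_gt0// div1r.
Qed.

Lemma singleton_measurable x : measurable ([set x] : set Y).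
Proof.
rewrite (_ : [set x] = \bigcap_n cyl n x).
  by apply: bigcapT_measurable => n; apply: determined_measurable; exact: cyl_determined.
apply/seteqP; split => [y -> n _|y xy] //=.
apply/esym/pt_seq_inj/funext => i; exact: (xy (absz i) I i).
Qed.

(** For every n, the point lies in an event of probability at most 1 / h n. *)
Lemma singleton_measure x : P [set x] = 0%E.
Proof.
have mx := singleton_measurable x.
apply/eqP; rewrite -measure_le0; apply/lee_addgt0Pr => e e0; rewrite add0e.
have [a oa _] := occurs_cover (Num.bound e^-1) (chacon_locally (pt_seqP x)) 0.
apply: (@le_trans _ _ (P (block_at (Num.bound e^-1) a))).
  by apply: le_measure; rewrite ?inE//; [exact: block_at_measurable|move=> y ->].
apply: le_trans (block_at_measure_le _ _) _; rewrite lee_fin.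
rewrite invf_ple ?posrE ?ltr0n ?h_gt0//; apply: ltW.
apply: lt_le_trans (archi_boundP _) _; first by rewrite invr_ge0 ltW.
by rewrite ler_nat ltnW ?h_gt.
Qed.

Lemma chacon_uncountable : ~ countable [set: chacon_space].
Proof.
move=> /countable_injP[f finj].
pose F i : set Y := [set x | f x = i].
have F0 i : measurable (F i) /\ P (F i) = 0%E.
  have [[x fx]|nF] := pselect (exists x, f x = i); last first.
    rewrite (_ : F i = set0) ?measure0//; apply/seteqP; split => // x fx.
    by case: nF; exists x.
  rewrite (_ : F i = [set x]); first by split; [exact: singleton_measurable|exact: singleton_measure].
  by apply/seteqP; split => [y fy|y ->]//; apply: finj; rewrite ?inE// fy.
have : (P (\bigcup_i F i) <= \sum_(0 <= i <oo) P (F i))%E.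
  apply: generalized_Boole_inequality => [i|]; first exact: (F0 i).1.
  by apply: bigcup_measurable => i _; exact: (F0 i).1.
rewrite (_ : \bigcup_i F i = setT); last by apply/seteqP; split => // x _; exists (f x).
rewrite probability_setT eseries0 ?lee_fin ?ler10// => i _ _; exact: (F0 i).2.
Qed.

End invariant_measure.

Lemma invariant_chacon (R : realType) :
  exists P : probability (g_sigma_algebraType (@clopen chacon_space)) R,
  forall E : set (g_sigma_algebraType (@clopen chacon_space)), measurable E ->
  P [set x : chacon_space | E (chacon_shift_by 1 x)] = P E.
Proof.
exact: (invariant_probability R chacon_space_compact (@chacon_shift_by_continuous 1)).
Qed.

Section converse.
Variable R : realType.
Local Notation X := (chacon_system R).
Local Notation K := (borel_hyperspace X).

Lemma induced_whole : induced_map (whole_space X) = whole_space X.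
Proof.
apply: hyperspace_eq; apply/seteqP; split => // x _.
by exists (chacon_shift_by (- 1) x) => //; exact: chacon_shift_byNK.
Qed.

(** The countable compacts are contained in the Borel set of compacts other
    than X, which is null for the Dirac mass. *)
Lemma dirac_IRC (mu : probability K R) : is_dirac_whole mu ->
  is_IRC mu /\ countable_null mu.
Proof.
move=> muD; split=> [E mE|].
  have mfE : measurable (@induced_map R X @^-1` E).
    by rewrite -[_ @^-1` _]setTI; exact: induced_map_measurable.
  rewrite !muD// !diracE; congr ((_ : bool)%:R%:E).
  by apply/idP/idP; rewrite !inE /preimage /= induced_whole.
have [P invP] := invariant_chacon R.
have uncX := chacon_uncountable invP.
have mN := @not_whole_measurable R.
have mu0 : mu [set A : K | A <> whole_space X] = 0%E.
  by rewrite (muD _ mN) diracE memNset//; exact.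
have N0 := etrans (measurable_mu_extE mu mN) mu0.
 apply/eqP; rewrite eq_le mu_ext_ge0 ?andbT; last exact: measure_ge0.
rewrite -[leRHS]N0; apply: le_mu_ext => A /= cA AX; apply: uncX.
by rewrite AX in cA.
Qed.

End converse.

(** * A random compact built from the returns at the heights *)

(** The m-block at h k lies in the k-block that follows the one around the
    origin, and recurs h k or h k + 1 places before, unless the k-block around the
    origin starts at the origin or ends less than h m places after it. *)
Lemma occurs_recurs (x : int -> bool) m k : (m < k)%N -> locally_chacon x ->
  occurs x m (h k)%:Z ->
  [\/ occurs x m 0, occurs x m (- 1), occurs x k 0 |
      exists2 j, (j < h m)%N & occurs x k (j%:Z - (h k)%:Z)].
Proof.
move=> mk xX /occursP om; have [a oa /andP[a0 ak]] := occurs_cover k xX 0.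
have hm := h_gt0 m; have hk := h_gt0 k.
have [a0'|an0] := eqVneq a 0; first by rewrite a0' in oa; constructor 3.
have [short|long] := ltP (a + (h k)%:Z) (h m)%:Z.
  constructor 4; exists (absz (a + (h k)%:Z)%R); first lia.
  by rewrite (_ : _ - _ = a)//; lia.
have copy b (c : int) : occurs x k b -> b - a = (h k)%:Z - c -> - 1 <= c <= 0 ->
    occurs x m c.
  move=> /occursP ob ba c01; apply/occursP => i im; rewrite -om//.
  have [u uE] : exists u : nat, u%:Z = c + i%:Z - a.
    by exists (absz (c + i%:Z - a)%R); lia.
  have uk : (u < h k)%N by lia.
  move/occursP in oa.
  rewrite (_ : c + i%:Z = a + u%:Z); last lia.
  by rewrite oa// -ob//; congr (x _); lia.
case: (occurs_next xX oa) => [ob|[ob _]].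
  by constructor 1; apply: copy ob _ _; lia.
by constructor 2; apply: copy ob _ _; lia.
Qed.

Section far.
Variable R : realType.
Local Notation X := (chacon_system R).
Local Notation K := (borel_hyperspace X).
Local Notation Y := (g_sigma_algebraType (@clopen chacon_space)).
Implicit Types (x y z : chacon_space).

(** The closure of the points T^(h k) x, k >= 3. The first returns are left out
    because the estimate in [not_IC_rigid] needs 2 < k. *)
Definition far_set x : set chacon_space :=
  [set z | forall n, exists2 k, (3 <= k)%N & agree n z (chacon_shift_by (h k)%:Z x)].

Lemma far_set_mem x k : (3 <= k)%N -> far_set x (chacon_shift_by (h k)%:Z x).
Proof. by move=> k3 n; exists k. Qed.

Lemma far_set_compact x : compact (far_set x : set X).
Proof.
apply: subclosed_compact (system_compact X) _ => // z clz n.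
have /clz[y [fy zy]] : nbhs z [set y | agree n z y].
  apply: (@open_nbhs_nbhs X); split; last exact: agree_refl.
  apply: (@determined_open R); exact: cyl_determined.
by have [k k3 yk] := fy n; exists k => //; exact: agree_trans zy yk.
Qed.

Definition far x : K :=
  Hyperspace (ex_intro _ _ (@far_set_mem x 3 (leqnn 3))) (@far_set_compact x).

Lemma chacon_shift_byD (s t : int) x :
  chacon_shift_by s (chacon_shift_by t x) = chacon_shift_by (s + t) x.
Proof.
by apply/pt_seq_inj/funext => i; rewrite /pt_seq /= /shift_by addrA.
Qed.

Lemma far_equivariant x : induced_map (far x) = far (chacon_shift_by 1 x).
Proof.
apply: hyperspace_eq; apply/seteqP; split => [_ [z fz <-] n|z fz].
  have [k k3 zk] := fz (n + 1)%N; exists k => //.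
  by rewrite chacon_shift_byD addrC -chacon_shift_byD; exact: (@agree_shift n 1).
exists (chacon_shift_by (- 1) z); last exact: chacon_shift_byNK.
move=> n; have [k k3 zk] := fz (n + 1)%N; exists k => //.
have := @agree_shift n (- 1) _ _ zk.
rewrite !chacon_shift_byD (_ : _ + _ + 1 = (h k)%:Z)//; lia.
Qed.

Lemma far_infinite x : ~ finite_set (hset (far x)).
Proof.
have inj : injective (fun k => chacon_shift_by (h (k + 3))%:Z x).
  move=> k l kl; have hkl : (h (k + 3))%:Z - (h (l + 3))%:Z = 0.
    apply: (aperiodic (chacon_locally (pt_seqP x))) => u.
    have := congr1 (fun y => pt_seq y (u - (h (l + 3))%:Z)) kl.
    rewrite /pt_seq /= /shift_by subrK => <-.
    by congr (set_val x _); lia.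
  have hlt i j : (i < j)%N -> (h i < h j)%N.
    by move=> ij; apply: leq_trans (h_le ij); rewrite hS; lia.
  have [kl'|lk|//] := ltngtP k l.
    by have := @hlt (k + 3)%N (l + 3)%N; rewrite ltn_add2r => /(_ kl'); lia.
  by have := @hlt (l + 3)%N (k + 3)%N; rewrite ltn_add2r => /(_ lk); lia.
move=> fin; apply: infinite_nat.
pose f k := chacon_shift_by (h (k + 3))%:Z x.
have : finite_set (f @^-1` hset (far x)).
  by apply: finite_preimage fin; move=> k l _ _; exact: inj.
rewrite (_ : _ @^-1` _ = setT)//; apply/seteqP; split => // k _.
by apply: far_set_mem; rewrite leq_addl.
Qed.

Lemma hits_far (D : set chacon_space) x : determined D ->
  hits (R := R) D (far x) <-> exists2 k, (3 <= k)%N & D (chacon_shift_by (h k)%:Z x).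
Proof.
move=> [n nD]; split=> [[z [fz Dz]]|[k k3 Dk]].
  by have [k k3 zk] := fz n; exists k => //; exact: nD zk Dz.
by exists (chacon_shift_by (h k)%:Z x); split => //; exact: far_set_mem.
Qed.

Lemma hits_far_measurable D : determined D ->
  measurable ([set x : Y | hits (R := R) D (far x)]).
Proof.
move=> Dd; rewrite (_ : [set x | _] =
    \bigcup_(k in [set k | (3 <= k)%N]) (chacon_shift_by (h k)%:Z @^-1` D)).
  apply: bigcup_measurable => k _; apply: (@determined_measurable R).
  exact: determined_shift.
apply/seteqP; split => [x /(hits_far _ Dd)[k k3 Dk]|x [k k3 Dk]]; first by exists k.
by apply/(hits_far _ Dd); exists k.
Qed.

Lemma word_set_determined n s : determined (word_set n s).
Proof. by exists n => x y /word_agree xy <-. Qed.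

(** For fixed n these classes, one for each finite set of words, form a
    partition of the compacts. *)
Definition words_are n (F : seq (seq bool)) : set K :=
  [set A | forall s, s \in F <-> hits (word_set n s) A].

Lemma words_areP n A : exists F, words_are n F A.
Proof.
pose T := (2 * n).+1.-tuple bool.
exists [seq val s | s <- enum [set s : T | `[< hits (word_set n s) A >]]].
move=> s; split=> [/mapP[t]|hs].
  by rewrite mem_enum inE => /asboolP ht ->.
have ss : size s == (2 * n).+1.
  by have [a [_ <-]] := hs; rewrite /word size_subword.
apply/mapP; exists (Tuple ss) => //.
by rewrite mem_enum inE; apply/asboolP.
Qed.

Lemma words_are_same n F A B : words_are n F A -> words_are n F B ->
  same_words n A B.
Proof.
have half C D : words_are n F C -> words_are n F D ->
    forall c, hset C c -> exists2 d, hset D d & agree n c d.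
  move=> FC FD c Cc; have : hits (word_set n (word n c)) C by exists c.
  by move=> /FC/FD[d [Dd /esym/word_agree cd]]; exists d.
move=> FA FB; split; first exact: half.
by move=> b /(half _ _ FB FA)[a Aa /agree_sym ab]; exists a.
Qed.

Lemma far_words_measurable n F : measurable ([set x : Y | words_are n F (far x)]).
Proof.
pose E s : set Y := [set x | s \in F <-> hits (R := R) (word_set n s) (far x)].
have mE s : measurable (E s).
  have mH := hits_far_measurable (word_set_determined n s).
  have [sF|sF] := boolP (s \in F).
    rewrite (_ : E s = [set x | hits (R := R) (word_set n s) (far x)])//.
    by apply/seteqP; split => x; rewrite /E /= sF; [move=> [H _]; exact: H|move=> ?; split].
  rewrite (_ : E s = ~` [set x | hits (R := R) (word_set n s) (far x)]).
    exact: measurableC.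
  apply/seteqP; split => x; rewrite /E /= (negbTE sF).
    by move=> [_ H] /H.
  by move=> nH; split.
rewrite (_ : [set x | _] = \bigcap_i E (odflt [::] (unpickle i))).
  by apply: bigcapT_measurable => i; exact: mE.
apply/seteqP; split => [x Fx i _|x Ex s]; first exact: Fx.
have : E (odflt [::] (unpickle (pickle s))) x := Ex _ I.
by rewrite pickleK.
Qed.

(** An open set of compacts is a countable union of classes [words_are], and the
    preimage of such a class is a countable Boolean combination of open sets. *)
Lemma far_measurable : measurable_fun [set: Y] (far : Y -> K).
Proof.
apply: (@measurability _ _ Y K setT _ (@open (hyperspace X) : set (set K))) => // _ [ O Oo <-].
rewrite setTI.
pose F (i : nat) : set Y :=
  if unpickle i is Some (n, W) then
    if `[< words_are n W `<=` O >] then [set x : Y | words_are n W (far x)] else set0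
  else set0.
rewrite (_ : _ @^-1` _ = \bigcup_i F i); last first.
  apply/seteqP; split => [x Ox|x [i _]].
    have [n nO] := (open_words O).1 Oo _ Ox; have [W FW] := words_areP n (far x).
    exists (pickle (n, W)) => //; rewrite /F pickleK; case: asboolP => // -[].
    by move=> B WB; apply: nO; exact: words_are_same FW WB.
  by rewrite /F; case: unpickle => [[n W]|//]; case: asboolP => // WO /= /WO.
apply: bigcupT_measurable => i; rewrite /F; case: unpickle => [[n W]|]; last exact: measurable0.
by case: asboolP => _; [exact: far_words_measurable|exact: measurable0].
Qed.

Lemma hits_determined_measurable D : determined D -> measurable (hits D : set K).
Proof.
move=> [n nD]; apply: open_measurable_K; apply/open_words => A [a [Aa Da]].
exists n => B [AB _]; have [b Bb ab] := AB a Aa.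
by exists b; split => //; exact: nD ab Da.
Qed.

(** If the law of [far] were the Dirac mass at X, then [far x] would almost
    surely hit the set of points that start with a 2-block. By [occurs_recurs] this
    has probability at most 2 / h 2 plus the sum over k >= 3 of (h 2 + 1) / h k, and
    h 2 = 13. *)
Lemma not_IC_rigid : ~ IC_rigid X.
Proof.
move=> rigid; have [P invP] := invariant_chacon R.
pose mu : probability K R := distribution P (mfun_Sub (mem_set far_measurable)).
have muE (E : set K) : mu E = P [set x : chacon_space | E (far x)] by [].
have irc : is_IRC mu.
  move=> E mE; have mfE : measurable ([set x | E (far x)] : set Y).
    by have := far_measurable measurableT mE; rewrite setTI.
  rewrite !muE -(invP _ mfE).
  by congr (P _); apply/funext => x; rewrite /preimage /= far_equivariant.
have nonfin : nonfinitary mu.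
  rewrite /nonfinitary muE (_ : [set x | _] = set0) ?measure0//.
  by apply/seteqP; split => // x /far_infinite.
have dirac := (rigid mu).1 (conj irc nonfin).
pose D := block_at 2 0.
have Dd : determined D by exact: block_at_determined.
have hit1 : mu (hits (R := R) D) = 1%E.
  rewrite dirac ?diracE; last exact: hits_determined_measurable.
  rewrite mem_set//; have [a oa _] := occurs_cover 2 (chacon_locally (pt_seqP point)) 0.
  by exists (chacon_shift_by a point); split => //; rewrite /D /block_at /= occurs_shift_by add0r.
pose B k (j : nat) : set Y := block_at k (if (j < 13)%N then j%:Z - (h k)%:Z else 0).
(* The last two cases of [occurs_recurs]: j < h 2 = 13, and the origin itself. *)
pose V k : set Y := \big[setU/set0]_(j < 14) B k j.
have mV k : measurable (V k).
  by apply: bigsetU_measurable => j _; exact: (@block_at_measurable R).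
have PV k : (P (V k) <= (14 / (3 ^ k)%:R)%:E)%E.
  apply: (@le_trans _ _ (\sum_(j < 14) P (B k j))%E).
    by apply: (Boole_inequality P) => j _; exact: (@block_at_measurable R).
  apply: (@le_trans _ _ (\sum_(j < 14) ((3 ^ k)%:R^-1)%:E)%E).
    apply: lee_sum => j _; apply: le_trans (block_at_measure_le invP _ _) _.
    rewrite lee_fin lef_pV2 ?posrE ?ltr0n ?h_gt0 ?expn_gt0// ler_nat.
    by have := h_expn k; rewrite expnS; have := expn_gt0 3 k; lia.
  by rewrite sumEFin lee_fin sumr_const card_ord -[_ *+ _]mulr_natl.
pose Z i : set Y := if i is i'.+2 then V i.+1 else block_at 2 (- i%:Z).
pose w i : R := if i is i'.+2 then 14 / (3 ^ i.+1)%:R else (13%:R)^-1.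
have mZ i : measurable (Z i).
  by case: i => [|[|i]]; [exact: (@block_at_measurable R)..|exact: mV].
have PZ i : (P (Z i) <= (w i)%:E)%E.
  by case: i => [|[|i]]; [exact: (block_at_measure_le invP 2)..|exact: PV].
(* A geometric series: 14 / 3 ^ 3 * (3 / 2) = 7 / 9. *)
have wS n : \sum_(0 <= i < n.+2) w i <= 2 / 13 + 7 / 9 - 7 / 9 / (3 ^ n)%:R.
  elim: n => [|n IHn]; first by rewrite !big_nat_recr//= big_geq//=; lra.
  rewrite big_nat_recr//= !expnS !natrM !invfM; move: IHn.
  by move: (\sum_(0 <= i < n.+2) _) ((3 ^ n)%:R^-1) => u v; lra.
have wC n : \sum_(0 <= i < n) w i <= 1 - 18^-1.
  apply: (@le_trans _ _ (\sum_(0 <= i < n.+2) w i)).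
    rewrite !big_nat_recr//= -addrA lerDl addr_ge0//.
    - by case: n => [|[|n]]; rewrite /w ?divr_ge0 ?invr_ge0.
    - by case: n => [|n]; rewrite /w ?divr_ge0 ?invr_ge0.
  apply: le_trans (wS n) _; have : 0 <= ((3 ^ n)%:R)^-1 :> R by rewrite invr_ge0.
  by move: ((3 ^ n)%:R^-1) => v; lra.
have cover : [set x : Y | hits (R := R) D (far x)] `<=` \bigcup_i Z i.
  move=> x /= /(hits_far _ Dd)[k k3].
  rewrite /D /block_at /= occurs_shift_by add0r => ok.
  case: (occurs_recurs k3 (chacon_locally (pt_seqP x)) ok) => [ o0| o1| o|[j j13 o]].
  - by exists 0%N.
  - by exists 1%N.
  - exists k.-1 => //; case: k k3 ok o => [|[|[|k]]]// _ _ o.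
    by rewrite /Z /V -(bigcup_mkord 14 (B k.+3)); exists 13%N.
  - exists k.-1 => //; case: k k3 ok o => [|[|[|k]]]// _ _ o.
    rewrite /Z /V -(bigcup_mkord 14 (B k.+3)); exists j; first by rewrite /= ltnS ltnW.
    by rewrite /B j13.
have : (P (\bigcup_i Z i) <= (1 - 18^-1)%:E)%E.
  apply: le_trans (generalized_Boole_inequality P mZ (bigcupT_measurable _ mZ)) _.
  apply: lime_le; first exact: is_cvg_nneseries.
  near=> n; apply: (@le_trans _ _ (\sum_(0 <= i < n) (w i)%:E)%E).
    by apply: lee_sum => i _; exact: PZ.
  by rewrite sumEFin lee_fin.
have : (mu (hits (R := R) D) <= P (\bigcup_i Z i))%E.
  rewrite muE; apply: le_measure => //; rewrite inE.
    exact: hits_far_measurable.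
  exact: bigcupT_measurable.
rewrite hit1 => h1 h2; have := le_trans h1 h2; rewrite lee_fin.
by apply/negP; rewrite -ltNge; lra.
Unshelve. all: by end_near. Qed.
End far.

Theorem theorem1p2 (R : realType) :
  weakly_IC_rigid (chacon_system R) /\ ~ IC_rigid (chacon_system R).
Proof.
split; last exact: not_IC_rigid.
by move=> mu; split=> [[irc null]|]; [exact: IRC_dirac|exact: dirac_IRC].
Qed.
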